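(* Let $\widetilde\Lambda\subset\widehat{\mathrm{Ein}}_2$ be a nonelementary generic closed achronal subset, preserved by a torsion-free discrete group $\Gamma\subset\widehat{SO}_0(2,2)$. Then the actions of $\Gamma$ on $\Omega(\widetilde\Lambda)$ and on $E(\widetilde\Lambda)$ are free and properly discontinuous, and the quotient spacetime $M_{\widetilde\Lambda}(\Gamma)=\Gamma\backslash E(\widetilde\Lambda)$ is strongly causal.
   Context: Let $E=\mathbb R^4$ with coordinates $(u,v,x_1,x_2)$ and $Q=-u^2-v^2+x_1^2+x_2^2$. $\mathrm{AdS}=\{Q=-1\}\subset E$ with the induced Lorentzian metric. $S(E)$ is the space of rays of $E$; $\mathrm{AdS}$ is identified with $\{[x]\in S(E): Q(x)<0\}$, whose boundary in $S(E)$ is $\mathrm{Ein}_2=\{[x]: Q(x)=0\}$. Let $\mathbb D^2=\{p=(p_1,p_2,p_3)\in S^2: p_3>0\}$ with closure $\overline{\mathbb D}^2$, and let $d$ be the spherical distance. The map $\overline{\mathbb D}^2\times\mathbb R\to S(E)$, $(p,\theta)\mapsto[(\cos\theta,\sin\theta,p_1,p_2)]$, identifies $\mathbb D^2\times\mathbb R$ with the universal covering $\widetilde{\mathrm{AdS}}$ of $\mathrm{AdS}$ (the metric being conformal to $ds^2-d\theta^2$) and $\partial\mathbb D^2\times\mathbb R$ with the infinite cyclic covering $\widehat{\mathrm{Ein}}_2$ of $\mathrm{Ein}_2$. Time orientation: $\theta$ increasing. Two points $(x,\theta),(y,\theta')$ of $\overline{\mathbb D}^2\times\mathbb R$ are causally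 related iff $d(x,y)\le|\theta-\theta'|$. $\widehat{SO}_0(2,2)$ is the group of isometries of $\widetilde{\mathrm{AdS}}$ preserving orientation and time-orientation; it acts also on $\widehat{\mathrm{Ein}}_2$ (by continuous extension). A subset $\widetilde\Lambda$ of $\widehat{\mathrm{Ein}}_2$ is achronal if $d(x,y)\ge|\theta-\theta'|$ for all $(x,\theta),(y,\theta')\in\widetilde\Lambda$; equivalently it is the graph of a $1$-Lipschitz function $f:\Lambda_0\to\mathbb R$, $\Lambda_0\subset\partial\mathbb D^2$. Two points of $\widehat{\mathrm{Ein}}_2$ are opposite if they have the form $(x,\theta)$, $(-x,\theta+\pi)$. The past (future) lightcone of a point is the union of the past-oriented (future-oriented) lightlike geodesic rays $s\mapsto (x(s),\theta_0\mp s)$, $s\ge 0$, starting at it, $x(s)$ being a unit-speed curve on the circle $\partial\mathbb D^2$. $\widetilde\Lambda$ is pure lightlike if it contains two opposite points such that $\widetilde\Lambda$ is contained in the past lightcone of one and the future lightcone of the other; otherwise it is generic. A generic achronal $\widetilde\Lambda$ is nonelementary if there is no point of $\widehat{\mathrm{Ein}}_2$ whose past lightcone contains $\widetilde\Lambda$ and no point whose future lightcone contains $\widetilde\Lambda$. For $x\in\overline{\mathbb D}^2$ put $f_-(x)=\sup_{y\in\Lambda_0}(f(y)-d(x,y))$, $f_+(x)=\inf_{y\in\Lambda_0}(f(y)+d(x,y))$. The invisible domains are $E(\widetilde\Lambda)=\{(x,\theta)\in\mathbb D^2\times\mathbb R: f_-(x)<\theta<f_+(x)\}\subset\widetilde{\mathrm{AdS}}$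 and $\Omega(\widetilde\Lambda)=\{(x,\theta)\in\partial\mathbb D^2\times\mathbb R: f_-(x)<\theta<f_+(x)\}\subset\widehat{\mathrm{Ein}}_2$. A time-oriented spacetime $M$ is strongly causal if the sets $U(x,y)=$ (future of $x$) $\cap$ (past of $y$), defined with timelike curves, form a basis of the manifold topology (equivalently, every neighborhood of every point contains an open neighborhood $U$ of that point such that any causal curve of $M$ joining two points of $U$ is contained in $U$). *)

(* Defs.v *)
From HB Require Import structures.
From mathcomp Require Import all_boot all_order all_algebra.
From mathcomp Require Import all_classical all_reals all_analysis.
Set Implicit Arguments.
Unset Strict Implicit.
Unset Printing Implicit Defensive.
Import Order.TTheory GRing.Theory Num.Theory.
Import numFieldNormedType.Exports.
Local Open Scope classical_set_scope.
Local Open Scope ring_scope.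

Definition dot (R : realType) (n : nat) (v w : 'rV[R]_n) : R :=
  \sum_(i < n) v 0 i * w 0 i.

(* The third coordinate of a vector of R^3 has index ord_max. *)
Definition cyl_set (R : realType) : set ('rV[R]_3 * R) :=
  [set z | dot z.1 z.1 = 1 /\ 0 <= z.1 0 ord_max].

Notation cyl R := (set_type (@cyl_set R)).

Definition pt (R : realType) (z : cyl R) : 'rV[R]_3 := (set_val z).1.
Definition tm (R : realType) (z : cyl R) : R := (set_val z).2.

Definition ads_set (R : realType) : set (cyl R) :=
  [set z | 0 < pt z 0 ord_max].
Definition ein (R : realType) : set (cyl R) :=
  [set z | pt z 0 ord_max = 0].

Notation ads R := (set_type (@ads_set R)).

Definition to_cyl (R : realType) (z : ads R) : cyl R := set_val z.

Definition sdist (R : realType) (p q : 'rV[R]_3) : R := acos (dot p q).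

(* The quadratic form Q of E = R^4, in polarized form. *)
Definition formQ (R : realType) (x y : 'rV[R]_4) : R :=
  - (x 0 0 * y 0 0) - x 0 1 * y 0 1
  + x 0 (inord 2) * y 0 (inord 2) + x 0 (inord 3) * y 0 (inord 3).

(* (p1, p2, theta) is a global chart of AdS~, with image [chart_dom]. *)
Definition chart (R : realType) (z : ads R) : 'rV[R]_3 :=
  \row_(i < 3) [:: pt (to_cyl z) 0 0; pt (to_cyl z) 0 1; tm (to_cyl z)]`_i.

Definition chart_dom (R : realType) : set 'rV[R]_3 :=
  [set u | (u 0 0) ^+ 2 + (u 0 1) ^+ 2 < 1].

Definition ray (R : realType) (u : 'rV[R]_3) : 'rV[R]_4 :=
  \row_(i < 4) [:: cos (u 0 ord_max); sin (u 0 ord_max); u 0 0; u 0 1]`_i.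

(* The covering map AdS~ -> AdS = {Q = -1}, read in the chart: [ray u]
   rescaled to the point of AdS on the same ray. *)
Definition ads_cover (R : realType) (u : 'rV[R]_3) : 'rV[R]_4 :=
  (Num.sqrt (- formQ (ray u) (ray u)))^-1 *: ray u.

(* The pullback by the covering map of the metric induced by Q on AdS. *)
Definition metric (R : realType) (u v w : 'rV[R]_3) : R :=
  formQ ('d (@ads_cover R) u v) ('d (@ads_cover R) u w).

Definition future_timelike (R : realType) (u v : 'rV[R]_3) : Prop :=
  metric u v v < 0 /\ 0 < v 0 ord_max.

(* Meant for open U: the derivatives are two-sided. *)
Fixpoint Ck (R : realType) (m n : nat) (k : nat) (U : set 'rV[R]_m)
    (f : 'rV[R]_m -> 'rV[R]_n) : Prop :=
  match k with
  | 0%N => forall u, U u -> {for u, continuous f}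
  | k'.+1 => (forall u, U u -> differentiable f u) /\
             forall v, Ck k' U (fun u => 'D_v f u)
  end.

Definition smooth_on (R : realType) (m n : nat) (U : set 'rV[R]_m)
    (f : 'rV[R]_m -> 'rV[R]_n) : Prop :=
  forall k, Ck k U f.

Definition local_expr (R : realType) (g : ads R -> ads R)
    (F : 'rV[R]_3 -> 'rV[R]_3) : Prop :=
  forall z, F (chart z) = chart (g z).

Definition smooth_map (R : realType) (g : ads R -> ads R) : Prop :=
  exists F, local_expr g F /\ smooth_on (@chart_dom R) F.

Definition diffeo (R : realType) (g : ads R -> ads R) : Prop :=
  smooth_map g /\
  exists h, [/\ smooth_map h, cancel g h & cancel h g].

Definition ads_isometry (R : realType) (g : ads R -> ads R) : Prop :=
  diffeo g /\
  forall F, local_expr g F -> forall u v w, chart_dom u ->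
    metric (F u) ('d F u v) ('d F u w) = metric u v w.

Definition preserves_orientation (R : realType) (g : ads R -> ads R) : Prop :=
  forall F, local_expr g F -> forall u, chart_dom u ->
    0 < \det (jacobian F u).

Definition preserves_time_orientation (R : realType)
    (g : ads R -> ads R) : Prop :=
  forall F, local_expr g F -> forall u v, chart_dom u ->
    future_timelike u v -> future_timelike (F u) ('d F u v).

Definition SO22hat (R : realType) : set (ads R -> ads R) :=
  [set g | [/\ ads_isometry g, preserves_orientation g &
               preserves_time_orientation g]].

Record subgroup (R : realType) := Subgroup {
  subgroup_mem :> (ads R -> ads R) -> Prop;
  subgroup_sub : forall g, subgroup_mem g -> SO22hat g;
  subgroup_id : subgroup_mem id;
  subgroup_comp : forall g h, subgroup_mem g -> subgroup_mem h ->
    subgroup_mem (g \o h);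
  subgroup_inv : forall g, subgroup_mem g ->
    exists h, [/\ subgroup_mem h, cancel g h & cancel h g]
}.

Definition torsion_free (R : realType) (G : subgroup R) : Prop :=
  forall g n, G g -> (0 < n)%N -> iter n g = id -> g = id.

Definition discrete (R : realType) (G : subgroup R) : Prop :=
  let A := [set g : {compact-open, ads R -> ads R} | G g] in A `<=` isolated A.

(* The continuous extension of g to the cylinder; it is unique because AdS~ is
   dense. The default value id is only used if there is no extension. *)
Definition extension (R : realType) (g : ads R -> ads R) : cyl R -> cyl R :=
  if pselect (exists h : cyl R -> cyl R,
      continuous h /\ forall z, h (to_cyl z) = to_cyl (g z)) is left e
  then sval (cid e) else id.

Definition preserves (R : realType) (G : subgroup R) (L : set (cyl R)) : Prop :=
  forall g, G g -> extension g @` L = L.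

Definition achronal (R : realType) (L : set (cyl R)) : Prop :=
  forall z w, L z -> L w -> `|tm z - tm w| <= sdist (pt z) (pt w).

Definition opposite (R : realType) (z w : cyl R) : Prop :=
  [/\ ein z, ein w, pt w = - pt z & tm w = tm z + pi].

Definition unit_speed_curve (R : realType) (c : R -> 'rV[R]_3) : Prop :=
  (forall s, [/\ dot (c s) (c s) = 1, c s 0 ord_max = 0, derivable c s 1 &
                 dot (derive1 c s) (derive1 c s) = 1]) /\
  continuous (derive1 c).

Definition past_lightcone (R : realType) (z : cyl R) : set (cyl R) :=
  [set w | exists c s, [/\ unit_speed_curve c, c 0 = pt z, 0 <= s,
                           pt w = c s & tm w = tm z - s]].

Definition future_lightcone (R : realType) (z : cyl R) : set (cyl R) :=
  [set w | exists c s, [/\ unit_speed_curve c, c 0 = pt z, 0 <= s,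
                           pt w = c s & tm w = tm z + s]].

Definition pure_lightlike (R : realType) (L : set (cyl R)) : Prop :=
  exists z w, [/\ L z, L w, opposite z w \/ opposite w z,
                  L `<=` past_lightcone z & L `<=` future_lightcone w].

Definition generic (R : realType) (L : set (cyl R)) : Prop :=
  ~ pure_lightlike L.

Definition nonelementary (R : realType) (L : set (cyl R)) : Prop :=
  (~ exists z, ein z /\ L `<=` past_lightcone z) /\
  (~ exists z, ein z /\ L `<=` future_lightcone z).

(* L is the graph of f over L0, so "y in L0" and "f y" are the components of
   the points of L. *)
Definition fminus (R : realType) (L : set (cyl R)) (x : 'rV[R]_3) : \bar R :=
  ereal_sup [set (tm w - sdist x (pt w))%:E | w in L].
Definition fplus (R : realType) (L : set (cyl R)) (x : 'rV[R]_3) : \bar R :=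
  ereal_inf [set (tm w + sdist x (pt w))%:E | w in L].

Definition between (R : realType) (L : set (cyl R)) (z : cyl R) : Prop :=
  (fminus L (pt z) < (tm z)%:E)%E /\ ((tm z)%:E < fplus L (pt z))%E.

Definition Edom (R : realType) (L : set (cyl R)) : set (ads R) :=
  [set z | between L (to_cyl z)].
Definition Omega (R : realType) (L : set (cyl R)) : set (cyl R) :=
  [set z | ein z /\ between L z].

Definition preserves_dom (R : realType) (X : topologicalType) (G : subgroup R)
    (act : (ads R -> ads R) -> X -> X) (A : set X) : Prop :=
  forall g, G g -> act g @` A = A.

Definition free_action (R : realType) (X : topologicalType) (G : subgroup R)
    (act : (ads R -> ads R) -> X -> X) (A : set X) : Prop :=
  forall g x, G g -> A x -> act g x = x -> g = id.

Definition properly_discontinuous (R : realType) (X : topologicalType)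
    (G : subgroup R) (act : (ads R -> ads R) -> X -> X) (A : set X) : Prop :=
  forall K, K `<=` A -> compact K ->
    finite_set [set g | G g /\ (act g @` K) `&` K !=set0].

Notation Etype L := (set_type (Edom L)).

Definition to_ads (R : realType) (L : set (cyl R)) (z : Etype L) : ads R :=
  set_val z.

Definition same_orbit (R : realType) (G : subgroup R) (L : set (cyl R)) :
    rel (Etype L) :=
  fun z w => `[< exists2 g, G g & g (to_ads z) = to_ads w >].
Arguments same_orbit {R} G L.

Lemma same_orbit_refl (R : realType) (G : subgroup R) (L : set (cyl R)) :
  reflexive (same_orbit G L).
Proof. by move=> z; apply/asboolP; exists id => //; exact: subgroup_id. Qed.

Lemma same_orbit_sym (R : realType) (G : subgroup R) (L : set (cyl R)) :
  symmetric (same_orbit G L).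
Proof.
suff H z w : same_orbit G L z w -> same_orbit G L w z.
  by move=> z w; apply/idP/idP; exact: H.
move=> /asboolP[g Gg gz]; apply/asboolP.
by have [h [Gh gK hK]] := subgroup_inv Gg; exists h => //; rewrite -gz gK.
Qed.

Lemma same_orbit_trans (R : realType) (G : subgroup R) (L : set (cyl R)) :
  transitive (same_orbit G L).
Proof.
move=> w z x /asboolP[g Gg gz] /asboolP[h Gh hw]; apply/asboolP.
by exists (h \o g); [exact: subgroup_comp|rewrite /= gz].
Qed.

Definition orbit_rel (R : realType) (G : subgroup R) (L : set (cyl R)) :=
  EquivRel (same_orbit G L) (@same_orbit_refl R G L) (@same_orbit_sym R G L)
    (@same_orbit_trans R G L).
Arguments orbit_rel {R} G L.

Notation Mquot G L := (quotient_topology {eq_quot (orbit_rel G L)}%qT).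

Definition quot_proj (R : realType) (G : subgroup R) (L : set (cyl R))
    (z : Etype L) : Mquot G L :=
  (\pi_(Mquot G L) z)%qT.
Arguments quot_proj {R} G {L} z.

(* c, restricted to [a, b], is a future-directed timelike C^1 curve of the
   quotient: since quot_proj is a local isometry, this means that near each point
   c lifts to such a curve of E(L). The local lifts are defined on open
   intervals, so that at the endpoints they extend c a little. *)
Definition timelike_curve (R : realType) (G : subgroup R) (L : set (cyl R))
    (c : R -> Mquot G L) (a b : R) : Prop :=
  forall t, a <= t <= b -> exists (e : R) (l : R -> Etype L), 0 < e /\
    let k s := chart (to_ads (l s)) in
    forall s, `|s - t| < e ->
      [/\ derivable k s 1, {for s, continuous (derive1 k)},
          future_timelike (k s) (derive1 k s) &
          a <= s <= b -> c s = quot_proj G (l s)].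

Definition future (R : realType) (G : subgroup R) (L : set (cyl R))
    (x : Mquot G L) : set (Mquot G L) :=
  [set y | exists c a b, [/\ a < b, timelike_curve c a b, c a = x & c b = y]].
Definition past (R : realType) (G : subgroup R) (L : set (cyl R))
    (y : Mquot G L) : set (Mquot G L) :=
  [set x | future x y].

Definition strongly_causal (R : realType) (G : subgroup R)
    (L : set (cyl R)) : Prop :=
  basis [set future xy.1 `&` past xy.2 | xy in [set: Mquot G L * Mquot G L]].

(* Main.v *)
Require Import Defs.
From HB Require Import structures.
From mathcomp Require Import all_boot all_order all_algebra.
From mathcomp Require Import all_classical all_reals all_analysis.
From mathcomp Require Import ring lra.
Set Implicit Arguments.
Unset Strict Implicit.
Unset Printing Implicit Defensive.
Import Order.TTheory GRing.Theory Num.Theory.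
Import numFieldNormedType.Exports.
Local Open Scope classical_set_scope.
Local Open Scope ring_scope.

(* Write q for the quadratic form. An isometry preserving both orientations is
   the restriction of a linear map A of SO(2,2): two local isometric immersions
   into {q = -1} have the same second derivatives (Koszul formula), so the
   matrix carrying the adapted frame of one to that of the other is constant.
   The boundary point of a ray is then moved by A as well, and two points are
   spatially related when q is negative on their rays and their times differ by
   less than pi; the invisible domains consist of the points spatially related
   to all of the limit set.

   If infinitely many elements of the group violate a compactness statement,
   their matrices are unbounded (discreteness), and A / |A| accumulates at a
   nonzero endomorphism B with B B^* = 0. Such limits form a multiplicative
   semigroup; because the limit set is in no lightcone, B maps no invisible ray
   to an invisible one, and q(x, x B) < 0 for every invisible timelike ray x
   (the powers of a hypothetical counterexample, rescaled by the dominant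
   eigenvalue, would give another limit contradicting invariance). The first
   fact gives proper discontinuity, the second excludes almost closed timelike
   curves in the quotient: a causal curve from near x to near g x makes
   q(x, x A) bounded below. *)

(** * The quadratic form *)

(** Time orientation enters the linear algebra as the sign of [dett], the minor of the two negative
    coordinates. It is a closed condition, so it survives in rescaled limits, where it makes the
    determinant of [B] on a totally isotropic image plane nonnegative. The inequality for
    [q(x, x B)] rests on Cayley-Hamilton for [SO(2,2)]: multiplied by [A^-2] it becomes homogeneous
    of degree two, hence holds for limits, and evaluated at [x] it gives [q(x, x B^2) = t q(x, x B)
    - d q(x, x) / 2], where [q(x, x) < 0] makes the inequality strict if [d > 0]. The obstacle on
    the covering is that a matrix determines an isometry only up to translations of [theta] by
    multiples of [2 pi], so bounded matrices do not by themselves confine the isometries. Invariance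
    of the achronal limit set, whose times are bounded, removes the ambiguity. The lower bound for
    causal pairs needs an upper bound on the time difference: two points invisible from a common
    limit point differ in time by less than the sum of their distances to it, hence by less than
    [2 pi] minus their own distance. *)

Definition Jmx (R : realType) : 'M[R]_4 :=
  diag_mx (\row_(i < 4) (if (i < 2)%N then -1 else 1)).

(** The adjoint of [B] with respect to [q], hence the inverse of [B] when [B] is an isometry of
    [q]. *)
HB.lock Definition adjQ (R : realType) (B : 'M[R]_4) : 'M[R]_4 :=
  Jmx R *m B^T *m Jmx R.

Arguments adjQ {R}.

Section Form.
Variable R : realType.
Local Notation Jmx := (Jmx R).
Implicit Types (x y z w : 'rV[R]_4) (A B : 'M[R]_4).

Lemma sum4 (V : nmodType) (F : 'I_4 -> V) :
  \sum_i F i = F 0 + F 1 + F (inord 2) + F (inord 3).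
Proof.
rewrite !big_ord_recl big_ord0 addr0 !addrA.
by do 3?congr (_ + _); congr F; apply: val_inj; rewrite /= ?inordK.
Qed.

Lemma ord4P (P : 'I_4 -> Prop) :
  P 0 -> P 1 -> P (inord 2) -> P (inord 3) -> forall i, P i.
Proof.
move=> P0 P1 P2 P3 [m mlt].
case: m mlt => [|[|[|[|//]]]] mlt.
- by rewrite (_ : Ordinal mlt = 0)//; apply: val_inj.
- by rewrite (_ : Ordinal mlt = 1)//; apply: val_inj.
- by rewrite (_ : Ordinal mlt = inord 2)//; apply: val_inj; rewrite /= inordK.
- by rewrite (_ : Ordinal mlt = inord 3)//; apply: val_inj; rewrite /= inordK.
Qed.

Lemma row4P x y : x 0 0 = y 0 0 -> x 0 1 = y 0 1 ->
  x 0 (inord 2) = y 0 (inord 2) -> x 0 (inord 3) = y 0 (inord 3) -> x = y.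
Proof. by move=> *; apply/rowP; apply: ord4P. Qed.

Lemma formQC x y : formQ x y = formQ y x.
Proof. by rewrite /formQ; ring. Qed.

Lemma formQDl x y z : formQ (x + y) z = formQ x z + formQ y z.
Proof. by rewrite /formQ !mxE; ring. Qed.

Lemma formQDr x y z : formQ z (x + y) = formQ z x + formQ z y.
Proof. by rewrite /formQ !mxE; ring. Qed.

Lemma formQZl a x z : formQ (a *: x) z = a * formQ x z.
Proof. by rewrite /formQ !mxE; ring. Qed.

Lemma formQZr a x z : formQ z (a *: x) = a * formQ z x.
Proof. by rewrite /formQ !mxE; ring. Qed.

Lemma formQNl x z : formQ (- x) z = - formQ x z.
Proof. by rewrite /formQ !mxE; ring. Qed.

Lemma formQNr x z : formQ z (- x) = - formQ z x.
Proof. by rewrite /formQ !mxE; ring. Qed.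

Lemma formQ0l z : formQ 0 z = 0 :> R.
Proof. by rewrite /formQ !mxE; ring. Qed.

Lemma formQ0r z : formQ z 0 = 0 :> R.
Proof. by rewrite /formQ !mxE; ring. Qed.

Definition formQE := (formQDl, formQDr, formQZl, formQZr, formQNl, formQNr,
  formQ0l, formQ0r).

Lemma mulJ x : x *m Jmx = \row_(i < 4) (if (i < 2)%N then - x 0 i else x 0 i).
Proof.
apply/rowP => i; rewrite mul_mx_diag !mxE.
by case: ifP => _; rewrite ?mulrN1 ?mulr1.
Qed.

Lemma formQJ x y : formQ x y = (x *m Jmx *m y^T) 0 0.
Proof.
rewrite mulJ !mxE sum4 !mxE /= !inordK//= /formQ; ring.
Qed.

Lemma trmxJ : Jmx^T = Jmx. Proof. exact: tr_diag_mx. Qed.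

Lemma mulJJ : Jmx *m Jmx = 1%:M.
Proof.
rewrite mul_diag_mx; apply/matrixP => i j; rewrite !mxE.
case: eqP => [->|]; last by rewrite mulr0n mulr0.
by case: ifP => _; rewrite !mulr1n ?mulrNN mulr1.
Qed.

Lemma adjQE B : adjQ B = Jmx *m B^T *m Jmx. Proof. by rewrite adjQ.unlock. Qed.

Lemma formQ_adj x y B : formQ (x *m B) y = formQ x (y *m adjQ B).
Proof.
rewrite !formQJ !adjQE !trmx_mul trmxJ trmxK.
by rewrite !mulmxA -[x *m Jmx *m Jmx]mulmxA mulJJ mulmx1 .
Qed.

Lemma adjQK : involutive (adjQ : 'M[R]_4 -> _).
Proof.
move=> B; rewrite !adjQE !trmx_mul trmxK trmxJ !mulmxA mulJJ mul1mx.
by rewrite -mulmxA mulJJ mulmx1.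
Qed.

Lemma adjQM A B : adjQ (A *m B) = adjQ B *m adjQ A.
Proof.
by rewrite !adjQE trmx_mul !mulmxA -[_ *m Jmx *m Jmx]mulmxA mulJJ mulmx1.
Qed.

Lemma adjQZ a B : adjQ (a *: B) = a *: adjQ B.
Proof. by rewrite !adjQE linearZ /= -scalemxAr -scalemxAl. Qed.

Lemma adjQ0 : adjQ 0 = 0 :> 'M[R]_4.
Proof. by rewrite !adjQE trmx0 mulmx0 mul0mx. Qed.

Lemma formQ_adjr x y B : formQ x (y *m B) = formQ (x *m adjQ B) y.
Proof. by rewrite formQ_adj adjQK. Qed.

Lemma mxtrace_adjQ B : \tr (adjQ B) = \tr B.
Proof. by rewrite !adjQE mxtrace_mulC mulmxA mulJJ mul1mx mxtrace_tr. Qed.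

(** The form is positive definite on the last two coordinates, so a null vector is controlled by its
    first two. *)
Lemma null_top0 x : formQ x x = 0 -> x 0 0 = 0 -> x 0 1 = 0 -> x = 0.
Proof.
rewrite /formQ => + x0 x1; rewrite x0 x1 !mul0r !oppr0 !add0r => h.
have h2 : x 0 (inord 2) = 0 by nra.
have h3 : x 0 (inord 3) = 0 by nra.
by apply: row4P; rewrite ?x0 ?x1 ?h2 ?h3 !mxE.
Qed.

(** The minor of the two negative coordinates. Between a timelike point and a tangent vector at it,
    its sign is that of the time component of the vector. *)
Definition dett x y := x 0 0 * y 0 1 - x 0 1 * y 0 0.

Lemma dettE a b c d x y :
  dett (a *: x + b *: y) (c *: x + d *: y) = (a * d - b * c) * dett x y.
Proof. by rewrite /dett !mxE; ring. Qed.

(** The coefficients come from Cramer's rule in the two negative coordinates; the difference of the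
    two sides is null and vanishes there, hence is zero. Totally isotropic planes are thus
    maximal. *)
Lemma iso_span x y w : formQ x x = 0 -> formQ y y = 0 -> formQ x y = 0 ->
  formQ w w = 0 -> formQ x w = 0 -> formQ y w = 0 -> dett x y != 0 ->
  w = (dett w y / dett x y) *: x + (dett x w / dett x y) *: y.
Proof.
move=> xx yy xy ww xw yw D; apply/eqP; rewrite -subr_eq0; apply/eqP.
apply: null_top0.
- rewrite !formQE xx yy ww xy xw yw (formQC w x) (formQC w y) (formQC y x).
  by rewrite xw yw xy; ring.
- by move: D; rewrite !mxE /dett => D; field.
- by move: D; rewrite !mxE /dett => D; field.
Qed.

Lemma iso_dep x y : formQ x x = 0 -> formQ y y = 0 -> formQ x y = 0 ->
  x != 0 -> dett x y = 0 -> exists k, y = k *: x.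
Proof.
move=> xx yy xy x0 D.
suff [k [k0 k1]] : exists k, y 0 0 = k * x 0 0 /\ y 0 1 = k * x 0 1.
  exists k; apply/eqP; rewrite -subr_eq0; apply/eqP; apply: null_top0.
  - by rewrite !formQE xx yy xy (formQC y x) xy; ring.
  - by rewrite !mxE k0; ring.
  - by rewrite !mxE k1; ring.
have [x00|x00] := eqVneq (x 0 0) 0.
  have x01 : x 0 1 != 0.
    by apply: contraNneq x0 => x01; apply/eqP; apply: null_top0.
  exists (y 0 1 / x 0 1); split; last by field.
  move: D; rewrite /dett x00 mul0r sub0r => /eqP; rewrite oppr_eq0 mulf_eq0.
  by rewrite (negPf x01) /= => /eqP ->; rewrite mulr0.
exists (y 0 0 / x 0 0); split; first by field.
move: D; rewrite /dett => /eqP; rewrite subr_eq0 => /eqP D.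
by apply: (mulfI x00); rewrite D; field.
Qed.

End Form.

(** * The characteristic polynomial of an isometry of [q] *)

Section CH.
Variable R : realType.
Implicit Types (A B : 'M[R]_4).

Lemma horner_char_poly n (A : 'M[R]_n) (x : R) :
  (char_poly A).[x] = \det (x%:M - A).
Proof.
rewrite /char_poly -[LHS]/(horner_eval x _) -det_map_mx; congr (\det _).
apply/matrixP => i j; rewrite !mxE /= /horner_eval hornerD hornerN hornerC hornerMn hornerX //.

Qed.

(** From [x - A = A (x A - 1)^*] the characteristic polynomial is reciprocal. *)
Lemma char_poly_palindromic A : A *m adjQ A = 1%:M -> \det A = 1 ->
  (char_poly A)`_1 = - \tr A.
Proof.
move=> AA dA; have AA' : adjQ A *m A = 1%:M by exact: mulmx1C.
have e (x : R) : x != 0 -> (char_poly A).[x] = x ^+ 4 * (char_poly A).[x^-1].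
  move=> x0; rewrite !horner_char_poly.
  have -> : x%:M - A = A *m (adjQ (x%:M *m A - 1%:M)).
    rewrite !adjQE linearB /= mulmxBr mulmxBl mulmxBr trmx1 mulmx1 mulJJ mulmx1.
    rewrite trmx_mul tr_scalar_mx mul_mx_scalar -scalemxAr -scalemxAl -adjQE.
    by rewrite -scalemxAr AA scalemx1.
  rewrite det_mulmx dA mul1r !adjQE !det_mulmx mulrAC -det_mulmx mulJJ det1 mul1r.
  rewrite det_tr -detZ mul_scalar_mx.
  have -> : x *: A - 1%:M = -1 *: (x *: (x^-1%:M - A)).
    rewrite scalerBr scale_scalar_mx divff// scaleN1r opprB //.
  by rewrite [LHS]detZ -signr_odd /= expr0 mul1r.
(* One evaluation suffices: at 2 the quadratic coefficient has weight 4 on both sides and cancels,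
   and the linear one remains. *)
have := e 2%:R; rewrite !horner_coef !size_char_poly !big_ord_recl !big_ord0 /=.
rewrite /bump /= !add1n.
have -> : (char_poly A)`_4 = 1.
  by have /monicP := char_poly_monic A; rewrite lead_coefE size_char_poly.
rewrite (@char_poly_trace R 4 A) // char_poly_det dA.
rewrite pnatr_eq0 => /(_ isT) h.
lra.
Qed.

(** Cayley-Hamilton multiplied by [A^-2]: the cubic and quartic terms disappear, and the relation
    still makes sense for limits, where [A] is no longer invertible. *)
Lemma SO_quadratic A : A *m adjQ A = 1%:M -> \det A = 1 ->
  exists d, A *m A - \tr A *: A + d%:M - \tr A *: adjQ A + adjQ A *m adjQ A = 0.
Proof.
move=> AA dA; have AA' : adjQ A *m A = 1%:M by exact: mulmx1C.
have H := Cayley_Hamilton A; move: H.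
have [d ->] : exists d, char_poly A = 1%:P + (- \tr A) *: 'X + d *: 'X^2
    - \tr A *: 'X^3 + 'X^4.
  exists (char_poly A)`_2.
  rewrite -[LHS]coefK size_char_poly poly_def !big_ord_recl big_ord0 addr0 /=.
  rewrite /bump /= !add1n !addrA char_poly_palindromic // char_poly_det dA.
  rewrite [(char_poly A)`_3](@char_poly_trace R 4 A) //.
  have -> : (char_poly A)`_4 = 1.
    by have /monicP := char_poly_monic A; rewrite lead_coefE size_char_poly.
  by rewrite mulr1 -signr_odd /= !expr0 expr1 !scale1r !scaleNr polyC1 //.
move=> H; exists d; move: H.
rewrite !(rmorphD, rmorphN)/= !horner_mxZ !rmorphXn /= horner_mx_X rmorph1.
rewrite !exprS expr0 mulr1 -!mulmxE !mulmxA.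
move=> /(congr1 (fun M : 'M[R]_4 => M *m adjQ A *m adjQ A)).
rewrite !(mulmxDl, mulNmx, mul0mx) -?scalemxAl.
have c1 (M : 'M[R]_4) : M *m A *m adjQ A = M by rewrite -mulmxA AA mulmx1.
rewrite !c1 AA !mul1mx => <-; rewrite scaleNr -scalemx1.
move: (A *m A) (adjQ A *m adjQ A) (adjQ A) => A2 B2 B.
by apply/matrixP => i j; rewrite !mxE; ring.
Qed.
End CH.

(** * Limits of matrices along filters and ultrafilters *)

Section Limits.
Variable R : realType.

Lemma cvg_pairT (T : Type) (F : set_system T) (FF : Filter F)
    (U V : topologicalType) (f : T -> U) (g : T -> V) (a : U) (b : V) :
  f @ F --> a -> g @ F --> b -> (fun t => (f t, g t)) @ F --> (a, b).
Proof. by move=> fa gb; apply: cvg_pair. Qed.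

Section Filt.
Variables (T : Type) (F : set_system T).
Context {FF : Filter F}.

Lemma cvg_mxP m n (f : T -> 'M[R]_(m, n)) (l : 'M[R]_(m, n)) :
  (forall i j, f t i j @[t --> F] --> l i j) -> f @ F --> l.
Proof.
move=> h; apply/cvg_ballP => e e0.
have : \forall t \near F, forall ij : 'I_m * 'I_n, ball (l ij.1 ij.2) e (f t ij.1 ij.2).
  by apply: filter_forall => -[i j] /=; have /cvg_ballP/(_ _ e0) := h i j.
by apply: filterS => t ht; split=> // i j; exact: (ht (i, j)).
Qed.

Lemma cvg_coord m n (f : T -> 'M[R]_(m, n)) (l : 'M[R]_(m, n)) i j :
  f @ F --> l -> f t i j @[t --> F] --> l i j.
Proof.
move=> fl; apply: (@cvg_comp _ _ _ f (fun M : 'M[R]_(m, n) => M i j) F _ _ fl).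
exact: coord_continuous.
Qed.

Lemma cvg_sumr n (f : 'I_n -> T -> R) (l : 'I_n -> R) :
  (forall i, f i t @[t --> F] --> l i) ->
  \sum_i f i t @[t --> F] --> \sum_i l i.
Proof.
elim: n f l => [|n IH] f l h.
  rewrite big_ord0; rewrite (_ : (fun t => _) = cst 0); first exact: cvg_cst.
  by apply/funext => t; rewrite big_ord0.
rewrite big_ord_recr /=; under eq_fun do rewrite big_ord_recr /=.
by apply: cvgD => //; apply: IH.
Qed.

Lemma cvg_mulmx m n p (f : T -> 'M[R]_(m, n)) (g : T -> 'M[R]_(n, p))
    (lf : 'M[R]_(m, n)) (lg : 'M[R]_(n, p)) :
  f @ F --> lf -> g @ F --> lg -> f t *m g t @[t --> F] --> lf *m lg.
Proof.
move=> hf hg; apply: cvg_mxP => i j; rewrite mxE.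
under eq_fun do rewrite mxE.
by apply: cvg_sumr => k; apply: cvgM; exact: cvg_coord.
Qed.

Lemma cvg_scalemx m n (k : T -> R) (f : T -> 'M[R]_(m, n))
    (lk : R) (lf : 'M[R]_(m, n)) :
  k @ F --> lk -> f @ F --> lf -> k t *: f t @[t --> F] --> lk *: lf.
Proof.
move=> hk hf; apply: cvg_mxP => i j; rewrite mxE.
by under eq_fun do rewrite mxE; apply: cvgM => //; exact: cvg_coord.
Qed.

Lemma cvg_addmx m n (f g : T -> 'M[R]_(m, n)) (lf lg : 'M[R]_(m, n)) :
  f @ F --> lf -> g @ F --> lg -> f t + g t @[t --> F] --> lf + lg.
Proof.
move=> hk hf; apply: cvg_mxP => i j; rewrite mxE.
by under eq_fun do rewrite mxE; apply: cvgD; exact: cvg_coord.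
Qed.

Lemma cvg_oppmx m n (f : T -> 'M[R]_(m, n)) (lf : 'M[R]_(m, n)) :
  f @ F --> lf -> - f t @[t --> F] --> - lf.
Proof.
move=> hf; apply: cvg_mxP => i j; rewrite mxE.
by under eq_fun do rewrite mxE; apply: cvgN; exact: cvg_coord.
Qed.

Lemma cvg_trmx m n (f : T -> 'M[R]_(m, n)) (lf : 'M[R]_(m, n)) :
  f @ F --> lf -> (f t)^T @[t --> F] --> lf^T.
Proof.
move=> hf; apply: cvg_mxP => i j; rewrite mxE.
by under eq_fun do rewrite mxE; exact: cvg_coord.
Qed.

Lemma cvg_mxtrace n (f : T -> 'M[R]_n) (lf : 'M[R]_n) :
  f @ F --> lf -> \tr (f t) @[t --> F] --> \tr lf.
Proof. by move=> hf; apply: cvg_sumr => i; exact: cvg_coord. Qed.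

Lemma cvg_adjQ (f : T -> 'M[R]_4) (lf : 'M[R]_4) :
  f @ F --> lf -> adjQ (f t) @[t --> F] --> adjQ lf.
Proof.
move=> hf; under eq_fun do rewrite adjQE; rewrite adjQE.
by apply: cvg_mulmx; [apply: cvg_mulmx; [exact: cvg_cst|exact: cvg_trmx]|exact: cvg_cst].
Qed.

Lemma cvg_formQ (f g : T -> 'rV[R]_4) (lf lg : 'rV[R]_4) :
  f @ F --> lf -> g @ F --> lg -> formQ (f t) (g t) @[t --> F] --> formQ lf lg.
Proof.
move=> hf hg; rewrite /formQ.
apply: cvgD; [apply: cvgD; [apply: cvgB; [apply: cvgN|]|]|]; apply: cvgM;
  exact: cvg_coord.
Qed.

Lemma cvg_dett (f g : T -> 'rV[R]_4) (lf lg : 'rV[R]_4) :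
  f @ F --> lf -> g @ F --> lg -> dett (f t) (g t) @[t --> F] --> dett lf lg.
Proof.
by move=> hf hg; rewrite /dett; apply: cvgB; apply: cvgM; exact: cvg_coord.
Qed.

End Filt.

Section Proper.
Variables (T : Type) (F : set_system T).
Context {FF : ProperFilter F}.

Lemma cvg_uniq (V : normedModType R) (f : T -> V) (a b : V) :
  f @ F --> a -> f @ F --> b -> a = b.
Proof. by move=> fa fb; exact: (@cvg_unique _ (@norm_hausdorff _ V) (f @ F) _ _ _ fa fb). Qed.

Lemma cvg_le0 (f : T -> R) (a : R) : f @ F --> a ->
  (\forall t \near F, f t <= 0) -> a <= 0.
Proof. by move=> fa h; apply: (closed_cvg (fun x : R => x <= 0) _ h _ fa); exact: closed_le. Qed.

Lemma cvg_ge0 (f : T -> R) (a : R) : f @ F --> a ->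
  (\forall t \near F, 0 <= f t) -> 0 <= a.
Proof. by move=> fa h; apply: (closed_cvg (fun x : R => 0 <= x) _ h _ fa); exact: closed_ge. Qed.

End Proper.

Lemma ultra_fmap (T V : Type) (U : set_system T) (f : T -> V) :
  UltraFilter U -> UltraFilter (f @ U).
Proof.
move=> UU; split=> [|G PG sG]; first exact: fmap_proper_filter.
apply/seteqP; split=> // A GA.
have [//|nA] := in_ultra_setVsetC (f @^-1` A) UU.
have /sG GnA : (f @ U) (~` A) by [].
have [x [Ax nAx]] := filter_ex (filterI GA GnA).
by case: (nAx Ax).
Qed.

(** Ultrafilters replace the extraction of subsequences: every bounded function converges along
    them, so several limits can be taken at once. *)
Lemma ultra_cvg_bounded (T : Type) (U : set_system T) (f : T -> R) (M : R) :
  UltraFilter U -> (\forall t \near U, `|f t| <= M) -> exists l : R, f @ U --> l.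
Proof.
move=> UU h; have := @segment_compact R (- M) M.
rewrite compact_ultra => cU.
have fU : UltraFilter (f @ U) by exact: ultra_fmap.
have hf : (f @ U) `[- M, M]%classic.
  by apply: filterS h => t ht /=; rewrite in_itv/= -ler_norml.
by have [l [_ fl]] := cU _ fU hf; exists l.
Qed.

Lemma ultra_cvg_mx (T : Type) (U : set_system T) m n (f : T -> 'M[R]_(m, n)) (M : R) :
  UltraFilter U -> (\forall t \near U, forall i j, `|f t i j| <= M) ->
  exists l : 'M[R]_(m, n), f @ U --> l.
Proof.
move=> UU h.
have /(_ _ _)/cid e i j : exists l : R, f t i j @[t --> U] --> l.
  by apply: (@ultra_cvg_bounded _ _ _ M); apply: filterS h.
exists (\matrix_(i, j) projT1 (e i j)); apply: cvg_mxP => i j.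
by rewrite mxE; exact: (projT2 (e i j)).
Qed.

Lemma closure_filter (T : topologicalType) (E : set T) (p : T) : closure E p ->
  exists F : set_system T, [/\ ProperFilter F, F --> p & F E].
Proof.
move=> cE; exists (within E (nbhs p)); split.
- split; last exact: within_filter.
  by move=> h; have [x [Ex]] := cE _ h; apply.
- exact: cvg_within.
- exact: withinT.
Qed.

Lemma filter_closure (T : Type) (V : topologicalType) (F : set_system T)
    (FF : ProperFilter F) (f : T -> V) (E : set V) p :
  f @ F --> p -> (\forall t \near F, E (f t)) -> closure E p.
Proof.
move=> fp h; apply: (closed_cvg (closure E) _ _ _ fp); first exact: closed_closure.
by apply: filterS h => t; exact: subset_closure.
Qed.

End Limits.

(** * Limits of the rescaled holonomy *)

Section SS.
Variables (R : realType) (AA : set 'M[R]_4) (Lc : set 'rV[R]_4).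
Implicit Types (A B M : 'M[R]_4) (x y z l : 'rV[R]_4).

(** What is retained of the group. [AA_time] is preservation of time orientation: a vector [y]
    orthogonal to the timelike [x] is a tangent vector there, future or past according to the sign
    of [dett x y]. *)
Record SO22_like : Prop := {
  AA_mul : forall A B, AA A -> AA B -> AA (A *m B);
  AA_adj : forall A, AA A -> AA (adjQ A);
  AA_orth : forall A, AA A -> A *m adjQ A = 1%:M;
  AA_det : forall A, AA A -> \det A = 1;
  AA_time : forall A x y, AA A -> formQ x x < 0 -> formQ x y = 0 ->
    formQ y y < 0 -> 0 <= dett x y * dett (x *m A) (y *m A) }.

(** The rays of the limit set, normalized in the negative plane. [Lc_neg] expresses achronality, and
    [Lc_nondeg] that the limit set lies in no lightcone. *)
Record limit_cone : Prop := {
  Lc_closed : closed Lc;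
  Lc_norm : forall l, Lc l -> l 0 0 ^+ 2 + l 0 1 ^+ 2 = 1;
  Lc_inv : forall l A, Lc l -> AA A ->
    exists t l', [/\ 0 < t, Lc l' & l *m A = t *: l'];
  Lc_null : forall l, Lc l -> formQ l l = 0;
  Lc_neg : forall l l', Lc l -> Lc l' -> formQ l l' <= 0;
  Lc_nondeg : forall a, a != 0 -> formQ a a = 0 -> exists2 l, Lc l & formQ a l != 0 }.

Hypothesis hA : SO22_like.
Hypothesis hL : limit_cone.

(** The scalar is kept next to the matrix so that the closure remembers that it tends to 0. *)
Definition SSE : set ('M[R]_4 * R) :=
  [set p | exists A c, [/\ AA A, 0 < c & p = (c *: A, c)]].

Definition SS B := closure SSE (B, 0).

Lemma SS_intro (T : Type) (F : set_system T) (FF : ProperFilter F)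
    (A : T -> 'M[R]_4) (c : T -> R) B :
  (\forall t \near F, AA (A t) /\ 0 < c t) -> c @ F --> (0 : R) ->
  c t *: A t @[t --> F] --> B -> SS B.
Proof.
move=> h c0 cA.
apply: (@filter_closure _ _ F FF (fun t => (c t *: A t, c t))).
  exact: cvg_pairT.
by apply: filterS h => t [At ct]; exists (A t), (c t).
Qed.

Lemma SS_elim B : SS B -> exists F : set_system ('M[R]_4 * R),
  [/\ ProperFilter F, p.1 @[p --> F] --> B, p.2 @[p --> F] --> (0 : R) & F SSE].
Proof.
move=> /closure_filter[F [FF FB FE]]; exists F; split=> //.
- exact: (cvg_comp _ _ FB cvg_fst).
- exact: (cvg_comp _ _ FB cvg_snd).
Qed.

Lemma SS_intro' (T : Type) (F : set_system T) (FF : ProperFilter F)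
    (f : T -> 'M[R]_4) (c : T -> R) B :
  (\forall t \near F, SSE (f t, c t)) -> c @ F --> (0 : R) ->
  f @ F --> B -> SS B.
Proof.
move=> h c0 cA.
apply: (@filter_closure _ _ F FF (fun t => (f t, c t))) h.
exact: cvg_pairT.
Qed.

Lemma SS_adj B : SS B -> SS (adjQ B).
Proof.
move=> /SS_elim[F [FF FB F0 FE]].
apply: (@SS_intro' _ F FF (fun p => adjQ p.1) (fun p => p.2)) => //; last exact: cvg_adjQ.
apply: filterS FE => p [A [c [AAA c0 ->]]]; exists (adjQ A), c.
by rewrite adjQZ; split => //; exact: AA_adj.
Qed.

Lemma SS_mul B B' : SS B -> SS B' -> SS (B *m B').
Proof.
move=> /SS_elim[F [FF FB F0 FE]] /SS_elim[F' [FF' FB' F0' FE']].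
have c1 : (fun p => p.1) @ filter_prod F F' --> F by exact: cvg_fst.
have c2 : (fun p => p.2) @ filter_prod F F' --> F' by exact: cvg_snd.
apply: (@SS_intro' _ (filter_prod F F') _ (fun p => p.1.1 *m p.2.1)
  (fun p => p.1.2 * p.2.2)).
- exists (SSE, SSE) => //= -[p p'] /= [[A [c [AAA c0 ->]]] [A' [c' [AAA' c0' ->]]]].
  exists (A *m A'), (c * c'); split; [exact: AA_mul|exact: mulr_gt0|].
  by rewrite -scalemxAl -scalemxAr scalerA.
- rewrite -(mulr0 0); apply: cvgM.
  + exact: (cvg_comp _ _ c1 F0).
  + exact: (cvg_comp _ _ c2 F0').
- apply: cvg_mulmx.
  + exact: (cvg_comp _ _ c1 FB).
  + exact: (cvg_comp _ _ c2 FB').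
Qed.

Lemma SS_scale B t : 0 < t -> SS B -> SS (t *: B).
Proof.
move=> t0 /SS_elim[F [FF FB F0 FE]].
apply: (@SS_intro' _ F FF (fun p => t *: p.1) (fun p => t * p.2)).
- apply: filterS FE => p [A [c [AAA c0 ->]]]; exists A, (t * c).
  by rewrite /= scalerA; split => //; exact: mulr_gt0.
- by rewrite -(mulr0 t); apply: cvgMl_tmp.
- by apply: cvg_scalemx => //; exact: cvg_cst.
Qed.

Lemma SS_lim (u : nat -> 'M[R]_4) B : (forall n, SS (u n)) -> u @ \oo --> B -> SS B.
Proof.
move=> hu uB.
have h : (fun n => (u n, 0 : R)) @ \oo --> (B, 0 : R).
  by apply: cvg_pairT => //; exact: cvg_cst.
by apply: (closed_cvg (fun p => closure SSE p) (@closed_closure _ _) _ _ h); exact: nearW.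
Qed.

(** Before the limit the product is [c ^ 2] times the identity. The consequence is that the image of
    [B] is totally isotropic, of dimension at most two. *)
Lemma SS_orth B : SS B -> B *m adjQ B = 0.
Proof.
move=> /SS_elim[F [FF FB F0 FE]].
have h1 : p.1 *m adjQ p.1 @[p --> F] --> B *m adjQ B.
  by apply: cvg_mulmx => //; exact: cvg_adjQ.
have h2 : p.2 ^+ 2 *: (1%:M : 'M[R]_4) @[p --> F] --> (0 ^+ 2) *: (1%:M : 'M[R]_4).
  by apply: cvg_scalemx; [apply: cvgM|exact: cvg_cst].
rewrite expr0n scale0r in h2; apply: (cvg_uniq h1).
apply: cvg_trans h2; apply: near_eq_cvg.
apply: filterS FE => p [A [c [AAA c0 ->]]] /=.
by rewrite adjQZ -scalemxAl -scalemxAr scalerA AA_orth.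
Qed.

Lemma SS_orth' B : SS B -> adjQ B *m B = 0.
Proof. by move=> /SS_adj/SS_orth; rewrite adjQK. Qed.

Lemma SS_iso B x y : SS B -> formQ (x *m B) (y *m B) = 0.
Proof.
by move=> sB; rewrite formQ_adj -mulmxA (SS_orth sB) mulmx0 formQ0r.
Qed.

Definition topn x : R := Num.sqrt (x 0 0 ^+ 2 + x 0 1 ^+ 2).

Lemma cvg_topn (T : Type) (F : set_system T) (FF : Filter F) (f : T -> 'rV[R]_4)
  (x : 'rV[R]_4) : f @ F --> x -> topn (f t) @[t --> F] --> topn x.
Proof.
move=> fx; rewrite /topn.
apply: (@cvg_comp _ _ _ _ Num.sqrt _ _ _ _ (@sqrt_continuous R _)).
by apply: cvgD; rewrite expr2; under eq_fun do rewrite expr2; apply: cvgM; exact: cvg_coord.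
Qed.

Lemma topnZ k x : topn (k *: x) = `|k| * topn x.
Proof.
rewrite /topn !mxE !exprMn -mulrDr sqrtrM ?sqr_ge0 //.
by rewrite sqrtr_sqr.
Qed.

Lemma topn_ge0 x : 0 <= topn x. Proof. exact: sqrtr_ge0. Qed.

Lemma topn_eq0 x : formQ x x = 0 -> topn x = 0 -> x = 0.
Proof.
move=> xx /eqP; rewrite sqrtr_eq0 => h.
by apply: null_top0 => //; nra.
Qed.

Lemma Lc_topn l : Lc l -> topn l = 1.
Proof. by move=> /(Lc_norm hL) h; rewrite /topn h sqrtr1. Qed.

(** Before the limit the image is a positive multiple of a limit ray, recovered by dividing by
    [topn]. The division passes to the limit because [l B] is null and nonzero, so [topn] does not
    vanish there. *)
Lemma SS_cone B l : SS B -> Lc l -> l *m B != 0 ->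
  exists t l', [/\ 0 < t, Lc l' & l *m B = t *: l'].
Proof.
move=> sB Ll lB; have := sB => /SS_elim[F [FF FB F0 FE]].
have n0 : topn (l *m B) != 0.
  by apply: contra lB => /eqP h; apply/eqP/(topn_eq0 _ h); exact: SS_iso.
have lM : l *m p.1 @[p --> F] --> l *m B by apply: cvg_mulmx => //; exact: cvg_cst.
have h : (topn (l *m p.1))^-1 *: (l *m p.1) @[p --> F] -->
    (topn (l *m B))^-1 *: (l *m B).
  by apply: cvg_scalemx => //; apply: cvgV => //; exact: cvg_topn.
exists (topn (l *m B)), ((topn (l *m B))^-1 *: (l *m B)); split.
- by rewrite lt_neqAle eq_sym n0 topn_ge0.
- apply: (closed_cvg (fun x => Lc x) (Lc_closed hL) _ _ h).
  apply: filterS FE => p [A [c [AAA c0 ->]]] /=.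
  have [t [l' [t0 Ll' E]]] := Lc_inv hL Ll AAA.
  rewrite -scalemxAr E [c *: _]scalerA topnZ Lc_topn // mulr1 gtr0_norm ?mulr_gt0 //.
  by rewrite scalerA mulVf ?scale1r // gt_eqF // mulr_gt0.
- by rewrite scalerA mulfV // scale1r.
Qed.

(** Taking traces computes the constant of [SO_quadratic], which makes the whole relation
    homogeneous of degree two and stable under rescaling and limits. *)
Lemma SS_quad B : SS B ->
  B *m B - \tr B *: B + (((\tr B) ^+ 2 - \tr (B *m B)) / 2)%:M
    - \tr B *: adjQ B + adjQ B *m adjQ B = 0.
Proof.
move=> /SS_elim[F [FF FB F0 FE]].
pose Phi (M : 'M[R]_4) := M *m M - \tr M *: M +
  (((\tr M) ^+ 2 - \tr (M *m M)) / 2) *: (1%:M : 'M[R]_4)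
    - \tr M *: adjQ M + adjQ M *m adjQ M.
have PhiA A : AA A -> Phi A = 0.
  move=> AAA; have [d hd] := SO_quadratic (AA_orth hA AAA) (AA_det hA AAA).
  suff dE : d = ((\tr A) ^+ 2 - \tr (A *m A)) / 2.
    by rewrite /Phi -dE scalemx1.
  have := congr1 mxtrace hd; rewrite !(raddfD, raddfN) /= !mxtraceZ mxtrace_adjQ.
  rewrite mxtrace_scalar mxtrace0 -adjQM mxtrace_adjQ; lra.
have PhiZ c A : Phi (c *: A) = c ^+ 2 *: Phi A.
  rewrite /Phi !mxtraceZ !adjQZ -!scalemxAl -!scalemxAr mxtraceZ mxtraceZ.
  move: (A *m A) (adjQ A *m adjQ A) (adjQ A) => A2 B2 B'.
  by apply/matrixP => i j; rewrite !mxE; field.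
have h : Phi p.1 @[p --> F] --> Phi B.
  apply: cvg_addmx; last by apply: cvg_mulmx; exact: cvg_adjQ.
  apply: cvg_addmx; last first.
    by apply: cvg_oppmx; apply: cvg_scalemx; [exact: cvg_mxtrace|exact: cvg_adjQ].
  apply: cvg_addmx.
    apply: cvg_addmx; first exact: cvg_mulmx.
    by apply: cvg_oppmx; apply: cvg_scalemx; [exact: cvg_mxtrace|].
  apply: cvg_scalemx; last exact: cvg_cst.
  apply: cvgM; last exact: cvg_cst.
  apply: cvgB; last by apply: cvg_mxtrace; exact: cvg_mulmx.
  by apply: cvgM; exact: cvg_mxtrace.
rewrite -scalemx1; apply: (cvg_uniq h).
have z : cst (0 : 'M[R]_4) @ F --> (0 : 'M[R]_4) by exact: cvg_cst.
apply: cvg_trans z; apply: near_eq_cvg.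
apply: filterS FE => p [A [c [AAA c0 ->]]] /=.
by rewrite PhiZ PhiA // scaler0.
Qed.

End SS.

(** Lets a perturbation parameter tend to 0 in a polynomial inequality. *)
Lemma quad_ge0 (R : realType) (a b c e0 : R) : 0 < e0 ->
  (forall e, 0 < e -> e < e0 -> 0 <= a + b * e + c * e ^+ 2) -> 0 <= a.
Proof.
move=> e00 h.
rewrite leNgt; apply/negP => a0.
pose K := `|b| + `|c| + 1.
have K0 : 0 < K by rewrite ltr_wpDl // addr_ge0.
pose e := Num.min (e0 / 2) (Num.min 1 (- a / (2 * K))).
have ePos : 0 < e.
  by rewrite !lt_min divr_gt0 //= ltr01 /= divr_gt0 ?oppr_gt0 // mulr_gt0.
have e1 : e <= 1 by rewrite !ge_min lexx orbT.
have e2 : e <= - a / (2 * K) by rewrite !ge_min lexx !orbT.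
have e3 : e < e0.
  by apply: (@le_lt_trans _ _ (e0 / 2)); [rewrite ge_min lexx|rewrite ltr_pdivrMr //; lra].
have := h e ePos e3; apply/negP; rewrite -ltNge.
have e4 : K * e <= - a / 2.
  move: e2; rewrite ler_pdivlMr ?mulr_gt0 // => e2.
  by rewrite ler_pdivlMr //; lra.
have hb : b * e <= `|b| * e by rewrite ler_wpM2r ?ler_norm // ltW.
have hc : c * e ^+ 2 <= `|c| * e.
  apply: (@le_trans _ _ (`|c| * e ^+ 2)); first by rewrite ler_wpM2r ?ler_norm ?sqr_ge0.
  by rewrite ler_wpM2l // expr2 ger_pMr.
move: e4; rewrite /K !mulrDl mul1r; lra.
Qed.

(** A recurrence with complex roots changes sign. For the ratio [r] of consecutive terms, [r - (t -
    d / r) = ((r - t / 2) ^ 2 + (d - t ^ 2 / 4)) / r], so a negative discriminant would make [r]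
    drop by at least a fixed amount at each step. *)
Lemma positive_recurrence (R : realType) (a : nat -> R) (t d : R) : 0 < d ->
  (forall k, 0 < a k) -> (forall k, a k.+2 = t * a k.+1 - d * a k) ->
  0 < t /\ 4 * d <= t ^+ 2.
Proof.
move=> d0 a0 ar; have t0 : 0 < t.
  have h1 := a0 0%N; have h2 := a0 1%N; have h3 := a0 2%N.
  rewrite ar in h3; rewrite ltNge; apply/negP => tn; nra.
split=> //; rewrite leNgt; apply/negP => td.
pose r k := a k.+1 / a k.
have r0 k : 0 < r k by exact: divr_gt0.
have rS k : r k.+1 = t - d / r k.
  rewrite /r ar; have := gt_eqF (a0 k); have := gt_eqF (a0 k.+1) => /negbT h1 /negbT h2.
  by field; rewrite h1 h2.
pose eta := (d - t ^+ 2 / 4) / r 0%N.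
have eta0 : 0 < eta by apply: divr_gt0 => //; lra.
have key k : r k.+1 <= r k - (d - t ^+ 2 / 4) / r k.
  rewrite rS -subr_ge0.
  have -> : r k - (d - t ^+ 2 / 4) / r k - (t - d / r k) = (r k - t / 2) ^+ 2 / r k.
    by field; rewrite gt_eqF.
  by apply: divr_ge0; [exact: sqr_ge0|exact: ltW].
have dec k : r k <= r 0%N - k%:R * eta.
  elim: k => [|k IH]; first by rewrite mul0r subr0.
  have rk : r k <= r 0%N.
    by apply: le_trans IH _; rewrite gerBl mulr_ge0 // ltW.
  apply: le_trans (key k) _.
  have : eta <= (d - t ^+ 2 / 4) / r k.
    by rewrite ler_pM2l ?lef_pV2 ?posrE //; lra.
  rewrite -natr1; lra.
have [n hn] : exists n : nat, r 0%N < n%:R * eta.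
  exists (Num.truncn (r 0%N / eta)).+1.
  by rewrite -ltr_pdivrMr // truncnS_gt.
have := dec n; have := r0 n; lra.
Qed.

(** * Time orientation in the limit, and the image plane of a limit *)

Section Geometry.
Variables (R : realType) (AA : set 'M[R]_4) (Lc : set 'rV[R]_4).
Hypothesis hA : SO22_like AA.
Hypothesis hL : limit_cone AA Lc.
Implicit Types (A B M : 'M[R]_4) (x y z l : 'rV[R]_4).
Local Notation SS := (SS AA).

(** Gram-Schmidt: replacing [y] by its part orthogonal to [x] changes neither minor. *)
Lemma AA_time_negdef A x y : AA A ->
  (forall a b, a != 0 \/ b != 0 -> formQ (a *: x + b *: y) (a *: x + b *: y) < 0) ->
  0 <= dett x y * dett (x *m A) (y *m A).
Proof.
move=> AAA h; have xx : formQ x x < 0.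
  by have := h 1 0 (or_introl (oner_neq0 _)); rewrite scale1r scale0r addr0.
pose k := formQ x y / formQ x x; pose y' := - k *: x + 1 *: y.
have xy' : formQ x y' = 0 by rewrite /y' !formQE /k; field; rewrite lt_eqF.
have yy' : formQ y' y' < 0 by apply: h; right; exact: oner_neq0.
have := AA_time hA AAA xx xy' yy'.
rewrite /y' mulmxDl -!scalemxAl /dett !mxE; congr (_ <= _); ring.
Qed.

(** Leaves the negative coordinates, hence [dett], unchanged. For [0 < e < 1] it makes a negative
    semidefinite pair with nonzero [dett] negative definite. *)
Definition squeeze (e : R) x : 'rV[R]_4 :=
  \row_i (if (i < 2)%N then x 0 i else (1 - e) * x 0 i).

Lemma squeezeE e x : formQ (squeeze e x) (squeeze e x) =
  formQ x x - (2 * e - e ^+ 2) * (x 0 (inord 2) ^+ 2 + x 0 (inord 3) ^+ 2).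
Proof. by rewrite /formQ !mxE /= !inordK //=; ring. Qed.

Lemma squeezeD e a b x y :
  a *: squeeze e x + b *: squeeze e y = squeeze e (a *: x + b *: y).
Proof. by apply/rowP => i; rewrite !mxE; case: ifP => _ //; ring. Qed.

Lemma squeeze_mul e x A : squeeze e x *m A =
  x *m A - e *: ((x - squeeze 1 x) *m A).
Proof.
rewrite scalemxAl -mulmxBl; congr (_ *m _).
by apply/rowP => i; rewrite !mxE; case: ifP => _; ring.
Qed.

Definition semidef x y := forall a b, formQ (a *: x + b *: y) (a *: x + b *: y) <= 0.

(** The plane is approximated by its squeezed versions, for which the inequality is polynomial in
    [e]. *)
Lemma AA_time_semidef A x y : AA A -> semidef x y ->
  0 <= dett x y * dett (x *m A) (y *m A).
Proof.
move=> AAA h; have [->|D] := eqVneq (dett x y) 0; first by rewrite mul0r.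
pose x' := (x - squeeze 1 x) *m A; pose y' := (y - squeeze 1 y) *m A.
apply: (@quad_ge0 _ _ (- dett x y * (dett x' (y *m A) + dett (x *m A) y'))
  (dett x y * dett x' y') 1) => // e e0 e1.
have h' : forall a b, a != 0 \/ b != 0 -> formQ (a *: squeeze e x + b *: squeeze e y)
    (a *: squeeze e x + b *: squeeze e y) < 0.
  move=> a b ab; rewrite squeezeD squeezeE.
  set w := a *: x + b *: y; have ww : formQ w w <= 0 by exact: h.
  have w0 : w != 0.
    apply/eqP => w0.
    have : dett w y = 0 by rewrite w0 /dett !mxE; ring.
    have : dett x w = 0 by rewrite w0 /dett !mxE; ring.
    rewrite (_ : dett x w = b * dett x y); last by rewrite /w /dett !mxE; ring.
    rewrite (_ : dett w y = a * dett x y); last by rewrite /w /dett !mxE; ring.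
    move=> /eqP; rewrite mulf_eq0 (negPf D) orbF => /eqP b0.
    move=> /eqP; rewrite mulf_eq0 (negPf D) orbF => /eqP a0.
    by case: ab; rewrite ?a0 ?b0 eqxx.
  have e2 : 0 < 2 * e - e ^+ 2 by nra.
  have [s0|s0] := eqVneq (w 0 (inord 2) ^+ 2 + w 0 (inord 3) ^+ 2) 0; last first.
    have : 0 < w 0 (inord 2) ^+ 2 + w 0 (inord 3) ^+ 2.
      by rewrite lt_neqAle eq_sym s0 addr_ge0 ?sqr_ge0.
    nra.
  rewrite s0 mulr0 subr0 lt_neqAle ww andbT; apply: contra w0 => /eqP w0.
  apply/eqP; apply: null_top0 => //; move: w0; rewrite /formQ; nra.
have := AA_time_negdef AAA h'.
rewrite !squeeze_mul -/x' -/y'.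
rewrite {1}/dett !mxE /= -/(dett x y); congr (_ <= _).
by rewrite /dett !mxE; ring.
Qed.

Lemma SS_time B x y : SS B -> semidef x y ->
  0 <= dett x y * dett (x *m B) (y *m B).
Proof.
move=> /SS_elim[F [FF FB F0 FE]] h.
have c : dett x y * dett (x *m p.1) (y *m p.1) @[p --> F] -->
    dett x y * dett (x *m B) (y *m B).
  by apply: cvgMl_tmp; apply: cvg_dett; apply: cvg_mulmx => //; exact: cvg_cst.
apply: (cvg_ge0 c); apply: filterS FE => p [A [k [AAA k0 ->]]] /=.
rewrite -!scalemxAr.
have -> : dett (k *: (x *m A)) (k *: (y *m A)) = k ^+ 2 * dett (x *m A) (y *m A).
  by rewrite /dett !mxE; ring.
by rewrite mulrCA mulr_ge0 ?sqr_ge0 //; exact: AA_time_semidef.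
Qed.

Lemma iso_semidef x y : formQ x x = 0 -> formQ y y = 0 -> formQ x y = 0 -> semidef x y.
Proof.
move=> xx yy xy a b; suff -> : formQ (a *: x + b *: y) (a *: x + b *: y) = 0 by [].
by rewrite !formQE xx yy (formQC y x) xy; ring.
Qed.

(** For some [x] the null vector [x B^*] is nonzero, so some limit ray [l] is not orthogonal to it,
    and [q(x B^*, l) = q(x, l B)]. *)
Lemma SS_survives B : SS B -> B != 0 -> exists2 l, Lc l & l *m B != 0.
Proof.
move=> sB B0.
have [x xB] : exists x, x *m adjQ B != 0.
  apply: contrapT => /forallNP h; move/eqP : B0; apply.
  rewrite -[B]adjQK; suff -> : adjQ B = 0 by rewrite adjQ0.
  apply/row_matrixP => i; rewrite rowE row0; apply/eqP.
  by have /negP/negbNE := h (delta_mx 0 i).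
have [l Ll ql] := Lc_nondeg hL xB (SS_iso hA _ _ (SS_adj hA sB)).
exists l => //; apply: contra ql => /eqP lB.
by rewrite -formQ_adjr lB formQ0r.
Qed.


(** The image of [B] is the isotropic plane of [x B] and [y B], so [B] factors as [F X] through it,
    and [X F] is the matrix of [B] on its image; the traces agree. Its determinant is nonnegative
    because [B] does not reverse the time orientation of this semidefinite plane. *)
Lemma iso_factor B x y : SS B -> dett (x *m B) (y *m B) != 0 ->
  exists m00 m01 m10 m11,
  [/\ x *m B *m B = m00 *: (x *m B) + m01 *: (y *m B),
      y *m B *m B = m10 *: (x *m B) + m11 *: (y *m B),
      \tr B = m00 + m11,
      \tr (B *m B) = m00 ^+ 2 + 2 * m01 * m10 + m11 ^+ 2 &
      0 <= m00 * m11 - m01 * m10].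
Proof.
move=> sB D.
have iso u v : formQ (u *m B) (v *m B) = 0 by exact: (SS_iso hA).
have i11 := iso x x; have i22 := iso y y; have i12 := iso x y.
move X1: (x *m B) D i11 i12 => x1 D i11 i12.
move X2: (y *m B) D i22 i12 => x2 D i22 i12.
have i1 u : formQ x1 (u *m B) = 0 by rewrite -X1; exact: iso.
have i2 u : formQ x2 (u *m B) = 0 by rewrite -X2; exact: iso.
pose X : 'M[R]_(2, 4) := \matrix_(i, j) (if i == 0 then x1 0 j else x2 0 j).
pose c0 (w : 'rV[R]_4) := dett w x2 / dett x1 x2.
pose c1 (w : 'rV[R]_4) := dett x1 w / dett x1 x2.
pose F : 'M[R]_(4, 2) := \matrix_(i, j)
  (if j == 0 then c0 (delta_mx 0 i *m B) else c1 (delta_mx 0 i *m B)).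
have BE : B = F *m X.
  apply/row_matrixP => i; rewrite rowE.
  rewrite [LHS](iso_span i11 i22 i12 (iso _ _) (i1 _) (i2 _) D).
  apply/rowP => j; rewrite !mxE !big_ord_recl big_ord0 addr0 !mxE /=.
  by [].
have [m mE] : exists m, m = X *m F by exists (X *m F).
have XB : X *m B = m *m X by rewrite [in LHS]BE mulmxA mE.
have rX0 (M : 'M[R]_4) : row 0 (X *m M) = x1 *m M.
  by rewrite row_mul; congr (_ *m _); apply/rowP => j; rewrite !mxE.
have rX1 (M : 'M[R]_4) : row 1 (X *m M) = x2 *m M.
  by rewrite row_mul; congr (_ *m _); apply/rowP => j; rewrite !mxE.
have rm i : row i (m *m X) = m i 0 *: x1 + m i 1 *: x2.
  apply/rowP => j; rewrite !mxE !big_ord_recl big_ord0 addr0 !mxE /=.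
  congr (_ + m i _ * _).
  exact: val_inj.
have E0 : x1 *m B = m 0 0 *: x1 + m 0 1 *: x2 by rewrite -rX0 XB rm.
have E1 : x2 *m B = m 1 0 *: x1 + m 1 1 *: x2 by rewrite -rX1 XB rm.
exists (m 0 0), (m 0 1), (m 1 0), (m 1 1); split => //.
- rewrite BE mxtrace_mulC -mE /mxtrace !big_ord_recl big_ord0 addr0.
  by congr (_ + m _ _); apply: val_inj.
- have -> : \tr (B *m B) = \tr (m *m m).
    by rewrite [X in X *m _]BE -mulmxA mxtrace_mulC XB -mulmxA -mE.
  rewrite /mxtrace !big_ord_recl big_ord0 addr0 !mxE !big_ord_recl !big_ord0 !addr0.
  rewrite (_ : lift ord0 ord0 = 1 :> 'I_2); last exact: val_inj.
  by rewrite (_ : ord0 = 0 :> 'I_2) //; ring.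
- have sd : semidef x1 x2 by exact: iso_semidef.
  have := SS_time sB sd; rewrite E0 E1 dettE mulrCA -expr2.
  by rewrite pmulr_lge0 // lt_neqAle sqr_ge0 eq_sym expf_neq0.
Qed.

End Geometry.

(** * Limits acting on invisible rays: rank one and nilpotent cases *)

Section Escape.
Variables (R : realType) (AA : set 'M[R]_4) (Lc : set 'rV[R]_4).
Hypothesis hA : SO22_like AA.
Hypothesis hL : limit_cone AA Lc.
Implicit Types (A B M V : 'M[R]_4) (x y z l : 'rV[R]_4).
Local Notation SS := (SS AA).

Definition invisible z := forall l, Lc l -> formQ z l < 0.

Lemma invisible_image z B l : invisible z -> SS B -> Lc l -> l *m B != 0 ->
  formQ z (l *m B) < 0.
Proof.
move=> hz sB Ll lB; have [t [l' [t0 Ll' ->]]] := SS_cone hA hL sB Ll lB.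
by rewrite formQZr pmulr_rlt0 //; exact: hz.
Qed.

Lemma invisible_image_le z B l : invisible z -> SS B -> Lc l ->
  formQ z (l *m B) <= 0.
Proof.
move=> hz sB Ll; have [->|lB] := eqVneq (l *m B) 0; first by rewrite formQ0r.
exact/ltW/invisible_image.
Qed.

Lemma adjQ_neq0 B : B != 0 -> adjQ B != 0.
Proof. by apply: contra => /eqP h; rewrite -[B]adjQK h adjQ0. Qed.

Lemma invisible_mul_neq0 z B : invisible z -> SS B -> B != 0 -> z *m B != 0.
Proof.
move=> hz sB B0.
have [l Ll lB] := SS_survives hA hL (SS_adj hA sB) (adjQ_neq0 B0).
have := invisible_image hz (SS_adj hA sB) Ll lB.
by rewrite -formQ_adj; apply: contraTneq => ->; rewrite formQ0l ltxx.
Qed.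

(** Images under [B] are mutually orthogonal, while an invisible ray is strictly negative against
    the image of a surviving limit ray, which is again a limit ray. *)
Lemma invisible_image_not_invisible z z' t B : invisible z -> invisible z' ->
  SS B -> B != 0 -> 0 <= t -> z *m B = t *: z' -> False.
Proof.
move=> hz hz' sB B0 t0 E.
have {}t0 : 0 < t.
  rewrite lt_neqAle t0 andbT eq_sym; apply: contraTneq (invisible_mul_neq0 hz sB B0).
  by move=> t00; rewrite E t00 scale0r eqxx.
have [l Ll lB] := SS_survives hA hL sB B0.
have := SS_iso hA z l sB; rewrite E formQZl => /eqP.
by rewrite mulf_eq0 (gt_eqF t0) lt_eqF //; exact: invisible_image.
Qed.

Variable z : 'rV[R]_4.
Hypothesis hz : invisible z.
Hypothesis zz : formQ z z < 0.

(** Testing against a limit ray that [B^*] does not kill shows [k > 0]; the claim is then the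
    negativity of [z] against [l B]. *)
Lemma rank1_spacelike B l k : SS B -> Lc l -> l *m B != 0 ->
  z *m B = k *: (l *m B) -> formQ z (z *m B) < 0.
Proof.
move=> sB Ll lB E.
have B0 : B != 0 by apply: contraNneq lB => ->; rewrite mulmx0.
have [l' Ll' l'B] := SS_survives hA hL (SS_adj hA sB) (adjQ_neq0 B0).
have h1 : formQ l' (z *m B) < 0.
  by rewrite formQ_adjr formQC; exact: (invisible_image hz (SS_adj hA sB)).
have h2 : formQ l' (l *m B) <= 0.
  rewrite formQ_adjr; have [t [l2 [t0 Ll2 ->]]] := SS_cone hA hL (SS_adj hA sB) Ll' l'B.
  by rewrite formQZl pmulr_rle0 //; exact: (Lc_neg hL).
move: h1; rewrite E !formQZr => h1.
have k0 : 0 < k by nra.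
by rewrite pmulr_rlt0 //; exact: invisible_image.
Qed.

(** Let [De] be the determinant of the products of [z, l] with [x1 = z B, x2 = l B]. The signs of
    the other three products are known, so [De >= 0] forces that of [q(z, z B)]. If [De < 0],
    pushing the image plane towards a dual pair keeps it negative semidefinite, while [B], which
    kills the plane itself, maps the perturbed plane back with reversed orientation, against
    [SS_time]. *)
Lemma nilpotent_spacelike B l : SS B -> Lc l -> B *m B = 0 ->
  dett (z *m B) (l *m B) != 0 -> formQ z (z *m B) < 0.
Proof.
move=> sB Ll BB D.
have iso u v : formQ (u *m B) (v *m B) = 0 by exact: (SS_iso hA).
have lB0 : l *m B != 0.
  by apply: contraNneq D => ->; rewrite /dett !mxE; apply/eqP; ring.
have bzl : formQ z (l *m B) < 0 by exact: invisible_image.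
have bll : formQ l (l *m B) <= 0.
  have [t [l2 [t0 Ll2 ->]]] := SS_cone hA hL sB Ll lB0.
  by rewrite formQZr pmulr_rle0 //; exact: (Lc_neg hL).
have blz : formQ l (z *m B) < 0.
  rewrite formQ_adjr formQC; apply: invisible_image => //; first exact: SS_adj.
  (* If [l B^* = 0], then [l] is orthogonal to the image plane, hence lies in it, and [B^2 = 0]
     gives [l B = 0]. *)
  apply: contraNneq lB0 => la.
  have h u : formQ l (u *m B) = 0 by rewrite formQ_adjr la formQ0l.
  rewrite (iso_span (iso z z) (iso l l) (iso z l) (Lc_null hL Ll) _ _ D).
  - by rewrite mulmxDl -!scalemxAl -!mulmxA BB !mulmx0 !scaler0 addr0 eqxx.
  - by rewrite formQC.
  - by rewrite formQC.
set x1 := z *m B in D iso bzl bll blz *; set x2 := l *m B in D iso bzl bll blz *.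
have i11 : formQ x1 x1 = 0 by exact: iso.
have i22 : formQ x2 x2 = 0 by exact: iso.
have i12 : formQ x1 x2 = 0 by exact: iso.
have x1B : x1 *m B = 0 by rewrite /x1 -mulmxA BB mulmx0.
have x2B : x2 *m B = 0 by rewrite /x2 -mulmxA BB mulmx0.
pose a := formQ z x1; pose b := formQ z x2; pose c := formQ l x1; pose d := formQ l x2.
pose De := a * d - b * c.
(* Up to the factor [De], [y1, y2] are dual to [x1, x2]. *)
have [y1 y1E] : exists y, y = d *: z - b *: l by exists (d *: z - b *: l).
have [y2 y2E] : exists y, y = a *: l - c *: z by exists (a *: l - c *: z).
have q11 : formQ x1 y1 = De by rewrite y1E !formQE !(formQC x1) -/a -/c /De; ring.
have q12 : formQ x1 y2 = 0 by rewrite y2E !formQE !(formQC x1) -/a -/c; ring.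
have q21 : formQ x2 y1 = 0 by rewrite y1E !formQE !(formQC x2) -/b -/d; ring.
have q22 : formQ x2 y2 = De by rewrite y2E !formQE !(formQC x2) -/b -/d /De; ring.
suff De0 : 0 <= De.
  have : 0 < b * c by rewrite nmulr_lgt0.
  have : a * d = b * c + De by rewrite /De; ring.
  rewrite -/a; rewrite -/d in bll; nra.
rewrite leNgt; apply/negP => De0.
(* [K] bounds the form on the span of [y1, y2]; for [e K < - De] the cross term [2 e De] dominates
   the term in [e ^ 2]. *)
pose K := `|formQ y1 y1| + 2 * `|formQ y1 y2| + `|formQ y2 y2| + 1.
have K0 : 0 < K by rewrite ltr_wpDl // !addr_ge0 // mulr_ge0.
have D2 : 0 < dett x1 x2 ^+ 2 by rewrite lt_neqAle sqr_ge0 eq_sym expf_neq0.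
suff : 0 <= - (dett x1 x2 ^+ 2) by rewrite oppr_ge0 leNgt D2.
apply: (@quad_ge0 _ _ (- dett x1 x2 * (dett x1 y2 + dett y1 x2))
  (- dett x1 x2 * dett y1 y2) (- De / K)).
  by rewrite divr_gt0 // oppr_gt0.
move=> e e0; rewrite ltr_pdivlMr // => eK.
have sd : semidef (x1 + e *: y1) (x2 + e *: y2).
  move=> s t.
  have -> : s *: (x1 + e *: y1) + t *: (x2 + e *: y2) =
      (s *: x1 + t *: x2) + e *: (s *: y1 + t *: y2).
    by apply/rowP => i; rewrite !mxE; ring.
  have [w wE] : exists w, w = s *: y1 + t *: y2 by exists (s *: y1 + t *: y2).
  rewrite -wE.
  have -> : formQ (s *: x1 + t *: x2 + e *: w) (s *: x1 + t *: x2 + e *: w) =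
      2 * e * De * (s ^+ 2 + t ^+ 2) + e ^+ 2 * formQ w w.
    have e1 : formQ x1 w = s * De by rewrite wE !formQE q11 q12; ring.
    have e2 : formQ x2 w = t * De by rewrite wE !formQE q21 q22; ring.
    rewrite !formQE i11 i22 i12 (formQC x2 x1) i12 (formQC w x1) (formQC w x2) e1 e2.
    by ring.
  have hw : formQ w w <= K * (s ^+ 2 + t ^+ 2).
    rewrite wE !formQE (formQC y2 y1).
    have h1 : s * (s * formQ y1 y1) <= s ^+ 2 * `|formQ y1 y1|.
      by rewrite mulrA -expr2 ler_wpM2l ?sqr_ge0 // ler_norm.
    have h2 : t * (t * formQ y2 y2) <= t ^+ 2 * `|formQ y2 y2|.
      by rewrite mulrA -expr2 ler_wpM2l ?sqr_ge0 // ler_norm.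
    have h3 : s * (t * formQ y1 y2) <= (s ^+ 2 + t ^+ 2) * `|formQ y1 y2|.
      have := ler_norm (formQ y1 y2); have := lerNnormlW (lexx `|formQ y1 y2|).
      move: (formQ y1 y2) (`|_|) => u v hu hv.
      have v0 : 0 <= v by lra.
      have := sqr_ge0 (s - t); have := sqr_ge0 (s + t); nra.
    have := sqr_ge0 s; have := sqr_ge0 t.
    have := normr_ge0 (formQ y1 y1); have := normr_ge0 (formQ y2 y2).
    rewrite /K; nra.
  have s0 : 0 <= s ^+ 2 + t ^+ 2 by rewrite addr_ge0 ?sqr_ge0.
  have h1 : e ^+ 2 * formQ w w <= e ^+ 2 * (K * (s ^+ 2 + t ^+ 2)).
    by rewrite ler_wpM2l ?sqr_ge0.
  have h2 : e * (s ^+ 2 + t ^+ 2) * (e * K) <= e * (s ^+ 2 + t ^+ 2) * - De.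
    by rewrite ler_wpM2l ?(ltW eK) // mulr_ge0 // ltW.
  have h3 : 0 <= e * (s ^+ 2 + t ^+ 2) * - De.
    by rewrite mulr_ge0 ?oppr_ge0 ?(ltW De0) // mulr_ge0 // ltW.
  move: h1 h2 h3; rewrite expr2; nra.
have := SS_time hA sB sd.
have -> : dett ((x1 + e *: y1) *m B) ((x2 + e *: y2) *m B) = e ^+ 2 * De * dett x1 x2.
  rewrite !mulmxDl x1B x2B !add0r -!scalemxAl y1E y2E !mulmxBl -!scalemxAl -/x1 -/x2.
  by rewrite /De /dett !mxE; ring.
have e2De : e ^+ 2 * De < 0 by rewrite pmulr_rlt0 // exprn_gt0.
rewrite mulrC -[_ * _ * dett x1 x2 * _]mulrA nmulr_rge0 //.
have -> : dett (x1 + e *: y1) (x2 + e *: y2) =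
    dett x1 x2 + (dett x1 y2 + dett y1 x2) * e + dett y1 y2 * e ^+ 2.
  by rewrite /dett !mxE; ring.
by move=> h; rewrite -oppr_le0; move: h; congr (_ <= _); ring.
Qed.

End Escape.

(** * The inequality for invisible timelike rays *)

Section Escape2.
Variables (R : realType) (AA : set 'M[R]_4) (Lc : set 'rV[R]_4).
Hypothesis hA : SO22_like AA.
Hypothesis hL : limit_cone AA Lc.
Implicit Types (A B M V : 'M[R]_4) (x y z l : 'rV[R]_4).
Local Notation SS := (SS AA).

(** The power of exponent [k + 1]: starting at [B] keeps every term in the semigroup [SS]. *)
Definition mpow B k := iter k (mulmx B) B.

Lemma SS_mpow B k : SS B -> SS (mpow B k).
Proof. by move=> sB; elim: k => //= k IH; exact: SS_mul. Qed.

Lemma mpowSr B k : mpow B k.+1 = mpow B k *m B.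
Proof. by elim: k => //= k IH; rewrite -mulmxA -IH. Qed.

(** [V B = r1 V] for [V = B^2 - r2 B], and the rescaled powers of [B] tend to [V]: divided by a
    geometric sequence of ratio [r1] if the eigenvalues differ, with an additional linear factor if
    they coincide. *)
Lemma dominant_limit B r1 r2 : SS B -> 0 < r2 -> r2 <= r1 ->
  B *m B *m B = (r1 + r2) *: (B *m B) - (r1 * r2) *: B ->
  SS (B *m B - r2 *: B).
Proof.
move=> sB r20 r21 B3; set V := B *m B - r2 *: B.
have r10 : 0 < r1 by exact: lt_le_trans r21.
have VB : V *m B = r1 *: V.
  rewrite /V mulmxBl B3 -scalemxAl scalerBr scalerA scalerDl.
  by apply/matrixP => i j; rewrite !mxE; ring.
move: r21; rewrite le_eqVlt => /orP[/eqP E|r21].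
  have pE k : mpow B k.+1 = r1 ^+ k.+1 *: B + (k.+1%:R * r1 ^+ k) *: V.
    elim: k => [|k IH].
      by rewrite /= /V E; apply/matrixP => i j; rewrite !mxE; ring.
    rewrite mpowSr IH mulmxDl -!scalemxAl VB.
    have -> : B *m B = V + r1 *: B by rewrite /V E subrK.
    apply/matrixP => i j; rewrite !mxE.
    by rewrite -[k.+2%:R]natr1 !exprS; ring.
  apply: (@SS_lim _ _ (fun k => (k.+1%:R * r1 ^+ k)^-1 *: mpow B k.+1)).
    move=> k; apply: SS_scale => //; last exact: SS_mpow.
    by rewrite invr_gt0 mulr_gt0 // exprn_gt0.
  have h : V + r1 *: (harmonic k *: B) @[k --> \oo] --> V + r1 *: (0 *: B).
    apply: cvg_addmx; first exact: cvg_cst.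
    apply: cvg_scalemx; first exact: cvg_cst.
    by apply: cvg_scalemx; [exact: cvg_harmonic|exact: cvg_cst].
  rewrite scale0r scaler0 addr0 in h; apply: cvg_trans h; apply: near_eq_cvg.
  apply: nearW => k; rewrite pE /harmonic /=.
  apply/matrixP => i j; rewrite !mxE exprS.
  have hk : (k.+1%:R : R) != 0 by rewrite pnatr_eq0.
  have hr : r1 ^+ k != 0 by rewrite expf_neq0 // gt_eqF.
  by field; rewrite hr addrC natr1.
pose W := B *m B - r1 *: B.
have WB : W *m B = r2 *: W.
  rewrite /W mulmxBl B3 -scalemxAl scalerBr scalerA scalerDl.
  by apply/matrixP => i j; rewrite !mxE; ring.
have pE k : (r1 - r2) *: mpow B k = r1 ^+ k *: V - r2 ^+ k *: W.
  elim: k => [|k IH].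
    by rewrite /= /V /W; apply/matrixP => i j; rewrite !mxE; ring.
  rewrite mpowSr scalemxAl IH mulmxBl -!scalemxAl VB WB.
  by rewrite !scalerA !exprSr.
apply: (@SS_lim _ _ (fun k => (r1 ^+ k)^-1 *: ((r1 - r2) *: mpow B k))).
  move=> k; apply: SS_scale => //; first by rewrite invr_gt0 exprn_gt0.
  by apply: SS_scale; [rewrite subr_gt0|exact: SS_mpow].
have h : V - (r2 / r1) ^+ k *: W @[k --> \oo] --> V - 0 *: W.
  apply: cvg_addmx; first exact: cvg_cst.
  apply: cvg_oppmx; apply: cvg_scalemx; last exact: cvg_cst.
  by apply: cvg_expr; rewrite gtr0_norm ?divr_gt0 // ltr_pdivrMr // mul1r.
rewrite scale0r subr0 in h; apply: cvg_trans h; apply: near_eq_cvg.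
apply: nearW => k; rewrite pE expr_div_n.
have hr : r1 ^+ k != 0 by rewrite expf_neq0 // gt_eqF.
by apply/matrixP => i j; rewrite !mxE; field; rewrite hr.
Qed.

Variable z : 'rV[R]_4.
Hypothesis hz : invisible Lc z.
Hypothesis zz : formQ z z < 0.

(** If [z B] and [l0 B] are proportional, the rank one case applies. Otherwise [t] and [d] are the
    trace and determinant of [B] on its image plane. If [d = 0], either [B^2 = 0] or the rank one
    case applies to [B^2]; if [d > 0], it applies to the dominant part [V] whenever [V] is
    nonzero. *)
Theorem limit_spacelike B : SS B -> B != 0 -> formQ z (z *m B) < 0.
Proof.
move=> sB B0.
have iso u v : formQ (u *m B) (v *m B) = 0 by exact: (SS_iso hA).
have [l0 Ll0 lB0] := SS_survives hA hL sB B0.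
have [D|D] := eqVneq (dett (z *m B) (l0 *m B)) 0.
  have D' : dett (l0 *m B) (z *m B) = 0.
    by move: D; rewrite /dett => D; lra.
  have [k E] := iso_dep (iso l0 l0) (iso z z) (iso l0 z) lB0 D'.
  exact: (rank1_spacelike hA hL hz sB Ll0 lB0 E).
have [m00 [m01 [m10 [m11 [E0 E1 trB trBB det0]]]]] := iso_factor hA sB D.
pose t := \tr B; pose d := (t ^+ 2 - \tr (B *m B)) / 2.
have dE : d = m00 * m11 - m01 * m10 by rewrite /d /t trB trBB; field.
have quad := SS_quad hA sB; rewrite -/t -/d in quad.
(* Multiplication by [B] removes the adjoint terms, since [B^* B = 0]. *)
have B3 : B *m B *m B = t *: (B *m B) - d *: B.
  have := congr1 (mulmx^~ B) quad; rewrite !mulmxDl !mulNmx -!scalemxAl mul_scalar_mx.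
  rewrite -[adjQ B *m _ *m _]mulmxA (SS_orth' hA sB) mulmx0 scaler0 subr0 addr0 mul0mx.
  move: (B *m B) (B *m B *m B) => B2 B3 /eqP; rewrite addrAC subr_eq0 => /eqP E.
  by rewrite -E addrK.
pose s1 := formQ z (z *m B); pose q0 := formQ z z.
(* On the diagonal [B] and its adjoint give the same value, so the relation reads
   [2 s2 - 2 t s1 + d q0 = 0]. *)
have s2 : formQ z (z *m B *m B) = t * s1 - d * q0 / 2.
  have := congr1 (fun M => formQ z (z *m M)) quad.
  rewrite !(mulmxDr, mulmxN, mulmx0) -!scalemxAr mul_mx_scalar !mulmxA !formQE.
  rewrite -(formQ_adj z z) -(formQ_adj z (z *m adjQ B)) -(formQ_adj (z *m B) z).
  rewrite (formQC (z *m B) z) (formQC (z *m B *m B)) -/s1 -/q0; lra.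
have [d0|d0] := ltP 0 d; last first.
  have {}d0 : d = 0 by apply/le_anti; rewrite d0 dE det0.
  have [BB|BB] := eqVneq (B *m B) 0.
    exact: (nilpotent_spacelike hA hL hz sB Ll0 BB D).
  have sBB : SS (B *m B) by exact: SS_mul.
  have [l Ll lBB] := SS_survives hA hL sBB BB.
  rewrite mulmxA in lBB.
  rewrite d0 scale0r subr0 in B3; rewrite d0 !mul0r subr0 in s2.
  have eig (u : 'rV[R]_4) : u *m B *m B *m B = t *: (u *m B *m B).
    by rewrite -!mulmxA (mulmxA B B B) B3 -scalemxAr !mulmxA.
  have iso2 u v : formQ (u *m B *m B) (v *m B *m B) = 0 by exact: iso.
  have [D2|D2] := eqVneq (dett (l *m B *m B) (z *m B *m B)) 0.
    have [k] := iso_dep (iso2 l l) (iso2 z z) (iso2 l z) lBB D2.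
    rewrite -(mulmxA z) -(mulmxA l) => E.
    rewrite -mulmxA in lBB.
    have := rank1_spacelike hA hL hz sBB Ll lBB E.
    rewrite mulmxA s2 => s2n.
    have h1 := invisible_image hA hL hz sBB Ll lBB.
    (* [B^3 = t B^2] is again a limit, so [t] cannot be negative. *)
    have sB3 : SS (B *m B *m B) by exact: SS_mul.
    have := invisible_image_le hA hL hz sB3 Ll.
    rewrite B3 -scalemxAr formQZr => h2.
    rewrite -/s1; nra.
  (* Independent images under [B^2] span the image of [B], on which [B] is then multiplication by
     [t], of determinant [t ^ 2]; so [d = 0] would give [t = 0] and [B^2 = 0]. *)
  have all_eig (u : 'rV[R]_4) : u *m B *m B = t *: (u *m B).
    rewrite (iso_span (iso2 l l) (iso2 z z) (iso2 l z) (iso u u) (iso _ _) (iso _ _) D2).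
    by rewrite mulmxDl -!scalemxAl !eig scalerDr !scalerA mulrC [_ * t]mulrC.
  have : dett (z *m B *m B) (l0 *m B *m B) = t ^+ 2 * dett (z *m B) (l0 *m B).
    by rewrite !all_eig /dett !mxE; ring.
  rewrite E0 E1 dettE -dE d0 mul0r => /esym/eqP.
  rewrite mulf_eq0 (negPf D) orbF expf_eq0 /= => /eqP t0.
  by case/eqP: lBB; rewrite all_eig t0 scale0r.
(* This orbit stays in the cone over the limit set, so [- q(z, v k)] is a positive solution of the
   recurrence of [B], whose eigenvalues on the image are therefore real and positive. *)
pose v k := iter k (mulmx^~ B) (l0 *m B).
have v_im k : exists w, v k = w *m B.
  by case: k => [|k]; [exists l0|exists (v k)].
have vSS k : v k.+2 = t *: v k.+1 - d *: v k.
  have [w E] := v_im k; rewrite /= E -!mulmxA (mulmxA B B B) B3 mulmxBr -!scalemxAr.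
  by rewrite !mulmxA.
have v_cone k : exists t l, [/\ 0 < t, Lc l & v k = t *: l].
  elim: k => [|k [s [l [s0 Ll E]]]]; first exact: (SS_cone hA hL sB).
  have vk : v k.+1 != 0.
    apply/eqP => v0; have : v k.+1 *m B = t *: v k.+1 - d *: v k := vSS k; rewrite v0 mul0mx scaler0 sub0r.
    move=> /esym/eqP; rewrite oppr_eq0 scaler_eq0 gt_eqF //= E scaler_eq0 gt_eqF //=.
    by move=> /eqP l00; have := Lc_norm hL Ll; rewrite l00 !mxE; lra.
  have lB : l *m B != 0.
    by apply: contra vk => /eqP lB; rewrite /= -/(v k) E -scalemxAl lB scaler0.
  have [s' [l' [s'0 Ll' E']]] := SS_cone hA hL sB Ll lB.
  exists (s * s'), l'; split => //; first exact: mulr_gt0.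
  by rewrite /= -/(v k) E -scalemxAl E' scalerA.
have [t0 td] : 0 < t /\ 4 * d <= t ^+ 2.
  apply: (@positive_recurrence R (fun k => - formQ z (v k))) => // k.
    have [s [l [s0 Ll ->]]] := v_cone k.
    by rewrite formQZr oppr_gt0 pmulr_rlt0 //; exact: hz.
  by rewrite vSS !formQE; ring.
pose e := Num.sqrt (t ^+ 2 - 4 * d).
have e2 : e ^+ 2 = t ^+ 2 - 4 * d by rewrite sqr_sqrtr // subr_ge0.
have e0 : 0 <= e by exact: sqrtr_ge0.
pose r1 := (t + e) / 2; pose r2 := (t - e) / 2.
have r12 : r1 + r2 = t by rewrite /r1 /r2; field.
have r12' : r1 * r2 = d.
  have -> : r1 * r2 = (t ^+ 2 - e ^+ 2) / 4 by rewrite /r1 /r2; field.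
  by rewrite e2; field.
have r10 : 0 < r1 by rewrite /r1; lra.
have r20 : 0 < r2 by rewrite -(pmulr_rgt0 _ r10) r12'.
have r21 : r2 <= r1 by rewrite /r1 /r2; lra.
have q0n : q0 < 0 by [].
(* The weak inequality for [V] is enough: it reads [r1 s1 <= d q0 / 2]. *)
have concl : formQ z (z *m (B *m B - r2 *: B)) <= 0 -> s1 < 0.
  rewrite mulmxBr -scalemxAr mulmxA !formQE s2 -/s1 -r12 => h.
  have : r1 * s1 <= d * q0 / 2 by lra.
  have : d * q0 < 0 by rewrite pmulr_rlt0.
  move=> h1 h2; have : r1 * s1 < 0 by lra.
  by rewrite pmulr_rlt0.
have sV : SS (B *m B - r2 *: B).
  by apply: (dominant_limit sB r20 r21); rewrite r12 r12'.
apply: concl; set V := B *m B - r2 *: B in sV *.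
have [->|V0] := eqVneq V 0; first by rewrite mulmx0 formQ0r.
have [l Ll lV] := SS_survives hA hL sV V0.
have VB : V *m B = r1 *: V.
  rewrite /V mulmxBl B3 -r12 -r12' -scalemxAl scalerBr scalerA scalerDl.
  by apply/matrixP => i j; rewrite !mxE; ring.
have isoV u w : formQ (u *m V) (w *m V) = 0 by exact: (SS_iso hA).
have isoVB u w : formQ (u *m V) (w *m B) = 0.
  have -> : u *m V = (u *m B - r2 *: u) *m B.
    by rewrite /V mulmxBr mulmxBl -scalemxAr -scalemxAl mulmxA.
  exact: iso.
have [DV|DV] := eqVneq (dett (l *m V) (z *m V)) 0.
  have [k E] := iso_dep (isoV l l) (isoV z z) (isoV l z) lV DV.
  exact: ltW (rank1_spacelike hA hL hz sV Ll lV E).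
(* Independent images under [V] would make [B] act as [r1] on its image; the trace formula for
   [d = r1 r2] then forces [r1 = r2], hence [V = 0]. *)
have all_eig : B *m B = r1 *: B.
  apply/row_matrixP => i; rewrite !rowE -scalemxAr mulmxA.
  set u := delta_mx 0 i.
  rewrite (iso_span (isoV l l) (isoV z z) (isoV l z) (iso u u) (isoVB _ _) (isoVB _ _) DV).
  by rewrite mulmxDl -!scalemxAl -!mulmxA VB -!scalemxAr scalerDr !scalerA mulrC [_ * r1]mulrC.
have : d = t * r2 / 2.
  by rewrite /d all_eig mxtraceZ -/t -r12; field.
rewrite -r12' -r12 => h.
have r : r1 = r2.
  have : r2 * (r1 - r2) = 0 by lra.
  by move/eqP; rewrite mulf_eq0 gt_eqF //= subr_eq0 => /eqP.
by case/eqP: V0; rewrite /V all_eig r subrr.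
Qed.

End Escape2.

(** * Isometries are linear *)

Section Calculus.
Variable R : realType.

Lemma is_derive_line (V W : normedModType R) (f : V -> W) (u v : V) (t : R) :
  derivable f (t *: v + u) v ->
  is_derive t 1 (fun h => f (h *: v + u)) ('D_v f (t *: v + u)).
Proof.
have E : (fun h : R => h^-1 *: (((fun h => f (h *: v + u)) \o shift t) (h *: (1 : R))
    - f (t *: v + u))) =
  (fun h => h^-1 *: ((f \o shift (t *: v + u)) (h *: v) - f (t *: v + u))).
  apply/funext => h /=; congr (_ *: (f _ - _)).
  by rewrite [_%:A]mulr1 scalerDl addrA.
by move=> df; split; rewrite /derivable /derive E.
Qed.

Definition second_difference (V : normedModType R) (f : V -> R) (u v w : V) (t : R) :=
  f (t *: v + (t *: w + u)) - f (t *: v + u) - f (t *: w + u) + f u.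

Lemma second_differenceC (V : normedModType R) (f : V -> R) (u v w : V) (t : R) :
  second_difference f u v w t = second_difference f u w v t.
Proof. by rewrite /second_difference addrCA; ring. Qed.

(** The mean value theorem in direction [v] turns the second difference into a difference of values
    of [g] near [u], estimated by differentiability of [g] at [u]. *)
Lemma second_difference_derive (V : normedModType R) (f g : V -> R) (u v w : V) :
  (\forall x \near u, is_derive x v f (g x)) -> differentiable g u ->
  forall e, 0 < e -> \forall t \near (0 : R)^'+,
    `|second_difference f u v w t - t ^+ 2 * 'D_w g u| <= e * t ^+ 2.
Proof.
move=> df dd e e0.
pose C := 2 * `|v| + `|w| + 1.
have C0 : 0 < C by rewrite ltr_wpDl // addr_ge0 // mulr_ge0.
have eC : 0 < e / C by exact: divr_gt0.
have /eqaddoP/(_ _ eC) h1 := diff_locally dd.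
have h2 : \forall h \near (0 : V), is_derive (h + u) v f (g (h + u)).
  by move: df; rewrite (near_shift 0) /= => h; apply: filterS h => x /=; rewrite subr0 addrC.
have [d /= d0 hd] := iffLR nbhs_norm0P (filterI h1 h2).
near=> t.
have t0 : 0 < t by near: t; exact: nbhs_right_gt.
have tC : t * C < d.
  rewrite -ltr_pdivlMr //; near: t; apply: nbhs_right_lt; exact: divr_gt0.
have small s r : 0 <= s -> s <= t -> 0 <= r -> r <= t -> `|s *: v + r *: w| <= t * (C - `|v|).
  move=> s0 st r0 rt; apply: (le_trans (ler_normD _ _)); rewrite !normrZ !ger0_norm //.
  have := normr_ge0 v; have := normr_ge0 w; rewrite /C => h h'.
  have : s * `|v| <= t * `|v| by rewrite ler_wpM2r.
  have : r * `|w| <= t * `|w| by rewrite ler_wpM2r.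
  lra.
have small' s r : 0 <= s -> s <= t -> 0 <= r -> r <= t -> `|s *: v + r *: w| < d.
  move=> s0 st r0 rt; apply: (le_lt_trans (small s r s0 st r0 rt)).
  by apply: le_lt_trans tC; rewrite ler_pM2l // gerBl.
pose phi s := f (s *: v + (t *: w + u)) - f (s *: v + u).
have dphi s : 0 <= s -> s <= t -> is_derive s 1 phi
    (g (s *: v + (t *: w + u)) - g (s *: v + u)).
  move=> s0 st; apply: is_deriveB.
    have h : is_derive (s *: v + t *: w + u) v f (g (s *: v + t *: w + u)).
      by apply: (hd _ _).2 => /=; apply: small' => //; exact: ltW.
    rewrite -addrA in h; have [h3 h4] := h; rewrite -h4; exact: is_derive_line.
  have := small' s 0 s0 st (lexx _) (ltW t0); rewrite scale0r addr0 => h.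
  have [h3 h4] := (hd _ h).2; rewrite -h4; exact: is_derive_line.
have [s] : exists2 s, s \in `]0, t[%R & phi t - phi 0 =
    (g (s *: v + (t *: w + u)) - g (s *: v + u)) * (t - 0).
  apply: (@MVT R phi (fun s => g (s *: v + (t *: w + u)) - g (s *: v + u))) => //.
    by move=> s; rewrite in_itv /= => /andP[s0 st]; apply: dphi; exact: ltW.
  apply: derivable_within_continuous => s; rewrite in_itv /= => /andP[s0 st].
  by have := dphi s s0 st.
rewrite in_itv /= => /andP[s0 st] E.
have -> : second_difference f u v w t = phi t - phi 0.
  by rewrite /second_difference /phi !scale0r !add0r; ring.
rewrite E subr0 [X in _ ^+ 2 * X](deriveE _ dd).
set L := 'd g u.
have ha : `|g (s *: v + (t *: w + u)) - (g u + L (s *: v + t *: w))| <=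
    e / C * `|s *: v + t *: w|.
  have := (hd _ (small' s t (ltW s0) (ltW st) (ltW t0) (lexx _))).1.
  by rewrite /= addrA.
have hb : `|g (s *: v + u) - (g u + L (s *: v))| <= e / C * `|s *: v|.
  have := small' s 0 (ltW s0) (ltW st) (lexx _) (ltW t0); rewrite scale0r addr0 => h.
  exact: (hd _ h).1.
have LE : L (s *: v + t *: w) = L (s *: v) + t * L w by rewrite linearD [L (t *: w)]linearZ.
rewrite LE in ha.
set X := g (s *: v + (t *: w + u)) in ha *.
set Y := g (s *: v + u) in hb *.
have -> : (X - Y) * t - t ^+ 2 * L w =
   t * ((X - (g u + (L (s *: v) + t * L w))) - (Y - (g u + L (s *: v)))) by ring.
rewrite normrM gtr0_norm // expr2 mulrCA ler_pM2l //.
apply: (le_trans (ler_normB _ _)).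
apply: (le_trans (lerD ha hb)); rewrite -mulrDr.
have hs : `|s *: v + t *: w| + `|s *: v| <= t * C.
  have := small s t (ltW s0) (ltW st) (ltW t0) (lexx _) => h.
  have : `|s *: v| <= t * `|v| by rewrite normrZ gtr0_norm // ler_wpM2r // ltW.
  rewrite mulrBr in h; lra.
apply: (@le_trans _ _ (e / C * (t * C))); first by rewrite ler_wpM2l // ltW.
by rewrite mulrCA divfK ?gt_eqF // mulrC.
Unshelve. all: by end_near. Qed.

(** Both iterated derivatives are the limit of the same second difference, symmetric in [v] and [w],
    divided by [t ^ 2]. *)
Lemma Schwarz (V : normedModType R) (f fv fw : V -> R) (u v w : V) :
  (\forall x \near u, is_derive x v f (fv x)) ->
  (\forall x \near u, is_derive x w f (fw x)) ->
  differentiable fv u -> differentiable fw u -> 'D_w fv u = 'D_v fw u.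
Proof.
move=> hv hw dv dw; apply/eqP; rewrite -subr_eq0 -normr_le0.
apply/ler_addgt0Pl => e e0; rewrite addr0.
have e2 : 0 < e / 2 by exact: divr_gt0.
have h1 := second_difference_derive w hv dv e2.
have h2 := second_difference_derive v hw dw e2.
move: h1 h2; move: ('D_w fv u) ('D_v fw u) => a b h1 h2.
have [t [t1 [t2 t0]]] : exists t, `|second_difference f u v w t - t ^+ 2 * a| <= e / 2 * t ^+ 2
    /\ `|second_difference f u w v t - t ^+ 2 * b| <= e / 2 * t ^+ 2 /\ 0 < t.
  near (0 : R)^'+ => t; exists t; split; first by near: t.
  by split; [near: t|near: t; exact: nbhs_right_gt].
have T0 : 0 < t ^+ 2 by exact: exprn_gt0.
rewrite -(ler_pM2l T0) -{1}(gtr0_norm T0) -normrM.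
have DC := second_differenceC f u v w t.
move: (second_difference f u v w t) (second_difference f u w v t) DC t1 t2 => D _ <- t1 t2.
have -> : t ^+ 2 * (a - b) = (D - t ^+ 2 * b) - (D - t ^+ 2 * a) by ring.
apply: (le_trans (ler_normB _ _)); apply: (le_trans (lerD t2 t1)); lra.
Unshelve. all: by end_near. Qed.

Lemma derive0_cst (V : normedModType R) (f : V -> R) (u : V) :
  (forall t : R, 0 <= t <= 1 -> derivable f (t *: u) u /\ 'D_u f (t *: u) = 0) ->
  f u = f 0.
Proof.
move=> h; pose g (t : R) := f (t *: u + 0).
have dg (t : R) : 0 <= t <= 1 -> is_derive t 1 g 0.
  move=> /h[h1 h2]; have := @is_derive_line _ _ f 0 u t.
  by rewrite (addr0 (t *: u)) h2; exact.
have [t _] : exists2 t : R, t \in `]0, 1[%R & g 1 - g 0 = 0 * (1 - 0).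
  apply: (@MVT R g (fun=> 0) 0 1) => //.
    by move=> t; rewrite in_itv /= => /andP[t0 t1]; apply: dg; rewrite !ltW.
  apply: derivable_within_continuous => t; rewrite in_itv /= => ht.
  by have := dg t ht.
by rewrite mul0r /g scale1r scale0r !addr0 => /eqP; rewrite subr_eq0 => /eqP.
Qed.

Section Mx.
Variables (V : normedModType R) (m n p : nat).

Lemma is_derive_mulmx (M : V -> 'M[R]_(m, n)) (N : V -> 'M[R]_(n, p)) u v :
  derivable M u v -> derivable N u v ->
  is_derive u v (fun x => M x *m N x) ('D_v M u *m N u + M u *m 'D_v N u).
Proof.
move=> dM dN.
have dMij i j : derivable (fun x => M x i j) u v by move/derivable_mxP : dM; exact.
have dNij i j : derivable (fun x => N x i j) u v by move/derivable_mxP : dN; exact.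
have key i j : is_derive u v (fun x => (M x *m N x) i j)
    (('D_v M u *m N u + M u *m 'D_v N u) i j).
  have -> : (fun x => (M x *m N x) i j) = (\sum_k (fun x => M x i k) * (fun x => N x k j)).
    by apply/funext => x; rewrite mxE fct_sumE.
  apply: is_derive_eq.
    by apply: is_derive_sum => k; apply: is_deriveM; apply: derivableP.
  rewrite !mxE -big_split /=; apply: eq_bigr => k _.
  by rewrite !derive_mx // !mxE [RHS]addrC [X in _ = _ + X]mulrC.
have dMN : derivable (fun x => M x *m N x) u v.
  by apply/derivable_mxP => i j; have := key i j.
split=> //; rewrite derive_mx //; apply/matrixP => i j; rewrite mxE.
by have := key i j => -[_ ->].
Qed.

End Mx.

Lemma is_diff_comp1 (V : normedModType R) (f : R -> R) (g dg : V -> R) (u : V) (f' : R) :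
  is_diff u g dg -> is_derive (g u) 1 f f' ->
  is_diff u (f \o g) (fun v => dg v * f').
Proof.
move=> dgu df.
have ddf : differentiable f (g u) by apply/derivable1_diffP.
have dgd : differentiable g u by [].
split; first exact: differentiable_comp.
rewrite diff_comp // diff_val; apply/funext => v /=.
by rewrite deriv1E // derive1E derive_val.
Qed.

Lemma is_diff_coord n (u : 'rV[R]_n) (i : 'I_n) : is_diff u (fun x : 'rV[R]_n => x 0 i) (fun x => x 0 i).
Proof.
have h : linear (fun x : 'rV[R]_n => x 0 i) by move=> a x y; rewrite !mxE.
split; first exact: differentiable_coord.
pose f := HB.pack (fun x : 'rV[R]_n => x 0 i) (GRing.isLinear.Build _ _ _ _ (fun x : 'rV[R]_n => x 0 i) h)
  : {linear 'rV[R]_n -> R}.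
apply: (@diff_lin _ _ _ f u); exact: coord_continuous.
Qed.

End Calculus.

(** * The covering map in the chart, its differential and its metric *)

Section Cover.
Variable R : realType.
Implicit Types (u v w : 'rV[R]_3).

Lemma is_diff_row (V : normedModType R) n (f df : V -> 'rV[R]_n) (a : V) :
  (forall k, is_diff a (fun x => f x 0 k) (fun b => df b 0 k)) -> is_diff a f df.
Proof.
move=> h.
have df_k k : differentiable (fun x => f x 0 k) a by have := h k => -[].
have dfu : differentiable f a.
  have -> : f = \sum_k (fun x => f x 0 k *: (delta_mx 0 k : 'rV[R]_n)).
    by apply/funext => x; rewrite fct_sumE -row_sum_delta.
  apply: differentiable_sum => k; exact: differentiableZl.
split=> //; apply/funext => b; rewrite -deriveE //.
rewrite derive_mx; last exact: diff_derivable.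
apply/rowP => k; rewrite mxE deriveE //.
by have := h k => -[_ ->].
Qed.

Lemma ord3P (P : 'I_3 -> Prop) : P 0 -> P 1 -> P ord_max -> forall i, P i.
Proof.
move=> P0 P1 P2 [m mlt]; case: m mlt => [|[|[|//]]] mlt.
- by rewrite (_ : Ordinal mlt = 0)//; apply: val_inj.
- by rewrite (_ : Ordinal mlt = 1)//; apply: val_inj.
- by rewrite (_ : Ordinal mlt = ord_max)//; apply: val_inj.
Qed.

Lemma row3P (x y : 'rV[R]_3) : x 0 0 = y 0 0 -> x 0 1 = y 0 1 ->
  x 0 ord_max = y 0 ord_max -> x = y.
Proof. by move=> *; apply/rowP; apply: ord3P. Qed.

(** The factor that puts a ray on [q = -1], inverse to the third coordinate of the point of the
    hemisphere. *)
Definition sgm u : R := (Num.sqrt (1 - u 0 0 ^+ 2 - u 0 1 ^+ 2))^-1.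

Definition dsgm u v : R := (u 0 0 * v 0 0 + u 0 1 * v 0 1) * sgm u ^+ 3.

Definition dray u v : 'rV[R]_4 := \row_(i < 4)
  [:: v 0 ord_max * - sin (u 0 ord_max); v 0 ord_max * cos (u 0 ord_max); v 0 0; v 0 1]`_i.

(** The differential of the covering map at [u] in direction [v], by [diff_ads_cover]. *)
Definition dX u v : 'rV[R]_4 := sgm u *: dray u v + dsgm u v *: ray u.

Lemma rayE u : [/\ ray u 0 0 = cos (u 0 ord_max), ray u 0 1 = sin (u 0 ord_max),
  ray u 0 (inord 2) = u 0 0 & ray u 0 (inord 3) = u 0 1].
Proof. by rewrite !mxE /= !inordK. Qed.

Lemma drayE u v : [/\ dray u v 0 0 = v 0 ord_max * - sin (u 0 ord_max),
  dray u v 0 1 = v 0 ord_max * cos (u 0 ord_max),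
  dray u v 0 (inord 2) = v 0 0 & dray u v 0 (inord 3) = v 0 1].
Proof. by rewrite !mxE /= !inordK. Qed.

Lemma formQ_ray u : formQ (ray u) (ray u) = - (1 - u 0 0 ^+ 2 - u 0 1 ^+ 2).
Proof.
have [r0 r1 r2 r3] := rayE u; rewrite /formQ r0 r1 r2 r3.
have := cos2Dsin2 (u 0 ord_max); rewrite !expr2 => h; lra.
Qed.

Lemma ads_coverE u : ads_cover u = sgm u *: ray u.
Proof. by rewrite /ads_cover formQ_ray opprK. Qed.

Lemma dom_gt0 u : chart_dom u -> 0 < 1 - u 0 0 ^+ 2 - u 0 1 ^+ 2.
Proof. by rewrite /chart_dom /=; lra. Qed.

Lemma sgm_gt0 u : chart_dom u -> 0 < sgm u.
Proof. by move=> /dom_gt0 h; rewrite invr_gt0 sqrtr_gt0. Qed.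

Lemma sgm2 u : chart_dom u -> sgm u ^+ 2 * (1 - u 0 0 ^+ 2 - u 0 1 ^+ 2) = 1.
Proof.
move=> /dom_gt0 h; rewrite exprVn sqr_sqrtr ?ltW // mulVf // gt_eqF //.
Qed.

Lemma is_diff_sgm u : chart_dom u -> is_diff u sgm (dsgm u).
Proof.
move=> hu; have h := dom_gt0 hu.
pose g (x : 'rV[R]_3) : R := 1 - x 0 0 ^+ 2 - x 0 1 ^+ 2.
have dg : is_diff u g (fun v => - (2 * (u 0 0 * v 0 0 + u 0 1 * v 0 1))).
  have h0 := is_diff_coord u 0; have h1 := is_diff_coord u 1.
  apply: is_diff_eq.
  apply/funext => v; rewrite !fctE /= /GRing.scale /=.
  by rewrite (_ : (0 : 'rV[R]_3 -> R) v = 0) //; ring.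
have ds : is_derive (g u) 1 (fun x => (Num.sqrt x)^-1) (- (2^-1 * sgm u ^+ 3)).
  have s0 : Num.sqrt (g u) != 0 by rewrite gt_eqF // sqrtr_gt0.
  have := is_derive1_sqrt h => hs.
  apply: is_derive_eq.
  rewrite /GRing.scale /= /sgm -/(g u); field; rewrite s0 //.
have -> : sgm = (fun x => (Num.sqrt x)^-1) \o g by [].
have hc := is_diff_comp1 dg ds.
apply: is_diff_eq; by apply/funext => v; rewrite /dsgm; field.
Qed.

Lemma is_diff_ray u k : is_diff u (fun x => ray x 0 k) (fun v => dray u v 0 k).
Proof.
have h0 := is_diff_coord u 0; have h1 := is_diff_coord u 1.
have h2 := is_diff_coord u ord_max.
have c := is_derive_cos (u 0 ord_max); have hc := is_diff_comp1 h2 c.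
have d := is_derive_sin (u 0 ord_max); have hd := is_diff_comp1 h2 d.
move: k; apply: ord4P.
- have -> : (fun x => ray x 0 0) = cos \o (fun x : 'rV[R]_3 => x 0 ord_max).
    by apply/funext => x; have [-> _ _ _] := rayE x.
  by apply: is_diff_eq; apply/funext => v; have [-> _ _ _] := drayE u v.
- have -> : (fun x => ray x 0 1) = sin \o (fun x : 'rV[R]_3 => x 0 ord_max).
    by apply/funext => x; have [_ -> _ _] := rayE x.
  by apply: is_diff_eq; apply/funext => v; have [_ -> _ _] := drayE u v.
- have -> : (fun x => ray x 0 (inord 2)) = (fun x : 'rV[R]_3 => x 0 0).
    by apply/funext => x; have [_ _ -> _] := rayE x.
  by apply: is_diff_eq; apply/funext => v; have [_ _ -> _] := drayE u v.
- have -> : (fun x => ray x 0 (inord 3)) = (fun x : 'rV[R]_3 => x 0 1).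
    by apply/funext => x; have [_ _ _ ->] := rayE x.
  by apply: is_diff_eq; apply/funext => v; have [_ _ _ ->] := drayE u v.
Qed.

Lemma is_diff_ads_cover u : chart_dom u -> is_diff u (@ads_cover R) (dX u).
Proof.
move=> hu; apply: is_diff_row => k.
have h1 := is_diff_sgm hu; have h2 := is_diff_ray u k.
have -> : (fun x => ads_cover x 0 k) = sgm * (fun x => ray x 0 k).
  by apply/funext => x; rewrite ads_coverE mxE.
apply: is_diff_eq; apply/funext => v; rewrite ?fctE /= /dX !mxE /GRing.scale /= -/(ray u) -/(dray u v). by ring.
Qed.

Lemma differentiable_sgm u : chart_dom u -> differentiable sgm u.
Proof. by move=> hu; have := is_diff_sgm hu => -[]. Qed.

Lemma differentiable_ray u k : differentiable (fun x => ray x 0 k) u.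
Proof. by have := is_diff_ray u k => -[]. Qed.

Lemma differentiable_dray u v k : differentiable (fun x => dray x v 0 k) u.
Proof.
have h2 := is_diff_coord u ord_max.
have d2 : differentiable (fun x : 'rV[R]_3 => x 0 ord_max) u by [].
have c : differentiable (fun x : 'rV[R]_3 => cos (x 0 ord_max)) u.
  by have c := is_derive_cos (u 0 ord_max); have [] := is_diff_comp1 h2 c.
have s : differentiable (fun x : 'rV[R]_3 => sin (x 0 ord_max)) u.
  by have c' := is_derive_sin (u 0 ord_max); have [] := is_diff_comp1 h2 c'.
move: k; apply: ord4P.
- have -> : (fun x => dray x v 0 0) = (v 0 ord_max *: - (fun x : 'rV[R]_3 => sin (x 0 ord_max))).
    by apply/funext => x; have [-> _ _ _] := drayE x v.
  by apply: differentiableZ; apply: differentiableN.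
- have -> : (fun x => dray x v 0 1) = (v 0 ord_max *: (fun x : 'rV[R]_3 => cos (x 0 ord_max))).
    by apply/funext => x; have [_ -> _ _] := drayE x v.
  exact: differentiableZ.
- have -> : (fun x => dray x v 0 (inord 2)) = cst (v 0 0).
    by apply/funext => x; have [_ _ -> _] := drayE x v.
  exact: differentiable_cst.
- have -> : (fun x => dray x v 0 (inord 3)) = cst (v 0 1).
    by apply/funext => x; have [_ _ _ ->] := drayE x v.
  exact: differentiable_cst.
Qed.

Lemma differentiable_dsgm u v : chart_dom u -> differentiable (dsgm^~ v) u.
Proof.
move=> hu; have h0 := is_diff_coord u 0; have h1 := is_diff_coord u 1.
have h := is_diff_sgm hu.
have -> : dsgm^~ v = ((v 0 0 *: (fun x : 'rV[R]_3 => x 0 0)) + (v 0 1 *: (fun x : 'rV[R]_3 => x 0 1)))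
   * (sgm ^+ 3).
  by apply/funext => x; rewrite /dsgm !fctE /GRing.scale /=; ring.
by apply: differentiableM.
Qed.

Lemma differentiable_dX u v k : chart_dom u -> differentiable (fun x => dX x v 0 k) u.
Proof.
move=> hu.
have -> : (fun x => dX x v 0 k) =
    sgm * (fun x => dray x v 0 k) + (dsgm^~ v) * (fun x => ray x 0 k).
  by apply/funext => x; rewrite /dX mxE [in LHS]mxE [X in _ + X]mxE !fctE.
apply: differentiableD; apply: differentiableM.
- exact: differentiable_sgm.
- exact: differentiable_dray.
- exact: differentiable_dsgm.
- exact: differentiable_ray.
Qed.

Lemma diff_ads_cover u v : chart_dom u -> 'd (@ads_cover R) u v = dX u v.
Proof. by move=> hu; have [_ ->] := is_diff_ads_cover hu. Qed.

Lemma formQ_dray u v w : formQ (dray u v) (dray u w) =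
  v 0 0 * w 0 0 + v 0 1 * w 0 1 - v 0 ord_max * w 0 ord_max.
Proof.
have [r0 r1 r2 r3] := drayE u v; have [s0 s1 s2 s3] := drayE u w.
rewrite /formQ r0 r1 r2 r3 s0 s1 s2 s3.
have := cos2Dsin2 (u 0 ord_max); move: (cos _) (sin _) => c s h.
rewrite (_ : v 0 ord_max * w 0 ord_max = v 0 ord_max * w 0 ord_max * (c ^+ 2 + s ^+ 2)).
  by ring.
by rewrite h mulr1.
Qed.

Lemma formQ_ray_dray u v : formQ (ray u) (dray u v) = u 0 0 * v 0 0 + u 0 1 * v 0 1.
Proof.
have [r0 r1 r2 r3] := drayE u v; have [s0 s1 s2 s3] := rayE u.
by rewrite /formQ r0 r1 r2 r3 s0 s1 s2 s3; ring.
Qed.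

(** The metric is [sgm ^ 2] times [ds^2 - dtheta^2], with [ds^2] the round metric of the hemisphere
    read in the projection to the disc. *)
Lemma formQ_dX u v w : chart_dom u -> formQ (dX u v) (dX u w) =
  sgm u ^+ 2 * (v 0 0 * w 0 0 + v 0 1 * w 0 1 - v 0 ord_max * w 0 ord_max) +
  sgm u ^+ 4 * (u 0 0 * v 0 0 + u 0 1 * v 0 1) * (u 0 0 * w 0 0 + u 0 1 * w 0 1).
Proof.
move=> hu; rewrite /dX !formQE formQ_dray formQ_ray !(formQC (dray _ _) (ray _)) !formQ_ray_dray.
rewrite /dsgm; have := sgm2 hu; move: (sgm u) (1 - _ - _) => s D h.
move: (u 0 0 * v 0 0 + _) (u 0 0 * w 0 0 + _) (_ - v 0 ord_max * _) => a b c.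
transitivity (s ^+ 2 * c + 2 * s ^+ 4 * a * b - s ^+ 4 * a * b * (s ^+ 2 * D)); first by ring.
by rewrite h; ring.
Qed.

Lemma formQ_ads_cover u : chart_dom u -> formQ (ads_cover u) (ads_cover u) = -1.
Proof.
move=> hu; rewrite ads_coverE !formQE formQ_ray; have := sgm2 hu.
move: (sgm u) (1 - _ - _) => s D h; transitivity (- (s ^+ 2 * D)); first by ring.
by rewrite h.
Qed.

Lemma metricE u v w : chart_dom u -> metric u v w = formQ (dX u v) (dX u w).
Proof. by move=> hu; rewrite /metric !diff_ads_cover. Qed.

Lemma dett_dX u v : dett (ads_cover u) (dX u v) = sgm u ^+ 2 * v 0 ord_max.
Proof.
have [s0 s1 _ _] := rayE u; have [r0 r1 _ _] := drayE u v.
rewrite ads_coverE /dX /dett.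
have cE (a b : R) (x y : 'rV[R]_4) i : (a *: x + b *: y) 0 i = a * x 0 i + b * y 0 i.
  by rewrite !mxE.
have zE (a : R) (x : 'rV[R]_4) i : (a *: x) 0 i = a * x 0 i by rewrite !mxE.
rewrite !cE !zE s0 s1 r0 r1; have := cos2Dsin2 (u 0 ord_max).
move: (cos _) (sin _) (sgm u) (dsgm u v) (v 0 ord_max) => c s a d t h.
by rewrite -[RHS]mulr1 -h; ring.
Qed.

End Cover.

(** * Second derivatives of an immersion into [q = -1] *)

Section Frames.
Variable R : realType.
Implicit Types (u v w : 'rV[R]_3) (f g : 'rV[R]_3 -> 'rV[R]_4).

Lemma near_dom u : chart_dom u -> \forall x \near u, chart_dom x.
Proof.
move=> hu.
have c : (fun x : 'rV[R]_3 => x 0 0 * x 0 0 + x 0 1 * x 0 1) x @[x --> u] -->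
    u 0 0 * u 0 0 + u 0 1 * u 0 1.
  have c0 : (fun x : 'rV[R]_3 => x 0 0) x @[x --> u] --> u 0 0 by exact: coord_continuous.
  have c1 : (fun x : 'rV[R]_3 => x 0 1) x @[x --> u] --> u 0 1 by exact: coord_continuous.
  exact: cvgD (cvgM c0 c0) (cvgM c1 c1).
have lt1 : u 0 0 * u 0 0 + u 0 1 * u 0 1 < 1 by exact: hu.
by have := cvgr_lt _ c _ lt1; exact.
Qed.

Lemma is_derive_matrix (V : normedModType R) m n (M : V -> 'M[R]_(m, n)) (dM : 'M[R]_(m, n))
    (a b : V) :
  (forall i j, is_derive a b (fun x => M x i j) (dM i j)) -> is_derive a b M dM.
Proof.
move=> h; have dMa : derivable M a b by apply/derivable_mxP => i j; have [] := h i j.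
split=> //; rewrite derive_mx //; apply/matrixP => i j; rewrite mxE.
by have [_ ->] := h i j.
Qed.

Lemma derive_entry (V : normedModType R) m n (M : V -> 'M[R]_(m, n)) (a b : V) i j :
  derivable M a b -> is_derive a b (fun x => M x i j) ('D_b M a i j).
Proof.
move=> dMa; have dMij : derivable (fun x => M x i j) a b by move/derivable_mxP : dMa; exact.
by split=> //; rewrite derive_mx // mxE.
Qed.

Lemma is_derive_formQ (V : normedModType R) (f g : V -> 'rV[R]_4) (a b : V) :
  derivable f a b -> derivable g a b ->
  is_derive a b (fun x => formQ (f x) (g x)) (formQ ('D_b f a) (g a) + formQ (f a) ('D_b g a)).
Proof.
move=> df dg.
have hf i := derive_entry 0 i df; have hg i := derive_entry 0 i dg.
have -> : (fun x => formQ (f x) (g x)) =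
  - ((fun x => f x 0 0) * (fun x => g x 0 0)) - ((fun x => f x 0 1) * (fun x => g x 0 1))
  + ((fun x => f x 0 (inord 2)) * (fun x => g x 0 (inord 2)))
  + ((fun x => f x 0 (inord 3)) * (fun x => g x 0 (inord 3))) by [].
have h0 := hf 0; have h1 := hf 1; have h2 := hf (inord 2); have h3 := hf (inord 3).
have k0 := hg 0; have k1 := hg 1; have k2 := hg (inord 2); have k3 := hg (inord 3).
have h := is_deriveD (is_deriveD (is_deriveB (is_deriveN (is_deriveM h0 k0))
  (is_deriveM h1 k1)) (is_deriveM h2 k2)) (is_deriveM h3 k3).
apply: is_derive_eq h _; rewrite /formQ /GRing.scale /=; ring.
Qed.

Definition twice_diff f := forall u, chart_dom u ->
  differentiable f u /\ forall v, differentiable ('D_v f) u.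

Section One.
Variable f : 'rV[R]_3 -> 'rV[R]_4.
Hypothesis f2 : twice_diff f.
Hypothesis fQ : forall u, chart_dom u -> formQ (f u) (f u) = -1.

Lemma twice_derivable u v : chart_dom u -> derivable f u v.
Proof. by move=> /f2[h _]; exact: diff_derivable. Qed.

Arguments twice_derivable {u} v _.

Lemma twice_derivable2 u v w : chart_dom u -> derivable ('D_v f) u w.
Proof. by move=> /f2[_ h]; exact: diff_derivable. Qed.

Arguments twice_derivable2 {u} v w _.

Lemma formQ_derive_f u v : chart_dom u -> formQ ('D_v f u) (f u) = 0.
Proof.
move=> hu; have h := is_derive_formQ (twice_derivable v hu) (twice_derivable v hu).
have c : is_derive u v (fun x => formQ (f x) (f x)) 0.
  apply: near_eq_is_derive (is_derive_cst (-1 : R) u v).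
  by apply: filterS (near_dom hu) => x /fQ ->.
have := h; move=> [_]; have [_ ->] := c; rewrite (formQC (f u)); lra.
Qed.

Lemma formQ_derive2_f u v w : chart_dom u ->
  formQ ('D_w ('D_v f) u) (f u) = - formQ ('D_v f u) ('D_w f u).
Proof.
move=> hu; have h := is_derive_formQ (twice_derivable2 v w hu) (twice_derivable w hu).
have c : is_derive u w (fun x => formQ ('D_v f x) (f x)) 0.
  apply: near_eq_is_derive (is_derive_cst (0 : R) u w).
  by apply: filterS (near_dom hu) => x hx; rewrite formQ_derive_f.
have := h; move=> [_]; have [_ ->] := c; lra.
Qed.

Lemma derive2C u v w : chart_dom u -> 'D_w ('D_v f) u = 'D_v ('D_w f) u.
Proof.
move=> hu; apply/rowP => k.
have e' a b : 'D_b ('D_a f) u 0 k = 'D_b (fun x => 'D_a f x 0 k) u.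
  by have [_ <-] := derive_entry 0 k (twice_derivable2 a b hu).
have dd a : differentiable (fun x => 'D_a f x 0 k) u.
  have [_ /(_ a) d1] := f2 hu.
  by apply: (@differentiable_comp _ _ _ _ _ (fun M : 'rV[R]_4 => M 0 k)) => //; exact: differentiable_coord.
apply: etrans (e' v w) _; apply: etrans _ (esym (e' w v)); apply: (@Schwarz _ _ (fun x => f x 0 k)) => //.
- by apply: filterS (near_dom hu) => x hx; exact: (derive_entry 0 k (twice_derivable v hx)).
- by apply: filterS (near_dom hu) => x hx; exact: (derive_entry 0 k (twice_derivable w hx)).
Qed.

Arguments derive2C {u} v w _.

(** The first fundamental form determines the tangential components of the second derivatives; the
    component along the position is given by [formQ_derive2_f]. Together they determine the
    derivative of the adapted frame. *)
Lemma Koszul u v w a : chart_dom u ->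
  2 * formQ ('D_w ('D_v f) u) ('D_a f u) =
  'D_w (fun x => formQ ('D_v f x) ('D_a f x)) u + 'D_v (fun x => formQ ('D_w f x) ('D_a f x)) u
  - 'D_a (fun x => formQ ('D_w f x) ('D_v f x)) u.
Proof.
move=> hu.
have alg (P1 P2 P3 P4 P5 P6 A V W : 'rV[R]_4) (D1 D2 D3 : R) :
    D1 = formQ P1 A + formQ V P2 -> D2 = formQ P3 A + formQ W P4 ->
    D3 = formQ P5 V + formQ W P6 -> P1 = P3 -> P2 = P5 -> P4 = P6 ->
    2 * formQ P1 A = D1 + D2 - D3.
  by move=> -> -> -> -> -> ->; rewrite (formQC V); ring.
have h v1 v2 v3 := is_derive_formQ (twice_derivable2 v1 v3 hu) (twice_derivable2 v2 v3 hu).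
have [_ E1] := h v a w; have [_ E2] := h w a v; have [_ E3] := h w v a.
exact: alg E1 E2 E3 (derive2C v w hu) (derive2C a w hu) (derive2C a v hu).
Qed.

End One.
End Frames.
Arguments twice_derivable {R f} _ {u} v _.
Arguments twice_derivable2 {R f} _ {u} v w _.

(** * The transfer matrix between two immersions with the same metric *)

Section Lin.
Variable R : realType.
Implicit Types (u v w : 'rV[R]_3).
Local Notation J := (Jmx R).

Lemma derivable_of (V W : normedModType R) (f : V -> W) (a b : V) (df : W) :
  is_derive a b f df -> derivable f a b.
Proof. by case. Qed.

Lemma mulJ_entry m n (M : 'M[R]_(m, 4)) (N : 'M[R]_(n, 4)) i k :
  (M *m J *m N^T) i k = formQ (row i M) (row k N).
Proof.
rewrite formQJ !mxE; apply: eq_bigr => j _.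
by rewrite !mxE; congr (_ * _); apply: eq_bigr => l _; rewrite !mxE.
Qed.

Lemma mulJ_eq m n (M M' : 'M[R]_(m, 4)) (N N' : 'M[R]_(n, 4)) :
  (forall i k, formQ (row i M) (row k N) = formQ (row i M') (row k N')) ->
  M *m J *m N^T = M' *m J *m N'^T.
Proof. by move=> h; apply/matrixP => i k; rewrite !mulJ_entry. Qed.

Lemma formQ_congr4 (a b c d a' b' c' d' : 'rV[R]_4) : a = a' -> b = b' -> c = c' -> d = d' ->
  formQ a' b' = formQ c' d' -> formQ a b = formQ c d.
Proof. by move=> -> -> -> ->. Qed.

Lemma derivable_trmx (V : normedModType R) m n (M : V -> 'M[R]_(m, n)) (a b : V) :
  derivable M a b -> derivable (fun x => (M x)^T) a b.
Proof.
move=> h; apply/derivable_mxP => i j; under eq_fun do rewrite mxE.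
by have [] := derive_entry j i h.
Qed.

Definition tangents (f : 'rV[R]_3 -> 'rV[R]_4) u : 'M[R]_(3, 4) :=
  \matrix_(j, k) 'D_(delta_mx 0 j) f u 0 k.

Definition frame (f : 'rV[R]_3 -> 'rV[R]_4) u : 'M[R]_(1 + 3, 4) :=
  col_mx (f u) (tangents f u).

Lemma row_tangents f u j : row j (tangents f u) = 'D_(delta_mx 0 j) f u.
Proof. by apply/rowP => k; rewrite !mxE. Qed.

Lemma row1 (x : 'rV[R]_4) i : row i x = x.
Proof. by apply/rowP => k; rewrite !mxE ord1. Qed.

Lemma row_frame_u f u a : row (lshift 3 a) (frame f u) = f u.
Proof. by rewrite /frame rowKu row1. Qed.

Lemma row_frame_d f u j : row (rshift 1 j) (frame f u) = 'D_(delta_mx 0 j) f u.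
Proof. by rewrite /frame rowKd row_tangents. Qed.

Definition dframe f u w : 'M[R]_(1 + 3, 4) :=
  col_mx ('D_w f u) (\matrix_(j < 3, k < 4) 'D_w ('D_(delta_mx 0 j) f) u 0 k).

Lemma row_dframe_u f u w a : row (lshift 3 a) (dframe f u w) = 'D_w f u.
Proof. by rewrite /dframe rowKu row1. Qed.

Lemma row_dframe_d f u w j :
  row (rshift 1 j) (dframe f u w) = 'D_w ('D_(delta_mx 0 j) f) u.
Proof. by rewrite /dframe rowKd; apply/rowP => k; rewrite !mxE. Qed.

Lemma is_derive_tangents f u w : twice_diff f -> chart_dom u ->
  is_derive u w (tangents f) (\matrix_(j, k) 'D_w ('D_(delta_mx 0 j) f) u 0 k).
Proof.
move=> hf hu; apply: is_derive_matrix => i j; rewrite mxE.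
under eq_fun do rewrite mxE.
exact: (derive_entry 0 j (twice_derivable2 hf _ w hu)).
Qed.

Lemma is_derive_frame f u w : twice_diff f -> chart_dom u ->
  is_derive u w (frame f) (dframe f u w).
Proof.
move=> hf hu; rewrite /frame /dframe; apply: is_derive_matrix => i k; rewrite -[i]splitK.
case: (fintype.split i) => j /=.
- rewrite col_mxEu; under eq_fun do rewrite col_mxEu.
  by rewrite (ord1 j); exact: (derive_entry 0 k (twice_derivable hf w hu)).
- rewrite col_mxEd; under eq_fun do rewrite col_mxEd.
  have [d1 d2] := is_derive_tangents w hf hu; rewrite -d2.
  exact: (derive_entry j k d1).
Qed.

Variables X Y : 'rV[R]_3 -> 'rV[R]_4.
Hypothesis X2 : twice_diff X.
Hypothesis Y2 : twice_diff Y.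
Hypothesis XQ : forall u, chart_dom u -> formQ (X u) (X u) = -1.
Hypothesis YQ : forall u, chart_dom u -> formQ (Y u) (Y u) = -1.
Hypothesis XY : forall u v w, chart_dom u ->
  formQ ('D_v X u) ('D_w X u) = formQ ('D_v Y u) ('D_w Y u).
Variable ginv : 'rV[R]_3 -> 'M[R]_3.
Hypothesis ginvP : forall u, chart_dom u ->
  tangents X u *m J *m (tangents X u)^T *m ginv u = 1%:M.
Hypothesis dginv : forall u w, chart_dom u -> derivable ginv u w.

Let tX u v : chart_dom u -> formQ ('D_v X u) (X u) = 0.
Proof. exact: (formQ_derive_f X2 XQ). Qed.

Let tY u v : chart_dom u -> formQ ('D_v Y u) (Y u) = 0.
Proof. exact: (formQ_derive_f Y2 YQ). Qed.

(** The inverse of the frame, written with the inverse Gram matrix of the tangents so that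
    differentiability follows from that of [ginv]. The sign comes from [q(X, X) = -1]. *)
Definition dual u : 'M[R]_(4, 1 + 3) :=
  J *m row_mx (- (X u)^T) ((tangents X u)^T *m ginv u).

Lemma frame_dual u : chart_dom u -> frame X u *m dual u = 1%:M.
Proof.
move=> hu; rewrite /dual mulmxA mul_col_mx mul_col_row.
have -> : X u *m J *m - (X u)^T = 1%:M.
  apply/matrixP => i k; rewrite mulmxN mxE mulJ_entry !row1 XQ // opprK.
  by rewrite !ord1 mxE eqxx.
have h : X u *m J *m (tangents X u)^T = 0.
  apply/matrixP => i k; rewrite mulJ_entry row1 row_tangents [RHS]mxE.
  by rewrite formQC; exact: tX.
have -> : X u *m J *m ((tangents X u)^T *m ginv u) = 0 by rewrite mulmxA h mul0mx.
have -> : tangents X u *m J *m - (X u)^T = 0.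
  apply/matrixP => i k; rewrite mulmxN mxE mulJ_entry row1 row_tangents [RHS]mxE.
  by apply/eqP; rewrite oppr_eq0; apply/eqP; exact: tX.
by rewrite mulmxA ginvP // -scalar_mx_block.
Qed.

Lemma dual_frame u : chart_dom u -> dual u *m frame X u = 1%:M :> 'M[R]_4.
Proof. by move=> hu; apply: (@mulmx1C _ 4); exact: frame_dual. Qed.

Definition transfer u : 'M[R]_4 := dual u *m frame Y u.

Lemma frame_transfer u : chart_dom u -> frame X u *m transfer u = frame Y u.
Proof. by move=> hu; rewrite /transfer mulmxA frame_dual // mul1mx. Qed.

Lemma gram_eq u : chart_dom u ->
  frame X u *m J *m (frame X u)^T = frame Y u *m J *m (frame Y u)^T.
Proof.
move=> hu; apply: mulJ_eq => i k.
rewrite -[i]splitK -[k]splitK.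
case: (fintype.split i) => a; case: (fintype.split k) => b /=.
- apply: (formQ_congr4 (row_frame_u X u a) (row_frame_u X u b) (row_frame_u Y u a) (row_frame_u Y u b)); exact: etrans (XQ hu) (esym (YQ hu)).
- apply: (formQ_congr4 (row_frame_u X u a) (row_frame_d X u b) (row_frame_u Y u a) (row_frame_d Y u b)).
  rewrite formQC [RHS]formQC; exact: etrans (tX _ hu) (esym (tY _ hu)).
- apply: (formQ_congr4 (row_frame_d X u a) (row_frame_u X u b) (row_frame_d Y u a) (row_frame_u Y u b)); exact: etrans (tX _ hu) (esym (tY _ hu)).
- apply: (formQ_congr4 (row_frame_d X u a) (row_frame_d X u b) (row_frame_d Y u a) (row_frame_d Y u b)); exact: XY.
Qed.

Lemma transfer_orth u : chart_dom u -> transfer u *m J *m (transfer u)^T = J.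
Proof.
move=> hu; rewrite /transfer trmx_mul !mulmxA.
rewrite -[_ *m J *m (frame Y u)^T]mulmxA -[dual u *m frame Y u *m _]mulmxA.
rewrite [frame Y u *m _]mulmxA -gram_eq // !mulmxA dual_frame // mul1mx.
by rewrite -mulmxA -trmx_mul dual_frame // trmx1 mulmx1.
Qed.

Lemma transfer_unit u : chart_dom u -> transfer u *m adjQ (transfer u) = 1%:M.
Proof.
by move=> hu; rewrite adjQE !mulmxA transfer_orth // mulJJ.
Qed.

Lemma derivable_transfer u w : chart_dom u -> derivable transfer u w.
Proof.
move=> hu.
have dT := derivable_trmx (derivable_of (is_derive_tangents w X2 hu)).
have dTg := derivable_of (is_derive_mulmx dT (dginv (w := w) hu)).
have dXT := derivable_trmx (twice_derivable X2 w hu).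
have drow : derivable (fun x => row_mx (- (X x)^T) ((tangents X x)^T *m ginv x)) u w.
  apply/derivable_mxP => i j; rewrite -[j]splitK.
  case: (fintype.split j) => k /=.
    under eq_fun do rewrite row_mxEl mxE.
    by apply: derivableN; exact: derivable_of (derive_entry i k dXT).
  under eq_fun do rewrite row_mxEr.
  exact: derivable_of (derive_entry i k dTg).
have d1 := derivable_of (is_derive_mulmx (derivable_cst (J : 'M[R]_4) u w) drow).
exact: derivable_of (is_derive_mulmx d1 (derivable_of (is_derive_frame w Y2 hu))).
Qed.

Lemma derive_gram_eq u w : chart_dom u ->
  'D_w (frame X) u *m J *m (frame X u)^T = 'D_w (frame Y) u *m J *m (frame Y u)^T.
Proof.
move=> hu; have [_ ->] := is_derive_frame w X2 hu; have [_ ->] := is_derive_frame w Y2 hu.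
have E a b v : 'D_v (fun x => formQ ('D_a X x) ('D_b X x)) u = 'D_v (fun x => formQ ('D_a Y x) ('D_b Y x)) u.
  by apply: near_eq_derive; apply: filterS (near_dom hu) => x hx; exact: XY.
apply: mulJ_eq => i k; rewrite -[i]splitK -[k]splitK.
case: (fintype.split i) => a; case: (fintype.split k) => b /=.
- apply: (formQ_congr4 (row_dframe_u X u w a) (row_frame_u X u b) (row_dframe_u Y u w a) (row_frame_u Y u b)); exact: etrans (tX _ hu) (esym (tY _ hu)).
- apply: (formQ_congr4 (row_dframe_u X u w a) (row_frame_d X u b) (row_dframe_u Y u w a) (row_frame_d Y u b)); exact: XY.
- apply: (formQ_congr4 (row_dframe_d X u w a) (row_frame_u X u b) (row_dframe_d Y u w a) (row_frame_u Y u b)).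
  have e1 := formQ_derive2_f X2 XQ (delta_mx 0 a) w hu.
  have e2 := formQ_derive2_f Y2 YQ (delta_mx 0 a) w hu.
  apply: etrans e1 (etrans _ (esym e2)).
  by congr (- _); exact: XY.
- apply: (formQ_congr4 (row_dframe_d X u w a) (row_frame_d X u b) (row_dframe_d Y u w a) (row_frame_d Y u b)).
  have two : (2 : R) != 0 by rewrite pnatr_eq0.
  apply: (mulfI two).
  have e1 := Koszul X2 (delta_mx 0 a) w (delta_mx 0 b) hu.
  have e2 := Koszul Y2 (delta_mx 0 a) w (delta_mx 0 b) hu.
  have add3 (p q r p' q' r' : R) : p = p' -> q = q' -> r = r' -> p + q - r = p' + q' - r'.
    by move=> -> -> ->.
  have e3 := E (delta_mx 0 a) (delta_mx 0 b) w; have e4 := E w (delta_mx 0 b) (delta_mx 0 a).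
  have e5 := E w (delta_mx 0 a) (delta_mx 0 b).
  exact: etrans e1 (etrans (add3 _ _ _ _ _ _ e3 e4 e5) (esym e2)).
Qed.

(** By [derive_gram_eq] the derivative of the frame of [Y] is that of the frame of [X] times the
    transfer matrix, so differentiating [frame X *m transfer = frame Y] leaves only the derivative
    of the transfer matrix. *)
Lemma derive_transfer u w : chart_dom u -> 'D_w transfer u = 0.
Proof.
move=> hu.
have dX' := derivable_of (is_derive_frame w X2 hu); have dA := derivable_transfer (w := w) hu.
have h1 := is_derive_mulmx dX' dA.
have h2 : is_derive u w (frame Y) ('D_w (frame X) u *m transfer u + frame X u *m 'D_w transfer u).
  apply: near_eq_is_derive h1.
  by apply: filterS (near_dom hu) => x hx; exact: frame_transfer.
have h3 : 'D_w (frame Y) u = 'D_w (frame X) u *m transfer u.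
  have e0 := derive_gram_eq w hu.
  move: (transfer_unit hu) (dual_frame hu) (frame_transfer hu) e0 => /mulmx1C AA DF FT.
  move: ('D_w (frame X) u) ('D_w (frame Y) u) (frame X u) (frame Y u) (transfer u) (dual u)
    AA DF FT => DX DY MX MY A E AA DF FT e0.
  have e1 : MX^T *m E^T = 1%:M by rewrite -trmx_mul DF trmx1.
  have e2 := congr1 (fun M => M *m E^T *m J) e0; rewrite /= in e2.
  rewrite -FT trmx_mul !mulmxA in e2.
  rewrite -[DX *m J *m MX^T *m E^T]mulmxA e1 mulmx1 -[DX *m J *m J]mulmxA mulJJ mulmx1 in e2.
  rewrite e2 -[DY *m J *m A^T *m MX^T *m E^T]mulmxA e1 mulmx1.
  by rewrite -!mulmxA [J *m (A^T *m _)]mulmxA [J *m A^T *m (J *m A)]mulmxA -adjQE AA mulmx1.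
have [_] := h2; rewrite h3 => /esym/eqP; rewrite -subr_eq0 addrAC subrr add0r => /eqP h4.
by rewrite -[LHS]mul1mx -(dual_frame hu) -mulmxA h4 mulmx0.
Qed.

Lemma transfer_cst u : chart_dom u -> transfer u = transfer 0.
Proof.
move=> hu; apply/matrixP => i j; apply: (@derive0_cst _ _ (fun u => transfer u i j)).
move=> t /andP[t0 t1].
(* The chart domain is star-shaped around 0. *)
have ht : chart_dom (t *: u).
  move: hu; rewrite /chart_dom /= !mxE !exprMn => hu.
  have : t ^+ 2 <= 1 by rewrite expr2 mulr_ile1.
  have := sqr_ge0 t; have := sqr_ge0 (u 0 0); have := sqr_ge0 (u 0 1); nra.
have [h1 h2] := derive_entry i j (derivable_transfer (w := u) ht).
by split=> //; rewrite h2 derive_transfer // mxE.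
Qed.

End Lin.

(** * The cylinder and its charts *)

Section SetType.
Variables (X : topologicalType) (A : set X).

Lemma cvg_set_type (T : Type) (F : set_system T) {FF : Filter F} (f : T -> A) (z : A) :
  (fun t => set_val (f t)) @ F --> set_val z -> f @ F --> z.
Proof.
move=> h U; rewrite nbhsE => - [B [oB Bz] BU].
have [W oW WB] := oB.
have : nbhs (set_val z) W.
  by apply: open_nbhs_nbhs; split=> //; move: Bz; rewrite -WB.
move=> /h hW; apply: (@filterS _ F FF (fun t => W (set_val (f t)))) hW => t Wt.
by apply: BU; rewrite -WB.
Qed.

Lemma set_val_continuous : continuous (set_val : A -> X).
Proof. exact: initial_continuous. Qed.

Lemma set_val_inj : injective (set_val : A -> X).
Proof. exact: val_inj. Qed.

End SetType.

Section Cyl.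
Variable R : realType.
Implicit Types (z w : cyl R) (u v : 'rV[R]_3).

Lemma sum3 (V : nmodType) (F : 'I_3 -> V) : \sum_i F i = F 0 + F 1 + F ord_max.
Proof.
rewrite !big_ord_recl big_ord0 addr0 !addrA.
by do 2?congr (_ + _); congr F; apply: val_inj.
Qed.

Lemma dotE (x y : 'rV[R]_3) :
  dot x y = x 0 0 * y 0 0 + x 0 1 * y 0 1 + x 0 ord_max * y 0 ord_max.
Proof. exact: sum3. Qed.

Lemma pt_unit z : pt z 0 0 ^+ 2 + pt z 0 1 ^+ 2 + pt z 0 ord_max ^+ 2 = 1.
Proof. by have [h _] := set_valP z; rewrite -h /pt dotE !expr2. Qed.

Lemma pt_ge0 z : 0 <= pt z 0 ord_max.
Proof. by have [_ h] := set_valP z. Qed.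

Definition crd z : 'rV[R]_3 := \row_(i < 3) [:: pt z 0 0; pt z 0 1; tm z]`_i.

Lemma crdE z : [/\ crd z 0 0 = pt z 0 0, crd z 0 1 = pt z 0 1 & crd z 0 ord_max = tm z].
Proof. by rewrite !mxE. Qed.

Lemma chartE (z : ads R) : chart z = crd (to_cyl z).
Proof. by []. Qed.

Lemma pt3E z : pt z 0 ord_max = Num.sqrt (1 - pt z 0 0 ^+ 2 - pt z 0 1 ^+ 2).
Proof.
have h := pt_unit z; rewrite -(ger0_norm (pt_ge0 z)) -sqrtr_sqr; congr (Num.sqrt _).
lra.
Qed.

Lemma crd_inj : injective crd.
Proof.
move=> z w E; have [e0 e1 e2] := crdE z; have [f0 f1 f2] := crdE w.
apply: set_val_inj; rewrite [LHS]surjective_pairing [RHS]surjective_pairing.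
have E0 : pt z 0 0 = pt w 0 0 by rewrite -e0 E f0.
have E1 : pt z 0 1 = pt w 0 1 by rewrite -e1 E f1.
congr pair; last by rewrite -/(tm z) -e2 E f2.
by apply: row3P => //; rewrite -/(pt z) -/(pt w) !pt3E E0 E1.
Qed.

(** Factor of the radial retraction of the plane onto the closed unit disc; it makes [mk] a total
    continuous map, inverse to [crd] over the disc. *)
Definition shrink u : R := (Num.sqrt (Num.max 1 (u 0 0 ^+ 2 + u 0 1 ^+ 2)))^-1.

Lemma shrink_le1 u : shrink u ^+ 2 * (u 0 0 ^+ 2 + u 0 1 ^+ 2) <= 1.
Proof.
have m0 : 0 < Num.max 1 (u 0 0 ^+ 2 + u 0 1 ^+ 2) by rewrite lt_max ltr01.
rewrite /shrink exprVn sqr_sqrtr; last exact: ltW.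
by rewrite [leLHS]mulrC ler_pdivrMr // mul1r le_max lexx orbT.
Qed.

Lemma shrink1 u : u 0 0 ^+ 2 + u 0 1 ^+ 2 <= 1 -> shrink u = 1.
Proof. by move=> h; rewrite /shrink max_l // sqrtr1 invr1. Qed.

Definition lift_pt u : 'rV[R]_3 := \row_(i < 3)
  [:: shrink u * u 0 0; shrink u * u 0 1;
      Num.sqrt (1 - (shrink u * u 0 0) ^+ 2 - (shrink u * u 0 1) ^+ 2)]`_i.

Lemma mk_subproof u : cyl_set (lift_pt u, u 0 ord_max).
Proof.
split=> /=; last by rewrite !mxE /= sqrtr_ge0.
rewrite dotE !mxE /= -!expr2 sqr_sqrtr; first by ring.
have := shrink_le1 u; rewrite mulrDr -!exprMn; lra.
Qed.

Definition mk u : cyl R := SigSub (mem_set (mk_subproof u)).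

Lemma pt_mk u : pt (mk u) = lift_pt u. Proof. by []. Qed.
Lemma crd_mk u : u 0 0 ^+ 2 + u 0 1 ^+ 2 <= 1 -> crd (mk u) = u.
Proof.
move=> h; have [e0 e1 e2] := crdE (mk u).
by apply: row3P; rewrite ?e0 ?e1 ?e2 // pt_mk mxE /= shrink1 // mul1r.
Qed.

Lemma crd_le1 z : crd z 0 0 ^+ 2 + crd z 0 1 ^+ 2 <= 1.
Proof.
have [-> -> _] := crdE z; have := pt_unit z; have := sqr_ge0 (pt z 0 ord_max); lra.
Qed.

Lemma mk_crd z : mk (crd z) = z.
Proof. by apply: crd_inj; rewrite crd_mk // crd_le1. Qed.

Lemma pt_continuous : continuous (@pt R).
Proof.
move=> z; apply: (@continuous_comp _ _ _ (set_val : cyl R -> _) fst z).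
  exact: (@set_val_continuous _ (@cyl_set R) z).
by case: (set_val z) => a b; exact: cvg_fst.
Qed.

Lemma tm_continuous : continuous (@tm R).
Proof.
move=> z; apply: (@continuous_comp _ _ _ (set_val : cyl R -> _) snd z).
  exact: (@set_val_continuous _ (@cyl_set R) z).
by case: (set_val z) => a b; exact: cvg_snd.
Qed.

Lemma cvg_row3 (T : Type) (F : set_system T) {FF : Filter F} (f : T -> 'rV[R]_3) (l : 'rV[R]_3) :
  f t 0 0 @[t --> F] --> l 0 0 -> f t 0 1 @[t --> F] --> l 0 1 ->
  f t 0 ord_max @[t --> F] --> l 0 ord_max -> f @ F --> l.
Proof.
by move=> h0 h1 h2; apply: cvg_mxP => i; rewrite (ord1 i); apply: ord3P.
Qed.

Lemma crd_continuous : continuous crd.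
Proof.
move=> z; have FF : Filter (nbhs z) by exact: nbhs_filter.
have E0 t := let: And3 h _ _ := crdE t in h.
have E1 t := let: And3 _ h _ := crdE t in h.
have E2 t := let: And3 _ _ h := crdE t in h.
apply: (@cvg_row3 _ (nbhs z) FF crd (crd z)).
- rewrite E0; under eq_fun do rewrite E0; 
  by have h := @cvg_coord R _ (nbhs z) 1 3 (@pt R) (pt z) 0 0; apply: h; exact: pt_continuous.
- rewrite E1; under eq_fun do rewrite E1; 
  by have h := @cvg_coord R _ (nbhs z) 1 3 (@pt R) (pt z) 0 1; apply: h; exact: pt_continuous.
- by rewrite E2; under eq_fun do rewrite E2; exact: (@tm_continuous z).
Qed.

Lemma cvg_sqrt (T : Type) (F : set_system T) (f : T -> R) (l : R) :
  f @ F --> l -> Num.sqrt (f t) @[t --> F] --> Num.sqrt l.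
Proof. by move=> h; exact: (cvg_comp f Num.sqrt h (@sqrt_continuous R l)). Qed.

Lemma cvg_sqr (T : Type) (F : set_system T) {FF : Filter F} (f : T -> R) (l : R) :
  f @ F --> l -> f t ^+ 2 @[t --> F] --> l ^+ 2.
Proof.
move=> h; rewrite expr2; under eq_fun do rewrite expr2; exact: (cvgM h h).
Qed.

Lemma shrink_continuous : continuous shrink.
Proof.
move=> u; have n0 : Num.sqrt (Num.max 1 (u 0 0 ^+ 2 + u 0 1 ^+ 2)) != 0.
  by rewrite gt_eqF // sqrtr_gt0 lt_max ltr01.
suff h : (fun v : 'rV[R]_3 => Num.max 1 (v 0 0 ^+ 2 + v 0 1 ^+ 2)) v @[v --> u] -->
    Num.max 1 (u 0 0 ^+ 2 + u 0 1 ^+ 2) by exact: cvgV n0 (cvg_sqrt h).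
apply: (@continuous_max _ _ (fun=> 1) (fun u : 'rV[R]_3 => u 0 0 ^+ 2 + u 0 1 ^+ 2)).
  exact: cst_continuous.
have c i : (fun v : 'rV[R]_3 => v 0 i ^+ 2) v @[v --> u] --> u 0 i ^+ 2.
  exact: (cvg_sqr (@coord_continuous R 1 3 0 i u)).
exact: cvgD (c 0) (c 1).
Qed.

Lemma lift_pt_continuous : continuous lift_pt.
Proof.
have h j : continuous (fun u : 'rV[R]_3 => shrink u * u 0 j).
  by move=> u; exact: (cvgM (@shrink_continuous u) (@coord_continuous R 1 3 0 j u)).
move=> u; have [e0 e1] : (forall v, lift_pt v 0 0 = shrink v * v 0 0) /\
    (forall v, lift_pt v 0 1 = shrink v * v 0 1) by split=> v; rewrite mxE.
have e2 v : lift_pt v 0 ord_max =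
  Num.sqrt (1 - (shrink v * v 0 0) ^+ 2 - (shrink v * v 0 1) ^+ 2) by rewrite mxE.
apply: (@cvg_row3 _ (nbhs u) _ lift_pt (lift_pt u)).
- by rewrite e0; under eq_fun do rewrite e0; exact: (h 0 u).
- by rewrite e1; under eq_fun do rewrite e1; exact: (h 1 u).
- rewrite e2; under eq_fun do rewrite e2.
  exact: (cvg_sqrt (cvgB (cvgB (cvg_cst _) (cvg_sqr (h 0 u))) (cvg_sqr (h 1 u)))).
Qed.

Lemma mk_continuous : continuous mk.
Proof.
move=> u; apply: (@cvg_set_type _ (@cyl_set R) _ (nbhs u) _ mk (mk u)).
exact: (@cvg_pairT _ (nbhs u) _ _ _ lift_pt (fun v : 'rV[R]_3 => v 0 ord_max)
  _ _ (@lift_pt_continuous u) (@coord_continuous R 1 3 0 ord_max u)).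
Qed.

Lemma cvg_cyl (T : Type) (F : set_system T) {FF : Filter F} (f : T -> cyl R) z :
  crd (f t) @[t --> F] --> crd z -> f @ F --> z.
Proof.
move=> h; have := cvg_comp (fun t => crd (f t)) mk h (@mk_continuous _).
have -> : mk \o (fun t => crd (f t)) = f by apply/funext => t; exact: mk_crd.
by rewrite mk_crd.
Qed.

Lemma cvg_ads (T : Type) (F : set_system T) {FF : Filter F} (f : T -> ads R) (z : ads R) :
  to_cyl (f t) @[t --> F] --> to_cyl z -> f @ F --> z.
Proof. by move=> h; exact: (@cvg_set_type _ (@ads_set R) _ F _ f z). Qed.

Lemma to_cyl_continuous : continuous (@to_cyl R).
Proof. exact: set_val_continuous. Qed.

Lemma chart_continuous : continuous (@chart R).
Proof.
move=> z; apply: (@continuous_comp _ _ _ (@to_cyl R) crd z); first exact: to_cyl_continuous.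
exact: crd_continuous.
Qed.

Lemma cvg_ads_chart (T : Type) (F : set_system T) {FF : Filter F} (f : T -> ads R) (z : ads R) :
  chart (f t) @[t --> F] --> chart z -> f @ F --> z.
Proof.
move=> h; apply: (@cvg_ads _ F _ f z).
exact: (@cvg_cyl _ F _ (fun t => to_cyl (f t)) (to_cyl z)).
Qed.

Lemma chart_inj : injective (@chart R).
Proof. by move=> z w /crd_inj/set_val_inj. Qed.

Lemma chart_domP (z : ads R) : chart_dom (chart z).
Proof.
have := set_valP z; rewrite /ads_set /= => h.
have [e0 e1 _] := crdE (to_cyl z); rewrite /chart_dom /= chartE e0 e1.
have := pt_unit (to_cyl z); rewrite /to_cyl; nra.
Qed.

Lemma mka_subproof u : chart_dom u -> ads_set (mk u).
Proof.
rewrite /chart_dom /= /ads_set /= pt_mk mxE /= sqrtr_gt0 => h.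
by rewrite shrink1 ?mul1r; [lra|exact: ltW].
Qed.

Lemma dom0 : chart_dom (0 : 'rV[R]_3).
Proof. by rewrite /chart_dom /= !mxE expr0n addr0 ltr01. Qed.

Definition mka u : ads R :=
  if pselect (chart_dom u) is left h then SigSub (mem_set (mka_subproof h))
  else SigSub (mem_set (mka_subproof dom0)).

Lemma chart_mka u : chart_dom u -> chart (mka u) = u.
Proof.
move=> h; rewrite /mka; case: pselect => // h'.
by rewrite chartE [to_cyl _]/(mk u) crd_mk // ltW.
Qed.

Lemma mka_chart (z : ads R) : mka (chart z) = z.
Proof. by apply: chart_inj; rewrite chart_mka //; exact: chart_domP. Qed.

End Cyl.

(** * Regularity of the covering map and of its composition with an isometry *)

Section Param.
Variable R : realType.
Implicit Types (u v w : 'rV[R]_3).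

Lemma near_eq_differentiable (V W : normedModType R) (f g : V -> W) (u : V) :
  (\forall x \near u, f x = g x) -> differentiable f u -> differentiable g u.
Proof.
move=> fg /diff_locallyP[cf /eqaddoP hf].
have fgu : f u = g u by exact: nbhs_singleton fg.
have hg : g \o shift u = cst (g u) + 'd f u +o_ 0 id.
  apply/eqaddoP => e e0; have h1 := hf e e0.
  have h2 : \forall y \near (0 : V), f (y + u) = g (y + u).
    by have := fg; rewrite (near_shift 0) subr0.
  apply: (@filterS2 _ _ _ _ _ _ _ h1 h2) => x.
  by rewrite !fctE /= -fgu => + E; rewrite E.
have dE := diff_unique cf hg.
by apply/diff_locallyP; rewrite dE.
Qed.

Lemma differentiable_row n (f : 'rV[R]_3 -> 'rV[R]_n) u :
  (forall k, differentiable (fun x => f x 0 k) u) -> differentiable f u.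
Proof.
move=> h; have hk k : is_diff u (fun x => f x 0 k) ('d (fun x => f x 0 k) u) by split.
suff [] : is_diff u f (fun b => \row_k 'd (fun x => f x 0 k) u b) by [].
apply: is_diff_row => k; have := hk k.
have -> : (fun b => (\row_k 'd (fun x => f x 0 k) u b) 0 k) = 'd (fun x => f x 0 k) u.
  by apply/funext => b; rewrite mxE.
by [].
Qed.

Lemma dX_linear u v : chart_dom u ->
  dX u v = \sum_j v 0 j *: dX u (delta_mx 0 j).
Proof.
move=> hu; rewrite -(diff_ads_cover v hu) {1}(row_sum_delta v) linear_sum.
by apply: eq_bigr => j _; rewrite linearZ /= (diff_ads_cover _ hu).
Qed.

Lemma twice_diff_ads_cover : twice_diff (@ads_cover R).
Proof.
move=> u hu; split; first by have [] := is_diff_ads_cover hu.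
move=> v; have h : differentiable (fun x => dX x v) u.
  by apply: differentiable_row => k; exact: differentiable_dX.
apply: near_eq_differentiable h; apply: filterS (near_dom hu) => x hx.
have [dx _] := is_diff_ads_cover hx.
exact: etrans (esym (diff_ads_cover v hx)) (esym (deriveE v dx)).
Qed.

Lemma derive_ads_cover u v : chart_dom u -> 'D_v (@ads_cover R) u = dX u v.
Proof.
move=> hu; have [dx _] := is_diff_ads_cover hu.
exact: etrans (deriveE v dx) (diff_ads_cover v hu).
Qed.

Section Comp.
Variable F : 'rV[R]_3 -> 'rV[R]_3.
Hypothesis Fdom : forall u, chart_dom u -> chart_dom (F u).
Hypothesis Fd : forall u, chart_dom u -> differentiable F u.
Hypothesis Fd2 : forall u v, chart_dom u -> differentiable ('D_v F) u.

Let Y u := ads_cover (F u).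

Lemma derive_ads_cover_comp u v : chart_dom u -> 'D_v Y u = dX (F u) ('D_v F u).
Proof.
move=> hu; have [dx _] := is_diff_ads_cover (Fdom hu).
have dY : differentiable Y u by exact: (differentiable_comp (Fd hu) dx).
apply: (etrans (deriveE v dY)).
have := @diff_comp _ _ _ _ F (@ads_cover R) u (Fd hu) dx.
move=> /(congr1 (fun f => f v)) h; apply: (etrans h) => /=.
rewrite (diff_ads_cover _ (Fdom hu)); congr dX.
exact: esym (deriveE v (Fd hu)).
Qed.

Lemma twice_diff_comp : twice_diff Y.
Proof.
move=> u hu; have [dx _] := is_diff_ads_cover (Fdom hu); split.
  exact: (differentiable_comp (Fd hu) dx).
move=> v.
have h : differentiable (fun x => \sum_j ('D_v F x 0 j *: dX (F x) (delta_mx 0 j))) u.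
  apply: differentiable_row => k.
  have -> : (fun x => (\sum_j ('D_v F x 0 j *: dX (F x) (delta_mx 0 j))) 0 k) =
    \sum_j ((fun x => 'D_v F x 0 j) * (fun x => dX (F x) (delta_mx 0 j) 0 k)).
    apply/funext => x; rewrite summxE fct_sumE; apply: eq_bigr => j _.
    by rewrite mxE.
  apply: differentiable_sum => j; apply: differentiableM.
    have c : differentiable (fun x : 'rV[R]_3 => x 0 j) ('D_v F u).
      exact: differentiable_coord.
    exact: (@differentiable_comp _ _ _ _ ('D_v F) (fun x : 'rV[R]_3 => x 0 j) u (Fd2 v hu) c).
  exact: (@differentiable_comp _ _ _ _ F (fun x => dX x (delta_mx 0 j) 0 k) u (Fd hu)
    (differentiable_dX _ _ (Fdom hu))).
apply: near_eq_differentiable h; apply: filterS (near_dom hu) => x hx.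
exact: etrans (esym (dX_linear _ (Fdom hx))) (esym (derive_ads_cover_comp v hx)).
Qed.

End Comp.

End Param.

(** * The inverse metric and the orientation of the frame *)

Section Ginv.
Variable R : realType.
Implicit Types (u v w : 'rV[R]_3).

Definition disc_crd u (a : 'I_3) : R := if a == ord_max then 0 else u 0 a.
Definition causal_sgn (a : 'I_3) : R := if a == ord_max then -1 else 1.

(** The inverse of [sgm ^ 2 (eta + sgm ^ 2 p^T p)], with [eta = diag(1, 1, -1)] and [p] the disc
    coordinates extended by 0 in time, by the Sherman-Morrison formula. *)
Definition ginv u : 'M[R]_3 := \matrix_(a, b)
  ((1 - u 0 0 ^+ 2 - u 0 1 ^+ 2) *
   (causal_sgn a * (a == b)%:R - disc_crd u a * disc_crd u b)).

Lemma gram_delta u a b : chart_dom u ->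
  formQ (dX u (delta_mx 0 a)) (dX u (delta_mx 0 b)) =
  sgm u ^+ 2 * (causal_sgn a * (a == b)%:R) + sgm u ^+ 4 * disc_crd u a * disc_crd u b.
Proof.
move=> hu; rewrite formQ_dX // !mxE !eqxx /=.
have n01 : (0 == 1 :> 'I_3) = false by [].
by move: a b; do 2!apply: ord3P; rewrite /disc_crd /causal_sgn /=; ring.
Qed.

Lemma ginvP u : chart_dom u ->
  tangents (@ads_cover R) u *m Jmx R *m (tangents (@ads_cover R) u)^T *m ginv u = 1%:M.
Proof.
move=> hu; apply/matrixP => a b; rewrite mxE sum3.
have E i : (tangents (@ads_cover R) u *m Jmx R *m (tangents (@ads_cover R) u)^T) a i =
   sgm u ^+ 2 * (causal_sgn a * (a == i)%:R) + sgm u ^+ 4 * disc_crd u a * disc_crd u i.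
  rewrite -gram_delta // mulJ_entry; congr formQ.
    exact: etrans (row_tangents _ _ _) (derive_ads_cover _ hu).
  exact: etrans (row_tangents _ _ _) (derive_ads_cover _ hu).
rewrite !E !mxE; have := sgm2 hu; move: (sgm u) => s h.
have e4 : s ^+ 4 = s ^+ 2 * s ^+ 2 by rewrite -exprD.
rewrite e4; move: (s ^+ 2) h => S h; clear E e4 hu s.
have k (c d : R) : S * (1 - u 0 0 ^+ 2 - u 0 1 ^+ 2) * c +
    S * (1 - u 0 0 ^+ 2 - u 0 1 ^+ 2) * (S * (1 - u 0 0 ^+ 2 - u 0 1 ^+ 2)) * d = c + d.
  by rewrite h; ring.
have k1 := k (1 - u 0 0 * u 0 0) (u 0 0 * u 0 0); have k2 := k (- (u 0 0 * u 0 1)) (u 0 0 * u 0 1).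
have k3 := k (1 - u 0 1 * u 0 1) (u 0 1 * u 0 1); have k4 := k 1 0.
move: a b; do 2!apply: ord3P; rewrite /disc_crd /causal_sgn /=;
  move: (u 0 0) (u 0 1) k1 k2 k3 k4 => x y k1 k2 k3 k4; clear -k1 k2 k3 k4; lra.
Qed.

Lemma derivable_ginv u w : chart_dom u -> derivable ginv u w.
Proof.
move=> hu; apply/derivable_mxP => a b; apply: diff_derivable.
have c0 (i : 'I_3) : differentiable (fun x : 'rV[R]_3 => x 0 i) u by exact: differentiable_coord.
have d a' : differentiable (fun x : 'rV[R]_3 => disc_crd x a') u.
  rewrite /disc_crd; case: (a' == ord_max); last exact: c0.
  exact: differentiable_cst.
have -> : (fun x => ginv x a b) =
   (cst 1 - (fun x : 'rV[R]_3 => x 0 0) ^+ 2 - (fun x : 'rV[R]_3 => x 0 1) ^+ 2) *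
   (cst (causal_sgn a * (a == b)%:R) - (fun x => disc_crd x a) * (fun x => disc_crd x b)).
  by apply/funext => x; rewrite mxE !fctE.
apply: differentiableM; apply: differentiableB.
- by apply: differentiableB; [exact: differentiable_cst|exact: differentiableX].
- exact: differentiableX.
- exact: differentiable_cst.
- exact: differentiableM.
Qed.

(** Rotation of the negative plane, that is, translation in [theta]; it brings frames back to time
    0. *)
Definition rot (t : R) : 'M[R]_4 := \matrix_(i, j)
  (nth [::] [:: [:: cos t; sin t; 0; 0]; [:: - sin t; cos t; 0; 0];
                [:: 0; 0; 1; 0]; [:: 0; 0; 0; 1]] i)`_j.

Lemma rotD s t : rot (s + t) = rot s *m rot t.
Proof.
apply/matrixP => i j; rewrite !mxE sum4 !mxE cosD sinD.
move: i j; do 2!apply: ord4P; rewrite /= ?inordK //=; ring.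
Qed.

Lemma rot0 : rot 0 = 1%:M.
Proof.
apply/matrixP => i j; rewrite !mxE cos0 sin0 oppr0.
by move: i j; do 2!apply: ord4P; rewrite /= ?inordK //= -?val_eqE /= ?inordK.
Qed.

Lemma det_rot t : 0 < \det (rot t).
Proof.
have n0 : \det (rot t) != 0.
  have : \det (rot t) * \det (rot (- t)) = 1.
    by rewrite -det_mulmx -rotD subrr rot0 det1.
  by move=> h; apply/eqP => E; move: h; rewrite E mul0r => /esym/eqP; rewrite oner_eq0.
rewrite lt_neqAle eq_sym n0 [t]splitr rotD det_mulmx.
exact: sqr_ge0.
Qed.

Definition std_frame : 'M[R]_(1 + 3, 4) := col_mx (delta_mx 0 0)
  (\matrix_(j < 3) [:: delta_mx 0 (inord 2); delta_mx 0 (inord 3); delta_mx 0 1]`_j).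

Definition frame_coef u : 'M[R]_(1 + 3) :=
  block_mx (sgm u)%:M 0 (\col_j dsgm u (delta_mx 0 j)) (sgm u)%:M *m
  block_mx 1%:M (\row_j disc_crd u j) 0 1%:M.

Lemma det_frame_coef u : chart_dom u -> 0 < \det (frame_coef u).
Proof.
move=> hu; rewrite det_mulmx det_lblock det_ublock !det_scalar !expr1n !mulr1 expr1.
by rewrite mulr_gt0 ?exprn_gt0 // sgm_gt0.
Qed.

Lemma delta_rot (k : 'I_4) t : delta_mx 0 k *m rot t = row k (rot t).
Proof. by rewrite rowE. Qed.

(** Every frame is a matrix of positive determinant times a fixed frame times a rotation, so the
    sign of its determinant does not depend on the point. This converts the sign of a Jacobian into
    the sign of [\det A]. *)
Lemma frame_adsE u : chart_dom u ->
  frame (@ads_cover R) u = frame_coef u *m (std_frame *m rot (u 0 ord_max)).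
Proof.
move=> hu; rewrite /std_frame mul_col_mx delta_rot.
set N1 := (X in col_mx _ X).
have E1 j : row j N1 = dray u (delta_mx 0 j).
  rewrite /N1 row_mul rowK; move: j; apply: ord3P; rewrite /= delta_rot;
  apply/rowP; apply: ord4P; rewrite !mxE /= ?inordK // -?val_eqE /= ?inordK //=; ring.
have rE : row 0 (rot (u 0 ord_max)) + (\row_j disc_crd u j) *m N1 = ray u.
  have -> : (\row_j disc_crd u j) *m N1 = \sum_j disc_crd u j *: dray u (delta_mx 0 j).
    rewrite mulmx_sum_row; apply: eq_bigr => j _; by rewrite mxE E1.
  rewrite sum3; have [r0 r1 r2 r3] := rayE u.
  apply/rowP; apply: ord4P; rewrite ?r0 ?r1 ?r2 ?r3 !mxE /= ?inordK //=;
  rewrite /disc_crd /= -?val_eqE /= ?inordK //=; ring.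
rewrite /frame_coef -mulmxA !mul_block_col !mul1mx !mul0mx add0r rE.
rewrite mul_scalar_mx addr0; congr col_mx; first exact: ads_coverE.
apply/row_matrixP => j; apply: (etrans (row_tangents _ _ _)).
apply: (etrans (derive_ads_cover _ hu)); rewrite /dX.
rewrite linearD /= row_mul mul_scalar_mx linearZ /= E1.
by rewrite addrC; congr (_ + _); apply/rowP => k; rewrite !mxE big_ord1 !mxE.
Qed.

End Ginv.

(** * Linear parts, timelike rays and tangent spaces *)

Section Linear.
Variable R : realType.
Implicit Types (u v w : 'rV[R]_3) (x y : 'rV[R]_4) (g : ads R -> ads R).

Definition linear_part g (A : 'M[R]_4) := forall z, ads_cover (chart (g z)) = ads_cover (chart z) *m A.

(** The rays at the origin, at time [pi / 2] and at distance [1 / 2] on the two disc axes span the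
    space. *)
Lemma ray_span (A B : 'M[R]_4) : (forall u, chart_dom u -> ray u *m A = ray u *m B) -> A = B.
Proof.
move=> h; have row_ext i : (delta_mx 0 i : 'rV[R]_4) *m A = (delta_mx 0 i : 'rV[R]_4) *m B ->
    row i A = row i B by rewrite !rowE.
have e0 : ray 0 = delta_mx 0 0 :> 'rV[R]_4.
  by apply/rowP; apply: ord4P; rewrite !mxE ?cos0 ?sin0 -?val_eqE /= ?inordK.
have e1 : ray ((pi / 2) *: delta_mx 0 ord_max) = delta_mx 0 1 :> 'rV[R]_4.
  by apply/rowP; apply: ord4P; rewrite !mxE /= ?inordK //= ?mulr1 ?mulr0 ?cos_pihalf ?sin_pihalf -?val_eqE /= ?inordK.
have e2 : ray (2^-1 *: delta_mx 0 0) = delta_mx 0 0 + 2^-1 *: delta_mx 0 (inord 2) :> 'rV[R]_4.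
  apply/rowP; apply: ord4P; rewrite !mxE /= ?inordK //= ?mulr0 ?cos0 ?sin0 -?val_eqE /= ?inordK //=; ring.
have e3 : ray (2^-1 *: delta_mx 0 1) = delta_mx 0 0 + 2^-1 *: delta_mx 0 (inord 3) :> 'rV[R]_4.
  apply/rowP; apply: ord4P; rewrite !mxE /= ?inordK //= ?mulr0 ?cos0 ?sin0 -?val_eqE /= ?inordK //=; ring.
have d (i : 'I_3) (t : R) : t ^+ 2 < 1 -> chart_dom (t *: delta_mx 0 i).
  move=> ht; rewrite /chart_dom /= !mxE /=.
  by move: i; apply: ord3P; rewrite /=; nra.
have dm (t : R) : chart_dom (t *: delta_mx 0 ord_max).
  by rewrite /chart_dom /= !mxE /=; nra.
have h2 : (2^-1 : R) ^+ 2 < 1 by rewrite expr2; lra.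
have n2 : (2^-1 : R) != 0 by rewrite invr_eq0 pnatr_eq0.
have r0 : (delta_mx 0 0 : 'rV[R]_4) *m A = (delta_mx 0 0 : 'rV[R]_4) *m B by rewrite -e0; apply: h; exact: dom0.
have r1 : (delta_mx 0 1 : 'rV[R]_4) *m A = (delta_mx 0 1 : 'rV[R]_4) *m B by rewrite -e1; apply: h; exact: dm.
have H i j : ray (2^-1 *: delta_mx 0 i) = delta_mx 0 0 + 2^-1 *: delta_mx 0 j :> 'rV[R]_4 ->
    (delta_mx 0 j : 'rV[R]_4) *m A = (delta_mx 0 j : 'rV[R]_4) *m B.
  move=> e; have := h _ (d i _ h2); rewrite e !mulmxDl r0 => /addrI.
  by rewrite -!scalemxAl => /(scalerI n2).
by apply/row_matrixP; apply: ord4P; apply: row_ext => //; [exact: H e2|exact: H e3].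
Qed.

Lemma linear_part_uniq g A B : linear_part g A -> linear_part g B -> A = B.
Proof.
move=> hA hB; apply: ray_span => u hu; have := hA (mka u); rewrite hB chart_mka //.
rewrite ads_coverE -!scalemxAl => /scalerI -> //.
by rewrite gt_eqF // sgm_gt0.
Qed.

Lemma linear_part_id : linear_part id 1%:M.
Proof. by move=> z; rewrite mulmx1. Qed.

Lemma linear_part_comp g h A B : linear_part g A -> linear_part h B ->
  linear_part (g \o h) (B *m A).
Proof. by move=> hA hB z; rewrite mulmxA -hB -hA. Qed.

Lemma polar (a b : R) : a ^+ 2 + b ^+ 2 = 1 -> exists t : R, cos t = a /\ sin t = b.
Proof.
move=> h; have a1 : -1 <= a <= 1 by apply/andP; split; nra.
have s : sin (acos a) = `|b|.
  by rewrite sin_acos // -sqrtr_sqr; congr Num.sqrt; lra.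
have [b0|b0] := leP 0 b.
  by exists (acos a); rewrite acosK // s ger0_norm.
by exists (- acos a); rewrite cosN sinN acosK // s ltr0_norm // opprK.
Qed.

Lemma timelike_ray x : formQ x x < 0 ->
  exists2 k : R, 0 < k & exists2 u, chart_dom u & x = k *: ray u.
Proof.
rewrite /formQ => h.
have n0 : 0 < x 0 0 ^+ 2 + x 0 1 ^+ 2.
  by have := sqr_ge0 (x 0 (inord 2)); have := sqr_ge0 (x 0 (inord 3)); rewrite !expr2; lra.
have [k [k0 k2]] : exists k : R, 0 < k /\ k ^+ 2 = x 0 0 ^+ 2 + x 0 1 ^+ 2.
  by exists (Num.sqrt (x 0 0 ^+ 2 + x 0 1 ^+ 2)); rewrite sqrtr_gt0 sqr_sqrtr // ltW.
have kn0 : k != 0 by rewrite gt_eqF.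
have [t [ct st]] : exists t : R, cos t = x 0 0 / k /\ sin t = x 0 1 / k.
  by apply: polar; rewrite !expr_div_n -mulrDl -k2 divff // expf_neq0.
exists k => //; exists (\row_(i < 3) [:: x 0 (inord 2) / k; x 0 (inord 3) / k; t]`_i).
  rewrite /chart_dom /= !mxE /= !expr_div_n -mulrDl ltr_pdivrMr ?exprn_gt0 // mul1r k2.
  by rewrite !expr2; lra.
apply/rowP; apply: ord4P; rewrite !mxE /= ?inordK //= ?mxE /= ?ct ?st mulrC divfK //.
Qed.

Lemma orth_dX u y : chart_dom u -> formQ (ray u) y = 0 -> exists v, y = dX u v.
Proof.
move=> hu; have sn0 : sgm u != 0 by rewrite gt_eqF // sgm_gt0.
have [r0 r1 r2 r3] := rayE u.
rewrite /formQ r0 r1 r2 r3 => h.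
pose c := cos (u 0 ord_max); pose s := sin (u 0 ord_max).
(* [a] is the coefficient of [ray u] in [y], read off in the negative plane, where the vectors
   [dray u v] are perpendicular to [ray u]. *)
have [a aE] : exists a, a = y 0 0 * c + y 0 1 * s by eexists.
pose v : 'rV[R]_3 := (sgm u)^-1 *: \row_(i < 3) [:: y 0 (inord 2) - a * u 0 0;
  y 0 (inord 3) - a * u 0 1; - y 0 0 * s + y 0 1 * c]`_i.
have s2 := sgm2 hu.
have cs : c ^+ 2 + s ^+ 2 = 1 by exact: cos2Dsin2.
have dE : dsgm u v = a.
  rewrite /dsgm !mxE /=.
  transitivity (sgm u ^+ 2 * (a * (1 - u 0 0 ^+ 2 - u 0 1 ^+ 2))); last first.
    by rewrite mulrCA s2 mulr1.
  have hh : a = u 0 0 * y 0 (inord 2) + u 0 1 * y 0 (inord 3) by move: h; rewrite aE /c /s; lra.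
  move: (y 0 (inord 2)) (y 0 (inord 3)) hh => y2 y3 hh.
  transitivity (sgm u ^+ 2 * (u 0 0 * y2 + u 0 1 * y3 - a * (u 0 0 ^+ 2 + u 0 1 ^+ 2))).
    by field.
  by rewrite -hh; ring.
exists v; apply/rowP => i; rewrite /dX dE.
have -> : (sgm u *: dray u v + a *: ray u) 0 i = sgm u * dray u v 0 i + a * ray u 0 i by rewrite !mxE.
move: i; have [d0 d1 d2 d3] := drayE u v; apply: ord4P; rewrite ?r0 ?r1 ?r2 ?r3 ?d0 ?d1 ?d2 ?d3.
- rewrite !mxE /= mulrA (mulrA (sgm u)) divff // mul1r -/s -/c aE.
  by transitivity (y 0 0 * (c ^+ 2 + s ^+ 2)); [rewrite cs mulr1|ring].
- rewrite !mxE /= mulrA (mulrA (sgm u)) divff // mul1r -/s -/c aE.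
  by transitivity (y 0 1 * (c ^+ 2 + s ^+ 2)); [rewrite cs mulr1|ring].
- by rewrite !mxE /= mulrA divff // mul1r subrK.
- by rewrite !mxE /= mulrA divff // mul1r subrK.
Qed.

End Linear.

Lemma det_orth (R : realType) (B : 'M[R]_4) : B *m adjQ B = 1%:M -> \det B ^+ 2 = 1.
Proof.
move=> /(congr1 determinant); rewrite det_mulmx det1 adjQE !det_mulmx det_tr => h.
have hj : \det (Jmx R) * \det (Jmx R) = 1 by rewrite -det_mulmx mulJJ det1.
by rewrite -h expr2 -[LHS]mulr1 -hj; ring.
Qed.

(** The common factor [S] is invertible because the frame has the right inverse [D], so its unknown
    sign cancels. *)
Lemma det_sign (R : realType) (T1 T2 S : 'M[R]_(1 + 3)) (R1 R2 A D : 'M[R]_4) (J : 'M[R]_3) :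
  T1 *m (S *m R1) *m A = block_mx 1%:M 0 0 J *m (T2 *m (S *m R2)) ->
  T1 *m (S *m R1) *m D = 1%:M ->
  0 < \det T1 -> 0 < \det T2 -> 0 < \det R1 -> 0 < \det R2 -> 0 < \det J ->
  \det A ^+ 2 = 1 -> 0 < \det A.
Proof.
move=> /(congr1 determinant) E /(congr1 determinant) s1.
move: E s1; rewrite !det_mulmx det_ublock !det1 mul1r.
move: (\det A) (\det T1) (\det T2) (\det S) (\det R1) (\det R2) (\det J) (\det D).
move=> a f1 f2 s r1 r2 j d E s1 hf1 hf2 hr1 hr2 hj a2.
have s0 : s != 0 by apply/eqP => s0; move: s1; rewrite s0; lra.
have E2 : f1 * r1 * a = j * f2 * r2 by apply: (mulIf s0); lra.
by rewrite -(pmulr_rgt0 a (mulr_gt0 hf1 hr1)) E2 !mulr_gt0.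
Qed.

(** * An isometry is the restriction of a matrix *)

Section Isometry.
Variable R : realType.
Variable F : 'rV[R]_3 -> 'rV[R]_3.
Hypothesis Fdom : forall u, chart_dom u -> chart_dom (F u).
Hypothesis Fd : forall u, chart_dom u -> differentiable F u.
Hypothesis Fd2 : forall u v, chart_dom u -> differentiable ('D_v F) u.
Hypothesis Fiso : forall u v w, chart_dom u ->
  metric (F u) ('d F u v) ('d F u w) = metric u v w.
Hypothesis Fdet : forall u, chart_dom u -> 0 < \det (jacobian F u).
Hypothesis Ftime : forall u v, chart_dom u -> future_timelike u v ->
  future_timelike (F u) ('d F u v).

Let X := @ads_cover R.
Let Y u := ads_cover (F u).

Let X2 : twice_diff X := @twice_diff_ads_cover R.
Let Y2 : twice_diff Y := twice_diff_comp Fdom Fd Fd2.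

Let XQ u : chart_dom u -> formQ (X u) (X u) = -1 := @formQ_ads_cover R u.
Let YQ u : chart_dom u -> formQ (Y u) (Y u) = -1.
Proof. by move=> hu; apply: formQ_ads_cover; exact: Fdom. Qed.

Let derive_Y u v : chart_dom u -> 'D_v Y u = dX (F u) ('d F u v).
Proof.
move=> hu; apply: (etrans (derive_ads_cover_comp Fdom Fd v hu)).
by congr dX; exact: deriveE v (Fd hu).
Qed.

Let XY u v w : chart_dom u -> formQ ('D_v X u) ('D_w X u) = formQ ('D_v Y u) ('D_w Y u).
Proof.
move=> hu.
have e1 := Fiso v w hu; rewrite (metricE _ _ hu) (metricE _ _ (Fdom hu)) in e1.
apply: formQ_congr4 (esym e1).
- exact: derive_ads_cover.
- exact: derive_ads_cover.
- exact: derive_Y.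
- exact: derive_Y.
Qed.

Let A := transfer X Y (@ginv R) 0.

Let trA u (hu : chart_dom u) : transfer X Y (@ginv R) u = A :=
  transfer_cst X2 Y2 XQ YQ XY (@ginvP R) (@derivable_ginv R) hu.

Let frameA u (hu : chart_dom u) : frame X u *m A = frame Y u.
Proof. by rewrite -(trA hu); exact: (frame_transfer Y X2 XQ (@ginvP R) hu). Qed.

Let coverA u : chart_dom u -> ads_cover u *m A = ads_cover (F u).
Proof. by move=> /frameA; rewrite /frame mul_col_mx => /eq_col_mx[]. Qed.

Let derivA u v : chart_dom u -> dX u v *m A = dX (F u) ('d F u v).
Proof.
move=> hu; have dA : derivable (fun=> A) u v by [].
have h := is_derive_mulmx (twice_derivable X2 v hu) dA.
have h2 : is_derive u v Y ('D_v X u *m A + X u *m 'D_v (fun=> A) u).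
  by apply: near_eq_is_derive h; apply: filterS (near_dom hu) => x; exact: coverA.
have [_ e] := h2; apply: esym; apply: (etrans (esym (derive_Y v hu))).
apply: (etrans e); rewrite derive_cst mulmx0 addr0.
by congr (_ *m _); exact: derive_ads_cover.
Qed.

Let detA : \det A = 1.
Proof.
have A1 : A *m adjQ A = 1%:M := transfer_unit X2 Y2 XQ YQ XY (@ginvP R) (@dom0 R).
have d1 := det_orth A1.
suff d0 : 0 < \det A.
  move/eqP: d1; rewrite sqrf_eq1 => /orP[/eqP //|/eqP E].
  by move: d0; rewrite E ltr0N1.
have hu := @dom0 R.
have fY : frame Y 0 = block_mx 1%:M 0 0 (jacobian F 0) *m frame X (F 0).
  rewrite /frame mul_block_col !mul0mx mul1mx addr0 add0r; congr col_mx.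
  apply/row_matrixP => j; apply: (etrans (row_tangents _ _ _)).
  apply: (etrans (derive_Y _ hu)); rewrite row_mul /jacobian.
  have -> : row j (lin1_mx ('d F (0 : 'rV[R]_3))) = 'd F (0 : 'rV[R]_3) (delta_mx 0 j).
    by rewrite rowE mul_rV_lin1.
  have hF := Fdom hu.
  apply: (etrans (dX_linear _ hF)); apply/rowP => k.
  rewrite summxE mxE; apply: eq_bigr => i _; rewrite mxE; congr (_ * _).
  rewrite [RHS]mxE.
  have e := derive_ads_cover (delta_mx 0 i) hF; exact: esym (congr1 (fun x : 'rV[R]_4 => x 0 k) e).
have E : frame_coef 0 *m (std_frame R *m rot ((0 : 'rV[R]_3) 0 ord_max)) *m A =
    block_mx 1%:M 0 0 (jacobian F 0) *m
      (frame_coef (F 0) *m (std_frame R *m rot (F 0 0 ord_max))).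
  apply: (etrans (congr1 (fun M => M *m A) (esym (frame_adsE hu)))).
  apply: (etrans (frameA hu)); apply: (etrans fY).
  exact: (congr1 (fun M => _ *m M) (frame_adsE (Fdom hu))).
have D := etrans (congr1 (fun M => M *m _) (esym (frame_adsE hu))) (frame_dual X2 XQ (@ginvP R) hu).
exact: (det_sign E D (det_frame_coef hu) (det_frame_coef (Fdom hu)) (det_rot _) (det_rot _)
  (Fdet hu) d1).
Qed.

Let timeA x y : formQ x x < 0 -> formQ x y = 0 -> formQ y y < 0 ->
  0 <= dett x y * dett (x *m A) (y *m A).
Proof.
move=> /timelike_ray[k k0 [u hu xE]]; rewrite xE => xy yy.
have s0 := sgm_gt0 hu.
have [v vE] : exists v, y = dX u v.
  apply: orth_dX => //; move: xy; rewrite formQZl => /eqP.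
  by rewrite mulf_eq0 (gt_eqF k0) /= => /eqP.
have rE : k *: ray u = (k * (sgm u)^-1) *: ads_cover u.
  by rewrite ads_coverE scalerA divfK // gt_eqF.
have dZ (c : R) (a b : 'rV[R]_4) : dett (c *: a) b = c * dett a b.
  by rewrite /dett !mxE; ring.
rewrite rE -scalemxAl coverA // vE derivA // (dZ _ (ads_cover u)) (dZ _ (ads_cover (F u))) !dett_dX.
have sF := sgm_gt0 (Fdom hu).
suff h : 0 <= v 0 ord_max * 'd F u v 0 ord_max.
  move: h s0 sF k0; move: (sgm u) (sgm (F u)) (v 0 _) ('d F u v 0 _) => s s' a b h s0 sF k0.
  have -> : k * s^-1 * (s ^+ 2 * a) * (k * s^-1 * (s' ^+ 2 * b)) =
     (k * s^-1 * s * s') ^+ 2 * (a * b) by ring.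
  by rewrite mulr_ge0 // sqr_ge0.
have key w : formQ (dX u w) (dX u w) < 0 -> 0 < w 0 ord_max -> 0 < 'd F u w 0 ord_max.
  by move=> h1 h2; have [] := Ftime hu (v := w); rewrite // /future_timelike metricE.
rewrite vE in yy.
have [h|h|<-] := ltgtP 0 (v 0 ord_max); last by rewrite mul0r.
- by rewrite mulr_ge0 // ltW // key.
- have hN := key (- v); rewrite linearN !mxE in hN.
  rewrite nmulr_rge0 // ltW // -oppr_gt0; apply: hN; last by rewrite oppr_gt0.
  rewrite -(diff_ads_cover _ hu) linearN (diff_ads_cover _ hu).
  by rewrite formQNl formQNr opprK.
Qed.

Lemma isometry_transfer : exists A : 'M[R]_4, [/\ forall u, chart_dom u -> ads_cover u *m A = ads_cover (F u),
  A *m adjQ A = 1%:M, \det A = 1 & forall x y, formQ x x < 0 -> formQ x y = 0 ->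
    formQ y y < 0 -> 0 <= dett x y * dett (x *m A) (y *m A)].
Proof.
exists A; split=> //.
exact: (transfer_unit X2 Y2 XQ YQ XY (@ginvP R) (@dom0 R)).
Qed.

End Isometry.

(** * The group of matrices *)

Section Group.
Variable R : realType.

Lemma SO22hat_linear (g : ads R -> ads R) : SO22hat g -> exists A, [/\ linear_part g A,
  A *m adjQ A = 1%:M, \det A = 1 & forall x y, formQ x x < 0 -> formQ x y = 0 ->
    formQ y y < 0 -> 0 <= dett x y * dett (x *m A) (y *m A)].
Proof.
move=> [[[[F [gF sF]] _] iso] ori time].
have Fdom u : chart_dom u -> chart_dom (F u).
  by move=> hu; rewrite -(chart_mka hu) gF; exact: chart_domP.
have Fd u : chart_dom u -> differentiable F u by have [/(_ u)] := sF 1%N.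
have Fd2 u v : chart_dom u -> differentiable ('D_v F) u.
  by have [_ /(_ v)[/(_ u)]] := sF 2%N.
have [A [h1 h2 h3 h4]] := isometry_transfer Fdom Fd Fd2 (iso F gF) (ori F gF) (time F gF).
by exists A; split=> // z; rewrite -gF h1 //; exact: chart_domP.
Qed.

Variable G : subgroup R.

Definition linear_group := [set A : 'M[R]_4 | exists2 g, G g & linear_part g A].

Lemma linear_groupP g A : G g -> linear_part g A -> [/\ 
  A *m adjQ A = 1%:M, \det A = 1 & forall x y, formQ x x < 0 -> formQ x y = 0 ->
    formQ y y < 0 -> 0 <= dett x y * dett (x *m A) (y *m A)].
Proof.
move=> /subgroup_sub/SO22hat_linear[B [hB ? ? ?]] hA.
by rewrite (linear_part_uniq hA hB).
Qed.

Lemma linear_part_inv g h A : G g -> G h -> cancel g h -> cancel h g -> linear_part g A ->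
  linear_part h (adjQ A).
Proof.
move=> Gg Gh gK hK hA.
have [B [hB _ _ _]] := SO22hat_linear (subgroup_sub Gh).
have [orth _ _] := linear_groupP Gg hA.
have e : A *m B = 1%:M.
  apply: (@linear_part_uniq _ (h \o g)); first exact: linear_part_comp.
  have -> : h \o g = id by apply/funext => z; exact: gK.
  exact: linear_part_id.
suff <- : B = adjQ A by [].
suff e2 : adjQ A *m (A *m B) = B by rewrite -e2 e mulmx1.
by rewrite mulmxA (mulmx1C orth) mul1mx.
Qed.

Lemma SO22_like_group : SO22_like linear_group.
Proof.
split.
- move=> A B [g Gg hA] [h Gh hB]; exists (h \o g); first exact: subgroup_comp.
  exact: linear_part_comp.
- move=> A [g Gg hA]; have [h [Gh gK hK]] := subgroup_inv Gg.
  by exists h => //; exact: linear_part_inv hA.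
- by move=> A [g Gg hA]; have [] := linear_groupP Gg hA.
- by move=> A [g Gg hA]; have [] := linear_groupP Gg hA.
- by move=> A x y [g Gg hA]; have [_ _] := linear_groupP Gg hA; apply.
Qed.

End Group.

(** * Spherical distance and causality *)

Section Sphere.
Variable R : realType.
Implicit Types (x y z : 'rV[R]_3).

Lemma dotC x y : dot x y = dot y x.
Proof. by rewrite !dotE; ring. Qed.

Lemma dot_combo (a b : R) x y z : dot (a *: x + b *: y) z = a * dot x z + b * dot y z.
Proof. by rewrite !dotE !mxE; ring. Qed.

Lemma dotNl x y : dot (- x) y = - dot x y.
Proof. by rewrite !dotE !mxE; ring. Qed.

Lemma dot_ge0 x : 0 <= dot x x.
Proof. by rewrite dotE -!expr2 !addr_ge0 ?sqr_ge0. Qed.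

Lemma dot_eq0 x : dot x x = 0 -> x = 0.
Proof.
rewrite dotE => h; have h0 := sqr_ge0 (x 0 0); have h1 := sqr_ge0 (x 0 1).
have h2 := sqr_ge0 (x 0 ord_max); rewrite !expr2 in h0 h1 h2.
have z0 (a : R) : a * a = 0 -> a = 0 by move/eqP; rewrite mulf_eq0 orbb => /eqP.
by apply: row3P; rewrite mxE; apply: z0; lra.
Qed.

Lemma dot_CS x y : dot x y ^+ 2 <= dot x x * dot y y.
Proof.
rewrite !dotE; move: (x 0 0) (x 0 1) (x 0 ord_max) (y 0 0) (y 0 1) (y 0 ord_max).
move=> a b c d e f; rewrite -subr_ge0.
have -> : (a * a + b * b + c * c) * (d * d + e * e + f * f) - (a * d + b * e + c * f) ^+ 2 =
  (a * e - b * d) ^+ 2 + (a * f - c * d) ^+ 2 + (b * f - c * e) ^+ 2 by ring.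
by rewrite !addr_ge0 ?sqr_ge0.
Qed.

Definition unit3 x := dot x x = 1.

Lemma unit_dot_le1 x y : unit3 x -> unit3 y -> -1 <= dot x y <= 1.
Proof.
move=> hx hy; have := dot_CS x y; rewrite hx hy mulr1 => h.
by apply/andP; split; nra.
Qed.

Lemma unitN x : unit3 x -> unit3 (- x).
Proof. by rewrite /unit3 dotNl dotC dotNl opprK. Qed.

Lemma cos_sdist x y : unit3 x -> unit3 y -> cos (sdist x y) = dot x y.
Proof. by move=> hx hy; rewrite acosK // in_itv /= unit_dot_le1. Qed.

Lemma sdist_ge0 x y : unit3 x -> unit3 y -> 0 <= sdist x y.
Proof. by move=> hx hy; apply: acos_ge0; exact: unit_dot_le1. Qed.

Lemma sdist_lepi x y : unit3 x -> unit3 y -> sdist x y <= pi.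
Proof. by move=> hx hy; apply: acos_lepi; exact: unit_dot_le1. Qed.

Lemma sdistC x y : sdist x y = sdist y x.
Proof. by rewrite /sdist dotC. Qed.

Lemma sdistxx x : unit3 x -> sdist x x = 0.
Proof. by move=> hx; rewrite /sdist hx acos1. Qed.

Lemma sdistN x y : unit3 x -> unit3 y -> sdist (- x) y = pi - sdist x y.
Proof. by move=> hx hy; rewrite /sdist dotNl acosN //; exact: unit_dot_le1. Qed.

Lemma cos_le (a b : R) : 0 <= a -> b <= pi -> a <= b -> cos b <= cos a.
Proof.
move=> a0 b0 ab; have [<-//|ne] := eqVneq a b; apply: ltW.
by rewrite ltr_cos ?in_itv /= ?lt_neqAle ?ne ?ab ?a0 ?b0 ?(le_trans a0) ?(le_trans ab).
Qed.

Lemma le_cos (a b : R) : 0 <= a <= pi -> 0 <= b <= pi -> cos b <= cos a -> a <= b.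
Proof.
by move=> ha hb; rewrite leNgt => h; rewrite leNgt -ltr_cos ?in_itv.
Qed.

(** Cauchy-Schwarz for the components of [x] and [z] orthogonal to [y] bounds the cosine of the sum
    of the two sides by [dot x z]. *)
Lemma sdist_triangle x y z : unit3 x -> unit3 y -> unit3 z ->
  sdist x z <= sdist x y + sdist y z.
Proof.
move=> hx hy hz; have a0 := sdist_ge0 hx hy; have b0 := sdist_ge0 hy hz.
have ap := sdist_lepi hx hy; have bp := sdist_lepi hy hz.
have [sp|sp] := leP pi (sdist x y + sdist y z); first exact: le_trans (sdist_lepi hx hz) sp.
apply: le_cos; [by rewrite sdist_ge0 ?sdist_lepi|by rewrite addr_ge0 // ltW|].
rewrite cosD !cos_sdist //.
have sE u v : unit3 u -> unit3 v -> 0 <= sin (sdist u v) /\ sin (sdist u v) ^+ 2 = 1 - dot u v ^+ 2.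
  move=> hu hv; split; first by rewrite sin_ge0_pi // sdist_ge0 // sdist_lepi.
  by rewrite sin2cos2 cos_sdist.
have [s0 s2] := sE x y hx hy; have [t0 t2] := sE y z hy hz.
have := dot_CS (1 *: x + (- dot x y) *: y) (1 *: z + (- dot y z) *: y).
have e u v (c d : R) : dot (1 *: u + c *: y) (1 *: v + d *: y) =
    dot u v + c * dot y v + d * dot u y + c * d.
  rewrite dot_combo dotC dot_combo [dot y (_ + _)]dotC dot_combo hy.
  by rewrite (dotC v u) (dotC y u) (dotC v y); ring.
rewrite !e hx hz (dotC z y) (dotC y x).
move: (dot x y) (dot y z) (dot x z) (sin _) (sin _) s0 s2 t0 t2 => a b c s t s0 s2 t0 t2 h.
have h2 : (a * b - c) ^+ 2 <= (s * t) ^+ 2 by rewrite exprMn s2 t2; nra.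
have st0 : 0 <= s * t by rewrite mulr_ge0.
rewrite -subr_ge0 leNgt; apply/negP => lt0; move: h2; rewrite leNgt => /negP; apply.
by rewrite ltr_sqr ?nnegrE; lra.
Qed.

(** The triangle inequality through the antipode of [z]. *)
Lemma sdist_perimeter x y z : unit3 x -> unit3 y -> unit3 z ->
  sdist x y + sdist y z + sdist z x <= 2 * pi.
Proof.
move=> hx hy hz; have := sdist_triangle hx (unitN hz) hy.
by rewrite (sdistC x (- z)) !sdistN // (sdistC z y); lra.
Qed.

Lemma cos_eq1 (t : R) : `|t| < 2 * pi -> cos t = 1 -> t = 0.
Proof.
move=> h c1; have s0 : sin (t / 2) = 0.
  have : sin (t / 2) ^+ 2 = 0.
    have := cosD (t / 2) (t / 2); rewrite -splitr c1 -!expr2 cos2sin2; lra.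
  by move/eqP; rewrite expf_eq0 => /eqP.
have pos (a : R) : 0 < a -> a < pi -> sin a != 0.
  by move=> a0 ap; rewrite gt_eqF // sin_gt0_pi // a0.
move: h => /ltr_normlP[h1 h2].
have [t0|t0|//] := ltgtP t 0.
- by have := pos (- (t / 2)); rewrite sinN s0 oppr0 eqxx => /(_ ltac:(lra) ltac:(lra)).
- by have := pos (t / 2); rewrite s0 eqxx => /(_ ltac:(lra) ltac:(lra)).
Qed.

End Sphere.

(** * The spatial relation *)

Section Spatial.
Variable R : realType.
Implicit Types (z w l : cyl R).

Definition rr z : 'rV[R]_4 := ray (crd z).

Lemma unit_pt z : unit3 (pt z).
Proof. by have [h _] := set_valP z. Qed.

Definition height z : R := pt z 0 ord_max.

Lemma formQ_rr z w :
  formQ (rr z) (rr w) = dot (pt z) (pt w) - height z * height w - cos (tm z - tm w).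
Proof.
have [r0 r1 r2 r3] := rayE (crd z); have [s0 s1 s2 s3] := rayE (crd w).
rewrite /formQ r0 r1 r2 r3 s0 s1 s2 s3 dotE cosB /height.
have [-> -> ->] := crdE z; have [-> -> ->] := crdE w; ring.
Qed.

Lemma formQ_rr_self z : formQ (rr z) (rr z) = - height z ^+ 2.
Proof. by rewrite formQ_rr unit_pt subrr cos0; ring. Qed.

(** The sign of the form is periodic in [theta]; the bound on the times selects the sheet of the
    covering. *)
Definition spatial z w := `|tm z - tm w| < pi /\ formQ (rr z) (rr w) < 0.

Lemma spatialC z w : spatial z w -> spatial w z.
Proof. by move=> [h1 h2]; split; rewrite 1?distrC // formQC. Qed.

Lemma rr_top z : rr z 0 0 ^+ 2 + rr z 0 1 ^+ 2 = 1.
Proof. by have [-> -> _ _] := rayE (crd z); exact: cos2Dsin2. Qed.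

Lemma rr_continuous : continuous rr.
Proof.
move=> z; have h k : (fun x : 'rV[R]_3 => ray x 0 k) x @[x --> crd z] --> ray (crd z) 0 k.
  by apply: differentiable_continuous; exact: differentiable_ray.
have h2 : (fun x : 'rV[R]_3 => ray x) x @[x --> crd z] --> ray (crd z).
  by apply: (@cvg_mxP R _ (nbhs (crd z)) (nbhs_filter _) 1 4 (@ray R)) => i k; rewrite (ord1 i); exact: h.
exact: (cvg_comp (@crd R) (@ray R) (@crd_continuous R z) h2).
Qed.

Lemma rr_crd_inj z w : rr z = rr w -> tm z = tm w -> z = w.
Proof.
move=> h t; apply: crd_inj; have [r0 r1 r2 r3] := rayE (crd z).
have [s0 s1 s2 s3] := rayE (crd w); have [_ _ z2] := crdE z; have [_ _ w2] := crdE w.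
apply: row3P; [rewrite -r2 -s2|rewrite -r3 -s3|by rewrite z2 w2 t].
  by rewrite -/(rr z) h.
by rewrite -/(rr z) h.
Qed.

(** For a boundary point the height term vanishes, and [q < 0] compares the cosines of the distance
    and of the time difference. *)
Lemma spatial_ein z l : ein l -> `|tm z - tm l| < sdist (pt z) (pt l) <-> spatial z l.
Proof.
move=> hl; rewrite /spatial formQ_rr /height hl mulr0 subr0.
have uz := unit_pt z; have ul := unit_pt l.
have cE : cos (tm z - tm l) = cos `|tm z - tm l|.
  by case: (ger0P (tm z - tm l)); rewrite ?cosN.
rewrite cE -(cos_sdist uz ul) subr_lt0.
have d0 := sdist_ge0 uz ul; have dp := sdist_lepi uz ul.
have n0 := normr_ge0 (tm z - tm l).
split=> [h|[h1]].
  by split; [exact: lt_le_trans h dp|rewrite ltr_cos // in_itv /= ?n0 ?d0 ?dp // ltW // (lt_le_trans h)].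
by rewrite ltr_cos ?in_itv /= ?n0 ?d0 ?dp ?ltW.
Qed.

Lemma ein_top l : ein l -> formQ (rr l) (rr l) = 0.
Proof. by rewrite formQ_rr_self /height => ->; rewrite expr0n oppr0. Qed.

Lemma spatial_near z w : spatial z w ->
  \forall p \near (z, w), spatial p.1 p.2.
Proof.
move=> [h1 h2].
have c1 : (fun p : cyl R * cyl R => `|tm p.1 - tm p.2|) p @[p --> (z, w)] --> `|tm z - tm w|.
  apply: cvg_norm; apply: cvgB.
    exact: (cvg_comp (fun p : cyl R * cyl R => p.1) (@tm R) cvg_fst (@tm_continuous R z)).
  exact: (cvg_comp (fun p : cyl R * cyl R => p.2) (@tm R) cvg_snd (@tm_continuous R w)).
have c2 : (fun p : cyl R * cyl R => formQ (rr p.1) (rr p.2)) p @[p --> (z, w)] --> formQ (rr z) (rr w).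
  apply: cvg_formQ.
    exact: (cvg_comp (fun p : cyl R * cyl R => p.1) rr cvg_fst (@rr_continuous z)).
  exact: (cvg_comp (fun p : cyl R * cyl R => p.2) rr cvg_snd (@rr_continuous w)).
have e1 := cvgr_lt _ c1 _ h1; have e2 := cvgr_lt _ c2 _ h2.
have FF : Filter (nbhs (z, w)) by exact: nbhs_filter.
have e3 : nbhs (z, w) ([set p | `|tm p.1 - tm p.2| < pi] `&` [set p | formQ (rr p.1) (rr p.2) < 0]).
  by apply: filterI; [exact: e1|exact: e2].
by apply: (@filterS _ _ FF _ _ _ e3) => p [].
Qed.

End Spatial.

(** * Compactness, and the invisible domains in terms of [spatial] *)

Section Compact.
Variable R : realType.
Implicit Types (z w l : cyl R) (L : set (cyl R)).

Lemma cyl_compact (K : set (cyl R)) (M : R) :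
  closed K -> (forall z, K z -> `|tm z| <= M) -> compact K.
Proof.
move=> cK bK; rewrite compact_ultra => U UU UK.
have [v hv] : exists v : 'rV[R]_3, @crd R @ U --> v.
  apply: (@ultra_cvg_mx _ _ U 1 3 (@crd R) (1 + `|M|) UU); apply: filterS UK => z Kz i j.
  have := crd_le1 z; have := bK z Kz; have := ler_norm M.
  have [e0 e1 e2] := crdE z; rewrite (ord1 i); move: j; apply: ord3P.
  - move=> _ _ h; rewrite real_ler_norml ?num_real //; have := normr_ge0 M.
    by move=> m0; apply/andP; split; nra.
  - move=> _ _ h; rewrite real_ler_norml ?num_real //; have := normr_ge0 M.
    by move=> m0; apply/andP; split; nra.
  - by rewrite e2 => h1 h2 _; lra.
have hz : U --> mk v.
  have := cvg_comp (@crd R) (@mk R) hv (@mk_continuous R v).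
  have -> : @mk R \o @crd R = id by apply/funext => z; exact: mk_crd.
  by [].
exists (mk v); split => //; apply: cK => B /hz UB.
by have [x [Kx Bx]] := filter_ex (filterI UK UB); exists x.
Qed.

Lemma vert_subproof z (t : R) : cyl_set (pt z, t).
Proof. by have [h1 h2] := set_valP z. Qed.

Definition vert z (t : R) : cyl R := SigSub (mem_set (vert_subproof z t)).

Lemma pt_vert z t : pt (vert z t) = pt z. Proof. by []. Qed.
Lemma tm_vert z t : tm (vert z t) = t. Proof. by []. Qed.

Lemma cyl_ext z w : pt z = pt w -> tm z = tm w -> z = w.
Proof.
move=> h1 h2; apply: set_val_inj.
by rewrite [LHS]surjective_pairing [RHS]surjective_pairing; congr pair.
Qed.

Lemma vert_tm z : vert z (tm z) = z.
Proof. exact: cyl_ext. Qed.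

Lemma vert_continuous z (t : R) : vert z s @[s --> t] --> vert z t.
Proof.
apply: (@cvg_set_type _ (@cyl_set R) _ (nbhs t) _ (vert z) (vert z t)).
exact: (@cvg_pairT _ (nbhs t) _ _ _ (fun=> pt z) id _ _ (cvg_cst _) cvg_id).
Qed.

Lemma spatial_all_open L z : compact L -> (forall l, L l -> spatial z l) ->
  \forall z' \near z, forall l, L l -> spatial z' l.
Proof.
move=> /compact_near_coveringP cL h.
have := cL _ (nbhs z) (fun z' l => spatial z' l) _; apply.
move=> l Ll; have [[A B] /= [Az Bl] AB] := spatial_near (h l Ll).
by exists (B, A) => // -[x y] /= [Bx Ay]; exact: (AB (y, x)).
Qed.

(** The pointwise strict inequalities remain strict for the supremum and the infimum: by compactness
    of [L] they persist when [z] is moved in time by a uniform amount. *)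
Lemma between_spatial L z : L `<=` @ein R -> compact L ->
  between L z <-> forall l, L l -> spatial z l.
Proof.
move=> Le cL; split=> [[h1 h2] l Ll|h].
  apply/(spatial_ein _ (Le l Ll)); rewrite real_ltr_norml ?num_real //.
  have i1 : ((tm l - sdist (pt z) (pt l))%:E < (tm z)%:E)%E.
    by apply: le_lt_trans h1; apply: ereal_sup_ubound; exists l.
  have i2 : ((tm z)%:E < (tm l + sdist (pt z) (pt l))%:E)%E.
    by apply: lt_le_trans h2 _; apply: ereal_inf_lbound; exists l.
  by move: i1 i2; rewrite !lte_fin => i1 i2; apply/andP; split; lra.
have hop := spatial_all_open cL h.
have hv : \forall t \near (tm z), forall l, L l -> spatial (vert z t) l.
  have c := @vert_continuous z (tm z); rewrite vert_tm in c.
  exact: c hop.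
have [e /= e0 he] := hv.
have near t l : `|tm z - t| < e -> L l -> `|t - tm l| < sdist (pt z) (pt l).
  by move=> ht Ll; have := he t ht l Ll => /(spatial_ein _ (Le l Ll)).
have b1 : `|tm z - (tm z - e / 2)| < e by rewrite opprB addrC subrK ger0_norm; lra.
have b2 : `|tm z - (tm z + e / 2)| < e by rewrite opprD addrA subrr sub0r normrN ger0_norm; lra.
split.
  apply: (@le_lt_trans _ _ (tm z - e / 2)%:E); last by rewrite lte_fin; lra.
  apply: ge_ereal_sup => _ [l Ll <-]; rewrite lee_fin.
  by have /ltr_normlP[h1 _] := near _ l b1 Ll; lra.
apply: (@lt_le_trans _ _ (tm z + e / 2)%:E); first by rewrite lte_fin; lra.
apply: le_ereal_inf_tmp => _ [l Ll <-]; rewrite lee_fin.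
by have /ltr_normlP[_ h2] := near _ l b2 Ll; lra.
Qed.

Lemma achronal_bounded L l0 : achronal L -> L l0 -> forall l, L l -> `|tm l| <= `|tm l0| + pi.
Proof.
move=> aL L0 l Ll; have h := aL l l0 Ll L0.
have := sdist_lepi (unit_pt l) (unit_pt l0) => h2.
rewrite -(subrK (tm l0) (tm l)) (le_trans (ler_normD _ _)) //; lra.
Qed.

Lemma achronal_compact L : closed L -> achronal L -> compact L.
Proof.
move=> cL aL; have [->|/set0P[l0 L0]] := eqVneq L set0; first exact: compact0.
exact: (cyl_compact cL (achronal_bounded aL L0)).
Qed.

Lemma achronal_le0 L l l' : L `<=` @ein R -> achronal L -> L l -> L l' ->
  formQ (rr l) (rr l') <= 0.
Proof.
move=> Le aL Ll Ll'; rewrite formQ_rr /height (Le l Ll) mul0r subr0.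
rewrite -(cos_sdist (unit_pt l) (unit_pt l')) subr_le0.
have -> : cos (tm l - tm l') = cos `|tm l - tm l'|.
  by case: (ger0P (tm l - tm l')); rewrite ?cosN.
by apply: cos_le; [exact: normr_ge0|apply: sdist_lepi; exact: unit_pt|exact: aL].
Qed.

End Compact.

(** * Following times along paths: equivariance and angles *)

Section Ext.
Variable R : realType.
Implicit Types (z w l : cyl R) (A : 'M[R]_4).

(** Used with [a = pi] to follow the sheet of the covering along a path. *)
Lemma window (f : R -> R) (a : R) : continuous f ->
  (forall s : R, 0 <= s <= 1 -> `|f s| != a) -> `|f 0| < a -> `|f 1| < a.
Proof.
move=> cf h f0; rewrite ltNge; apply/negP => f1.
have [] := @IVT R (fun s => `|f s|) 0 1 a ler01.
- by apply: continuous_subspaceT => s; apply: cvg_norm; exact: cf.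
- by rewrite ge_min (ltW f0) /= le_max f1 orbT.
- by move=> c; rewrite in_itv /= => c01 /eqP; apply/negP; exact: h.
Qed.

Lemma formQ_rr_bot z w : formQ (rr z) (rr w) =
  pt z 0 0 * pt w 0 0 + pt z 0 1 * pt w 0 1 - cos (tm z - tm w).
Proof. by rewrite formQ_rr dotE /height; ring. Qed.

(** At time difference [pi] the form is 1 plus the scalar product of two points of the unit disc. *)
Lemma formQ_rr_not_pi z w : formQ (rr z) (rr w) < 0 -> `|tm z - tm w| != pi.
Proof.
rewrite formQ_rr_bot => h; apply/eqP => hp; move: h.
have -> : cos (tm z - tm w) = cos `|tm z - tm w| by case: ger0P => _; rewrite ?cosN.
have := pt_unit z; have := pt_unit w; rewrite hp cospi.
have := sqr_ge0 (pt z 0 0 + pt w 0 0); have := sqr_ge0 (pt z 0 1 + pt w 0 1).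
have := sqr_ge0 (height z); have := sqr_ge0 (height w); rewrite /height; nra.
Qed.

Lemma tm_crd z : tm z = crd z 0 ord_max. Proof. by have [_ _ ->] := crdE z. Qed.

Section Equivariant.
Variables (h : cyl R -> cyl R) (A : 'M[R]_4).
Hypothesis hc : continuous h.
Hypothesis hA : forall z, exists2 k : R, 0 < k & rr (h z) = k *: (rr z *m A).
Hypothesis orthA : A *m adjQ A = 1%:M.

Lemma formQ_equivariant z w : formQ (rr z) (rr w) < 0 -> formQ (rr (h z)) (rr (h w)) < 0.
Proof.
have [a a0 ->] := hA z; have [b b0 ->] := hA w => q.
by rewrite formQZl formQZr formQ_adj -mulmxA orthA mulmx1 !pmulr_rlt0.
Qed.

Lemma path_equivariant (c : R -> cyl R) w : continuous c ->
  (forall s : R, 0 <= s <= 1 -> formQ (rr (c s)) (rr w) < 0 \/ c s = w) ->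
  `|tm (h (c 0)) - tm (h w)| < pi -> `|tm (h (c 1)) - tm (h w)| < pi.
Proof.
move=> cc hq; apply: (@window (fun s => tm (h (c s)) - tm (h w))).
  move=> s; have e1 := cvg_comp c h (cc s) (@hc (c s)).
  have e2 := cvg_comp (h \o c) (@tm R) e1 (@tm_continuous R (h (c s))).
  exact: (cvgB e2 (cvg_cst (tm (h w)))).
move=> s hs; have [q|->] := hq s hs; last by rewrite subrr normr0 eq_sym gt_eqF // pi_gt0.
exact: formQ_rr_not_pi (formQ_equivariant q).
Qed.

(** The sign of the form is invariant. The bound on the times needs a path from [w] to [z] along
    which the form against [w] stays negative: a chord at the time of [w], then a vertical
    segment. *)
Lemma spatial_equivariant z w : spatial z w -> spatial (h z) (h w).
Proof.
move=> [ht hq]; split; last exact: formQ_equivariant.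
have q1 s : 0 <= s <= 1 -> formQ (rr (vert z (tm w + s * (tm z - tm w)))) (rr w) < 0.
  move=> /andP[s0 s1]; move: hq; rewrite !formQ_rr_bot pt_vert tm_vert => hq.
  apply: le_lt_trans hq; rewrite lerD2l lerN2 addrAC subrr add0r.
  have cE (x : R) : cos x = cos `|x| by case: ger0P => _; rewrite ?cosN.
  rewrite (cE (tm z - tm w)) (cE (s * _)); apply: cos_le; [exact: normr_ge0|exact: ltW|].
  by rewrite normrM (ger0_norm s0) ler_piMl.
pose z' := vert z (tm w).
have h1 : `|tm (h z') - tm (h w)| < pi.
  (* At the start of the chord the form may vanish, when [w] is on the boundary; the alternative
     [c s = w] covers this. *)
  pose c s := mk (crd w + s *: (crd z' - crd w)).
  have c0 : c 0 = w by rewrite /c scale0r addr0 mk_crd.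
  have -> : z' = c 1 by rewrite /c scale1r addrC subrK mk_crd.
  apply: path_equivariant.
  - move=> s; apply: (cvg_comp (fun s : R => crd w + s *: (crd z' - crd w)) (@mk R)); last exact: mk_continuous.
    by apply: cvgD; [exact: cvg_cst|apply: cvgZr_tmp; exact: cvg_id].
  - move=> s /andP[s0 s1]; have [->|sn0] := eqVneq s 0; [by right|left].
    have {sn0}s0 : 0 < s by rewrite lt_neqAle eq_sym sn0.
    have q0 : formQ (rr z') (rr w) < 0.
      by have := q1 0 _; rewrite mul0r addr0; apply; rewrite lexx ler01.
    have uw := crd_le1 w; have uz := crd_le1 z'.
    have [w0 w1 w2] := crdE w; have [z0 z1 z2] := crdE z'.
    have mE (u v : 'rV[R]_3) i : (u + s *: (v - u)) 0 i = u 0 i + s * (v 0 i - u 0 i) by rewrite !mxE.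
    have e : crd (c s) = crd w + s *: (crd z' - crd w).
      apply: crd_mk; rewrite !mE; move: uw uz; move: (crd w 0 0) (crd w 0 1) (crd z' 0 0) (crd z' 0 1).
      move=> a b x y ha hx.
      have -> : (a + s * (x - a)) ^+ 2 + (b + s * (y - b)) ^+ 2 =
        (1 - s) * (a ^+ 2 + b ^+ 2) + s * (x ^+ 2 + y ^+ 2)
        - s * (1 - s) * ((x - a) ^+ 2 + (y - b) ^+ 2) by ring.
      have k1 : 0 <= (1 - s) * (1 - (a ^+ 2 + b ^+ 2)) by rewrite mulr_ge0 // subr_ge0.
      have k2 : 0 <= s * (1 - (x ^+ 2 + y ^+ 2)) by rewrite mulr_ge0 ?subr_ge0 // ltW.
      have k3 : 0 <= s * (1 - s) * ((x - a) ^+ 2 + (y - b) ^+ 2).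
        by rewrite !mulr_ge0 ?subr_ge0 ?addr_ge0 ?sqr_ge0 // ltW.
      lra.
    have [c0' c1' c2'] := crdE (c s).
    rewrite formQ_rr_bot -c0' -c1' -c2' e -w0 -w1 -w2 !mE.
    move: q0; rewrite formQ_rr_bot -z0 -z1 -z2 -w0 -w1 -w2.
    have -> : crd z' 0 ord_max = crd w 0 ord_max by rewrite z2 w2.
    rewrite subrr mulr0 addr0 subrr cos0.
    move: uw uz; move: (crd w 0 0) (crd w 0 1) (crd z' 0 0) (crd z' 0 1).
    move=> a b x y ha hx hh.
    have k1 : 0 <= (1 - s) * (1 - (a ^+ 2 + b ^+ 2)) by rewrite mulr_ge0 // subr_ge0.
    have k2 : 0 < s * (1 - (x * a + y * b)) by rewrite mulr_gt0 // subr_gt0; lra.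
    have -> : (a + s * (x - a)) * a + (b + s * (y - b)) * b - 1 =
      - ((1 - s) * (1 - (a ^+ 2 + b ^+ 2)) + s * (1 - (x * a + y * b))) by ring.
    by rewrite oppr_lt0; lra.
  - by rewrite c0 subrr normr0 pi_gt0.
have -> : z = vert z (tm w + 1 * (tm z - tm w)) by rewrite mul1r addrC subrK vert_tm.
apply: (@path_equivariant (fun s => vert z (tm w + s * (tm z - tm w)))).
- move=> s; have e1 : (fun x : R => tm w + x * (tm z - tm w)) x @[x --> s] --> tm w + s * (tm z - tm w).
    exact: (cvgD (cvg_cst (tm w)) (cvgM cvg_id (cvg_cst (tm z - tm w)))).
  exact: (cvg_comp _ (vert z) e1 (@vert_continuous R z (tm w + s * (tm z - tm w)))).
- by move=> s hs; left; exact: q1.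
- by rewrite mul0r addr0.
Qed.

End Equivariant.

Lemma rr_cos_sub z w : rr z 0 0 = rr w 0 0 -> rr z 0 1 = rr w 0 1 -> cos (tm z - tm w) = 1.
Proof.
have [-> -> _ _] := rayE (crd z); have [-> -> _ _] := rayE (crd w).
by rewrite -!tm_crd cosB => -> ->; rewrite -!expr2 cos2Dsin2.
Qed.

Lemma rr_tm_inj z w : rr z = rr w -> `|tm z - tm w| < 2 * pi -> z = w.
Proof.
move=> h ht; apply: rr_crd_inj => //; apply/eqP; rewrite -subr_eq0; apply/eqP.
by apply: cos_eq1 => //; apply: rr_cos_sub; rewrite h.
Qed.

(** The angle of [(X, Y)] between [- pi] and [pi], by the half-angle formula; continuous away from
    the negative half-axis. *)
Definition arg (X Y : R) : R := 2 * atan (Y / (Num.sqrt (X ^+ 2 + Y ^+ 2) + X)).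

Lemma arg_lt (X Y : R) : `|arg X Y| < pi.
Proof.
rewrite /arg; set t := atan _; have := atan_gtNpi2 (Y / (Num.sqrt (X ^+ 2 + Y ^+ 2) + X)).
have := atan_ltpi2 (Y / (Num.sqrt (X ^+ 2 + Y ^+ 2) + X)); rewrite -/t => h1 h2.
by rewrite real_ltr_norml ?num_real //; apply/andP; split; lra.
Qed.

Lemma cos_sin_arg (X Y r : R) : 0 < r -> r ^+ 2 = X ^+ 2 + Y ^+ 2 -> - r < X ->
  cos (arg X Y) = X / r /\ sin (arg X Y) = Y / r.
Proof.
move=> r0 r2 rX; rewrite /arg -r2 sqrtr_sqr gtr0_norm //.
have d0 : r + X != 0 by rewrite gt_eqF //; lra.
have rn0 : r != 0 by rewrite gt_eqF.
set y := Y / (r + X); have yE : y * (r + X) = Y by rewrite /y divfK.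
have y1 : 1 + y ^+ 2 != 0 by rewrite gt_eqF // ltr_pwDl ?sqr_ge0.
have ct : cos (atan y) != 0.
  by rewrite cos_atan invr_eq0 gt_eqF // sqrtr_gt0 ltr_pwDl ?sqr_ge0.
have sE : sin (atan y) = y * cos (atan y) by rewrite -{2}(atanK y) /tan divfK.
have c2 : cos (atan y) ^+ 2 = (1 + y ^+ 2)^-1.
  by rewrite cos_atan exprVn sqr_sqrtr // addr_ge0 ?sqr_ge0.
have key : (1 + y ^+ 2)^-1 = (r + X) / (2 * r).
  have e : (1 + y ^+ 2) * (r + X) = 2 * r.
    apply: (mulIf d0); transitivity ((r + X) ^+ 2 + (y * (r + X)) ^+ 2); first by ring.
    by rewrite yE; transitivity (2 * r * r + 2 * r * X); [rewrite -[2 * r * r]mulrA -expr2; lra|ring].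
  apply: (mulfI y1); rewrite divff // mulrA e divff // mulf_neq0 // pnatr_eq0 //.
split.
  rewrite mulrC mulr_natr cos_mulr2n c2 key -mulr_natr; field; by rewrite rn0.
rewrite mulrC mulr_natr sin_mulr2n sE mulrCA -expr2 c2 key -mulr_natr -yE; field; by rewrite rn0.
Qed.

Lemma cvg_arg (T : Type) (F : set_system T) {FF : Filter F} (f g : T -> R) (X Y : R) :
  0 < Num.sqrt (X ^+ 2 + Y ^+ 2) + X ->
  f @ F --> X -> g @ F --> Y -> arg (f t) (g t) @[t --> F] --> arg X Y.
Proof.
move=> h fX gY; have h0 : Num.sqrt (X ^+ 2 + Y ^+ 2) + X != 0 by rewrite gt_eqF.
have e1 : (fun t => Num.sqrt (f t ^+ 2 + g t ^+ 2) + f t) t @[t --> F] -->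
    Num.sqrt (X ^+ 2 + Y ^+ 2) + X.
  exact: (cvgD (cvg_sqrt (cvgD (cvg_sqr fX) (cvg_sqr gY))) fX).
have e2 : (fun t => g t / (Num.sqrt (f t ^+ 2 + g t ^+ 2) + f t)) t @[t --> F] -->
    Y / (Num.sqrt (X ^+ 2 + Y ^+ 2) + X) by exact: (cvgM gY (cvgV h0 e1)).
exact: (cvgM (cvg_cst (2 : R)) (cvg_comp _ (@atan R) e2 (@continuous_atan R _))).
Qed.

End Ext.

(** * Extension to the boundary *)

Lemma row3E (R : realType) (a b c : R) : let u : 'rV[R]_3 := \row_(i < 3) [:: a; b; c]`_i in
  [/\ u 0 0 = a, u 0 1 = b & u 0 ord_max = c].
Proof. by rewrite /= !mxE. Qed.

Section Ext.
Variable R : realType.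
Variables (g : ads R -> ads R) (A : 'M[R]_4).
Hypothesis gc : continuous g.
Hypothesis gA : linear_part g A.
Hypothesis orthA : A *m adjQ A = 1%:M.
Implicit Types (z w : cyl R).

Lemma rr_linear_part (z : ads R) :
  exists2 k : R, 0 < k & rr (to_cyl (g z)) = k *: (rr (to_cyl z) *m A).
Proof.
have := gA z; rewrite !ads_coverE.
have s0 := sgm_gt0 (chart_domP z); have s1 := sgm_gt0 (chart_domP (g z)).
rewrite -scalemxAl => h; exists ((sgm (chart (g z)))^-1 * sgm (chart z)).
  by rewrite mulr_gt0 // invr_gt0.
by rewrite -scalerA -h scalerA mulVf ?scale1r // gt_eqF.
Qed.

Definition img z := rr z *m A.

Lemma formQ_img z w : formQ (img z) (img w) = formQ (rr z) (rr w).
Proof. by rewrite formQ_adj -mulmxA orthA mulmx1. Qed.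

Lemma rr_neq0 z : rr z != 0.
Proof.
apply/eqP => h; have := rr_top z; rewrite h !mxE expr0n addr0 => /eqP.
by rewrite eq_sym oner_eq0.
Qed.

Lemma img_neq0 z : img z != 0.
Proof.
apply: contra (rr_neq0 z) => /eqP h; apply/eqP.
by rewrite -[rr z]mulmx1 -orthA mulmxA -/(img z) h mul0mx.
Qed.

Lemma img_le0 z : formQ (img z) (img z) <= 0.
Proof. by rewrite formQ_img formQ_rr_self oppr_le0 sqr_ge0. Qed.

Lemma topn_gt0 (x : 'rV[R]_4) : formQ x x <= 0 -> x != 0 -> 0 < topn x.
Proof.
move=> q x0; rewrite lt_neqAle topn_ge0 andbT eq_sym; apply: contra x0 => /eqP h.
have xx : x 0 0 ^+ 2 + x 0 1 ^+ 2 = 0.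
  have n0 : 0 <= x 0 0 ^+ 2 + x 0 1 ^+ 2 by rewrite addr_ge0 ?sqr_ge0.
  by rewrite -(sqr_sqrtr n0) -/(topn x) h expr0n.
apply/eqP/topn_eq0 => //; apply/eqP; rewrite eq_le q /= /formQ.
by have := sqr_ge0 (x 0 (inord 2)); have := sqr_ge0 (x 0 (inord 3)); rewrite !expr2 in xx *; lra.
Qed.

Lemma topn_sqr (x : 'rV[R]_4) : topn x ^+ 2 = x 0 0 ^+ 2 + x 0 1 ^+ 2.
Proof. by rewrite sqr_sqrtr // addr_ge0 ?sqr_ge0. Qed.

Let r z := topn (img z).

Let r0 z : 0 < r z. Proof. exact: topn_gt0 (img_le0 z) (img_neq0 z). Qed.

(** The vertical line over the centre of the disc; its image under [g] serves as a reference for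
    times. *)
Definition axis (t : R) : ads R := mka (t *: delta_mx 0 ord_max).

Lemma crd_axis t : crd (to_cyl (axis t)) = t *: delta_mx 0 ord_max.
Proof.
rewrite -chartE chart_mka // /chart_dom /= !mxE /= !mulr0; nra.
Qed.

Lemma axisE t : [/\ pt (to_cyl (axis t)) 0 0 = 0, pt (to_cyl (axis t)) 0 1 = 0 & tm (to_cyl (axis t)) = t].
Proof.
have [<- <- <-] := crdE (to_cyl (axis t)); rewrite crd_axis !mxE /=.
by split; ring.
Qed.

Lemma axis_continuous : continuous axis.
Proof.
move=> t; apply: (@cvg_ads_chart _ _ (nbhs t) _ axis (axis t)).
rewrite chartE crd_axis; under eq_fun do rewrite chartE crd_axis.
exact: (@cvg_scalemx _ _ (nbhs t) _ _ _ id (fun=> delta_mx 0 ord_max) _ _ cvg_id (cvg_cst _)).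
Qed.

(** The matrix gives the image ray, but its time only modulo [2 pi]. [phi z] is the time of the
    image of the axis point at the same time, and [X], [Y] are the negative coordinates of the image
    ray turned back by it. *)
Let phi z := tm (to_cyl (g (axis (tm z)))).
Let base z := rr (to_cyl (g (axis (tm z)))).
Let X z := img z 0 0 * cos (phi z) + img z 0 1 * sin (phi z).
Let Y z := cos (phi z) * img z 0 1 - sin (phi z) * img z 0 0.

Let baseE z : [/\ base z 0 0 = cos (phi z), base z 0 1 = sin (phi z) &
  base z 0 (inord 2) ^+ 2 + base z 0 (inord 3) ^+ 2 <= 1].
Proof.
have [b0 b1 b2 b3] := rayE (crd (to_cyl (g (axis (tm z))))).
rewrite /base /rr b0 b1 b2 b3 /phi -tm_crd; split=> //; exact: crd_le1.
Qed.

Let XY z : r z ^+ 2 = X z ^+ 2 + Y z ^+ 2.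
Proof.
rewrite topn_sqr /X /Y; have := cos2Dsin2 (phi z).
move: (cos _) (sin _) (img z 0 0) (img z 0 1) => c s a b h.
by transitivity ((a ^+ 2 + b ^+ 2) * (c ^+ 2 + s ^+ 2)); [rewrite h mulr1|ring].
Qed.

(** The form is negative between the image ray and the reference, so their negative parts are never
    opposite and [arg] is continuous there. *)
Let rX z : - r z < X z.
Proof.
have [k k0 bE] := rr_linear_part (axis (tm z)).
have q : formQ (img z) (base z) < 0.
  rewrite /base bE formQZr -/(img _) formQ_img formQ_rr_bot.
  have [-> -> ->] := axisE (tm z); rewrite subrr cos0; nra.
have [b0 b1 b2] := baseE z.
have := img_le0 z; move: q (XY z) (r0 z); rewrite /formQ b0 b1 => q _ rz0 q2.
have := topn_sqr (img z); rewrite -/(r z) => r2.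
have X1 : img z 0 (inord 2) * base z 0 (inord 2) + img z 0 (inord 3) * base z 0 (inord 3) < X z.
  by move: q; rewrite /X; lra.
apply: le_lt_trans X1; move: q2 r2 b2 rz0; move: (r z) (img z 0 0) (img z 0 1).
move: (img z 0 (inord 2)) (img z 0 (inord 3)) (base z 0 (inord 2)) (base z 0 (inord 3)).
move=> y2 y3 c2 c3 rr y0 y1 q2 r2 b2 rz0.
have cs : (y2 * c2 + y3 * c3) ^+ 2 <= rr ^+ 2.
  have -> : (y2 * c2 + y3 * c3) ^+ 2 = (y2 ^+ 2 + y3 ^+ 2) * (c2 ^+ 2 + c3 ^+ 2) - (y2 * c3 - y3 * c2) ^+ 2 by ring.
  have s0 := sqr_ge0 (y2 * c3 - y3 * c2).
  have y0' : 0 <= y2 ^+ 2 + y3 ^+ 2 by rewrite addr_ge0 ?sqr_ge0.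
  have yr : y2 ^+ 2 + y3 ^+ 2 <= rr ^+ 2 by rewrite r2 !expr2; lra.
  have kk : (y2 ^+ 2 + y3 ^+ 2) * (c2 ^+ 2 + c3 ^+ 2) <= y2 ^+ 2 + y3 ^+ 2 by rewrite ler_piMr.
  by apply: le_trans (le_trans kk yr); rewrite lerBlDr lerDl.
rewrite -subr_ge0 leNgt; apply/negP => lt0; move: cs; rewrite leNgt => /negP; apply.
by rewrite -[X in _ < X]sqrrN ltr_sqr ?nnegrE; lra.
Qed.

Definition ext z : cyl R := mk (\row_(i < 3) [:: img z 0 (inord 2) / r z;
  img z 0 (inord 3) / r z; phi z + arg (X z) (Y z)]`_i).

Lemma crd_ext z : crd (ext z) = \row_(i < 3) [:: img z 0 (inord 2) / r z;
  img z 0 (inord 3) / r z; phi z + arg (X z) (Y z)]`_i.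
Proof.
apply: crd_mk; have [-> -> _] := row3E (img z 0 (inord 2) / r z) (img z 0 (inord 3) / r z)
  (phi z + arg (X z) (Y z)).
rewrite !expr_div_n -mulrDl ler_pdivrMr ?exprn_gt0 // mul1r topn_sqr.
by have := img_le0 z; rewrite /formQ !expr2; lra.
Qed.

Lemma crd_extE z : [/\ crd (ext z) 0 0 = img z 0 (inord 2) / r z,
  crd (ext z) 0 1 = img z 0 (inord 3) / r z & crd (ext z) 0 ord_max = phi z + arg (X z) (Y z)].
Proof. by rewrite crd_ext; exact: row3E. Qed.

Lemma rr_ext z : rr (ext z) = (topn (img z))^-1 *: img z.
Proof.
have [c s] := cos_sin_arg (r0 z) (XY z) (rX z).
have rn0 : r z != 0 by rewrite gt_eqF.
have [e0 e1 e2 e3] := rayE (crd (ext z)).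
have cs := cos2Dsin2 (phi z).
have [x0 x1 x2] := crd_extE z; rewrite {}x2 in e0 e1; rewrite {}x0 in e2; rewrite {}x1 in e3.
apply/rowP; apply: ord4P; rewrite /rr ?e0 ?e1 ?e2 ?e3 [RHS]mxE -/(r z).
- rewrite cosD c s /X /Y; move: cs; move: (cos _) (sin _) => a b cs.
  transitivity ((r z)^-1 * (img z 0 0 * (a ^+ 2 + b ^+ 2))); last by rewrite cs mulr1.
  by ring.
- rewrite sinD c s /X /Y; move: cs; move: (cos _) (sin _) => a b cs.
  transitivity ((r z)^-1 * (img z 0 1 * (a ^+ 2 + b ^+ 2))); last by rewrite cs mulr1.
  by ring.
- by rewrite mulrC.
- by rewrite mulrC.
Qed.

Lemma ext_continuous : continuous ext.
Proof.
move=> z; have FF : Filter (nbhs z) by exact: nbhs_filter.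
have ci : img z' @[z' --> z] --> img z.
  exact: (@cvg_mulmx _ _ (nbhs z) FF _ _ _ (@rr R) (fun=> A) _ _ (@rr_continuous R z) (cvg_cst _)).
have cij i : img z' 0 i @[z' --> z] --> img z 0 i by exact: (@cvg_coord _ _ (nbhs z) _ _ img _ 0 i ci).
have cr : r z' @[z' --> z] --> r z by exact: cvg_topn.
have cp : phi z' @[z' --> z] --> phi z.
  have h1 := cvg_comp (@tm R) axis (@tm_continuous R z) (@axis_continuous (tm z)).
  have h2 := cvg_comp (axis \o @tm R) g h1 (@gc _).
  have h3 := cvg_comp _ (@to_cyl R) h2 (@to_cyl_continuous R _).
  exact: (cvg_comp _ (@tm R) h3 (@tm_continuous R _)).
have cc : cos (phi z') @[z' --> z] --> cos (phi z) by exact: (cvg_comp _ _ cp (@continuous_cos R _)).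
have cs : sin (phi z') @[z' --> z] --> sin (phi z) by exact: (cvg_comp _ _ cp (@continuous_sin R _)).
have cX : X z' @[z' --> z] --> X z by exact: (cvgD (cvgM (cij 0) cc) (cvgM (cij 1) cs)).
have cY : Y z' @[z' --> z] --> Y z by exact: (cvgB (cvgM cc (cij 1)) (cvgM cs (cij 0))).
have ca : arg (X z') (Y z') @[z' --> z] --> arg (X z) (Y z).
  apply: cvg_arg cX cY; rewrite -XY sqrtr_sqr gtr0_norm //; have := rX z; lra.
have rn0 : r z != 0 by rewrite gt_eqF.
apply: (@cvg_cyl _ _ (nbhs z) _ ext (ext z)).
apply: (@cvg_row3 _ _ (nbhs z) _ (fun z => crd (ext z)) (crd (ext z))).
- have E w : crd (ext w) 0 0 = img w 0 (inord 2) / r w by have [] := crd_extE w.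
  by rewrite E; under eq_fun do rewrite E; exact: (cvgM (cij _) (cvgV rn0 cr)).
- have E w : crd (ext w) 0 1 = img w 0 (inord 3) / r w by have [] := crd_extE w.
  by rewrite E; under eq_fun do rewrite E; exact: (cvgM (cij _) (cvgV rn0 cr)).
- have E w : crd (ext w) 0 ord_max = phi w + arg (X w) (Y w) by have [] := crd_extE w.
  by rewrite E; under eq_fun do rewrite E; exact: (cvgD cp ca).
Qed.

(** Both sides have the same ray, and both times are within [pi] of the reference [phi], hence less
    than [2 pi] apart. *)
Lemma ext_to_cyl (z : ads R) : ext (to_cyl z) = to_cyl (g z).
Proof.
set z' := to_cyl z; have [k k0 gE] := rr_linear_part z.
have rE : rr (ext z') = rr (to_cyl (g z)).
  have kE : topn (rr (to_cyl (g z))) = 1 by rewrite /topn rr_top sqrtr1.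
  move: kE; rewrite rr_ext gE -/z' -/(img z') topnZ gtr0_norm // => kE.
  have rn0 : r z' != 0 by rewrite gt_eqF ?r0.
  by congr (_ *: _); apply: (mulIf rn0); rewrite mulVf // kE.
apply: rr_tm_inj => //.
have a1 : `|tm (ext z') - phi z'| < pi.
  by rewrite tm_crd; have [_ _ ->] := crd_extE z'; rewrite addrAC subrr add0r; exact: arg_lt.
suff a2 : `|tm (to_cyl (g z)) - phi z'| < pi.
  rewrite -(subrK (phi z') (tm (ext z'))) -addrA.
  by rewrite (le_lt_trans (ler_normD _ _)) // (distrC (phi z')); lra.
pose u s : 'rV[R]_3 := \row_(i < 3) [:: s * crd z' 0 0; s * crd z' 0 1; tm z']`_i.
(* The sine is bounded by 1 on the whole line, so the radial path stays in the chart domain for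
   every real [s]. *)
pose v (s : R) := sin (s * (pi / 2)).
have v2 s : v s ^+ 2 <= 1 by have := cos2Dsin2 (s * (pi / 2)); have := sqr_ge0 (cos (s * (pi / 2))); rewrite /v; lra.
have hu s : chart_dom (u (v s)).
  rewrite /chart_dom /=; have [-> -> _] := row3E (v s * crd z' 0 0) (v s * crd z' 0 1) (tm z').
  rewrite !exprMn -mulrDr; have := v2 s.
  have := chart_domP z; rewrite chartE /chart_dom /= -/z'.
  have : 0 <= crd z' 0 0 ^+ 2 + crd z' 0 1 ^+ 2 by rewrite addr_ge0 ?sqr_ge0.
  move: (crd z' 0 0 ^+ 2 + _) => d d0 hd sv.
  by apply: le_lt_trans hd; rewrite ler_piMl.
pose c s := mka (u (v s)).
have cE s : crd (to_cyl (c s)) = u (v s) by rewrite -chartE chart_mka.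
have c1 : c 1 = z.
  apply: chart_inj; rewrite chartE cE chartE -/z' /v mul1r sin_pihalf.
  have [e0 e1 e2] := row3E (1 * crd z' 0 0) (1 * crd z' 0 1) (tm z').
  by apply: row3P; rewrite ?e0 ?e1 ?e2 ?mul1r // -tm_crd.
have c0 : to_cyl (c 0) = to_cyl (axis (tm z')).
  apply: crd_inj; rewrite cE crd_axis /v mul0r sin0.
  have [e0 e1 e2] := row3E (0 * crd z' 0 0) (0 * crd z' 0 1) (tm z').
  by apply: row3P; rewrite ?e0 ?e1 ?e2 ?mul0r mxE /= ?mxE /= ?mulr0 ?mulr1.
have cc : continuous c.
  move=> s; have cv : v x @[x --> s] --> v s.
    exact: (cvg_comp _ (@sin R) (cvgM cvg_id (cvg_cst (pi / 2))) (@continuous_sin R _)).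
  apply: (@cvg_ads_chart _ _ (nbhs s) _ c (c s)).
  rewrite chartE cE; under eq_fun do rewrite chartE cE.
  apply: (@cvg_row3 _ _ (nbhs s) _ (fun s => u (v s)) (u (v s))).
  - have E x : u (v x) 0 0 = v x * crd z' 0 0 by have [] := row3E (v x * crd z' 0 0) (v x * crd z' 0 1) (tm z').
    by rewrite E; under eq_fun do rewrite E; exact: (cvgM cv (cvg_cst _)).
  - have E x : u (v x) 0 1 = v x * crd z' 0 1 by have [] := row3E (v x * crd z' 0 0) (v x * crd z' 0 1) (tm z').
    by rewrite E; under eq_fun do rewrite E; exact: (cvgM cv (cvg_cst _)).
  - have E x : u (v x) 0 ord_max = tm z' by rewrite mxE.
    by rewrite E; under eq_fun do rewrite E; exact: cvg_cst.
have := @window R (fun s => tm (to_cyl (g (c s))) - phi z') pi.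
rewrite c1; apply.
- move=> s; have e1 := cvg_comp c g (cc s) (@gc (c s)).
  have e2 := cvg_comp _ (@to_cyl R) e1 (@to_cyl_continuous R _).
  have e3 := cvg_comp _ (@tm R) e2 (@tm_continuous R _).
  exact: (cvgB e3 (cvg_cst (phi z'))).
- move=> s _; apply: formQ_rr_not_pi.
  have [k1 k10 ->] := rr_linear_part (c s); have [k2 k20 ->] := rr_linear_part (axis (tm z')).
  rewrite formQZl formQZr -/(img _) -/(img _) formQ_img formQ_rr_bot.
  have [-> -> ->] := axisE (tm z').
  have -> : tm (to_cyl (c s)) = tm z' by rewrite tm_crd cE mxE.
  by rewrite subrr cos0 !mulr0 add0r sub0r mulrN1 mulrN oppr_lt0 mulr_gt0.
- have -> : c 0 = axis (tm z') by apply: set_val_inj; exact: c0.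
  by rewrite subrr normr0 pi_gt0.
Qed.

End Ext.

(** * The extended action and the invariance of the domains *)

Section Ext.
Variable R : realType.
Implicit Types (z w l : cyl R).

Lemma SO22hat_continuous (g : ads R -> ads R) : SO22hat g -> continuous g.
Proof.
move=> [[[[F [gF sF]] _] _] _ _] z.
apply: (@cvg_ads_chart _ _ (nbhs z) _ g (g z)).
rewrite -gF; under eq_fun do rewrite -gF.
exact: (cvg_comp (@chart R) F (@chart_continuous R z) (sF 0%N _ (chart_domP z))).
Qed.

Lemma formQ_eq0_ein z : formQ (rr z) (rr z) = 0 -> ein z.
Proof.
rewrite formQ_rr_self => /eqP; rewrite oppr_eq0 expf_eq0 /= => /eqP.
by [].
Qed.

(** Radial contraction by [1 - 1 / (n + 1)] approximates every point of the cylinder from inside. *)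
Lemma ads_dense (h h' : cyl R -> cyl R) : continuous h -> continuous h' ->
  (forall z : ads R, h (to_cyl z) = h' (to_cyl z)) -> h = h'.
Proof.
move=> ch ch' E; apply/funext => z.
pose s (n : nat) : R := 1 - n.+1%:R^-1.
have n1 n : 0 < n.+1%:R^-1 :> R by rewrite invr_gt0 ltr0n.
have n2 n : n.+1%:R^-1 <= 1 :> R by rewrite invf_le1 ?ltr0n // ler1n.
pose u n : 'rV[R]_3 := \row_(i < 3) [:: s n * crd z 0 0; s n * crd z 0 1; tm z]`_i.
have uE n := row3E (s n * crd z 0 0) (s n * crd z 0 1) (tm z).
have hu n : chart_dom (u n).
  rewrite /chart_dom /=; have [-> -> _] := uE n; rewrite !exprMn -mulrDr.
  have := crd_le1 z; have : 0 <= crd z 0 0 ^+ 2 + crd z 0 1 ^+ 2 by rewrite addr_ge0 ?sqr_ge0.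
  move: (crd z 0 0 ^+ 2 + _) => d d0 d1; have := n1 n; have := n2 n; rewrite /s.
  move: (n.+1%:R^-1) => a a1 a0.
  apply: (@le_lt_trans _ _ ((1 - a) ^+ 2)); first by rewrite ler_piMr ?sqr_ge0.
  nra.
have cs : s n @[n --> \oo] --> (1 : R).
  by have := cvgB (cvg_cst (1 : R)) (@cvg_harmonic R); rewrite subr0; apply.
have cw : to_cyl (mka (u n)) @[n --> \oo] --> z.
  apply: (@cvg_cyl _ _ \oo _ (fun n => to_cyl (mka (u n))) z).
  have e n : crd (to_cyl (mka (u n))) = u n by rewrite -chartE chart_mka.
  under eq_fun do rewrite e.
  apply: (@cvg_row3 _ _ \oo _ u (crd z)).
  - have E0 n : u n 0 0 = s n * crd z 0 0 by have [] := uE n.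
    under eq_fun do rewrite E0.
    by have := cvgM cs (cvg_cst (crd z 0 0)); rewrite mul1r; apply.
  - have E0 n : u n 0 1 = s n * crd z 0 1 by have [] := uE n.
    under eq_fun do rewrite E0.
    by have := cvgM cs (cvg_cst (crd z 0 1)); rewrite mul1r; apply.
  - have E0 n : u n 0 ord_max = tm z by have [] := uE n.
    by under eq_fun do rewrite E0; rewrite -tm_crd; exact: cvg_cst.
apply: crd_inj.
have c1 := cvg_comp _ (@crd R) (cvg_comp _ h cw (@ch z)) (@crd_continuous R _).
have c2 := cvg_comp _ (@crd R) (cvg_comp _ h' cw (@ch' z)) (@crd_continuous R _).
have eE : @crd R \o (h \o (fun n => to_cyl (mka (u n)))) = @crd R \o (h' \o (fun n => to_cyl (mka (u n)))).
  by apply/funext => n /=; rewrite E.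
rewrite eE in c1; exact: (@cvg_uniq _ _ \oo _ _ _ _ _ c1 c2).
Qed.

Lemma extensionP (g : ads R -> ads R) : SO22hat g ->
  [/\ continuous (extension g), forall z : ads R, extension g (to_cyl z) = to_cyl (g z) &
   forall A, linear_part g A -> forall z, exists2 k : R, 0 < k & rr (extension g z) = k *: (rr z *m A)].
Proof.
move=> hg; have gc := SO22hat_continuous hg; have [A [gA orthA _ _]] := SO22hat_linear hg.
have c := ext_continuous gc gA orthA; have e := ext_to_cyl gc gA orthA.
have -> : extension g = ext g A.
  rewrite /extension; case: pselect => [ex|]; last by case; exists (ext g A).
  have [c' e'] := svalP (cid ex).
  by apply: ads_dense => // z; rewrite e' e.
split=> // B gB z; rewrite (linear_part_uniq gB gA); exists (topn (img A z))^-1.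
  by rewrite invr_gt0; apply: topn_gt0; [exact: img_le0|exact: img_neq0].
exact: rr_ext.
Qed.

Lemma extension_id : extension (@id (ads R)) = id.
Proof.
rewrite /extension; case: pselect => [ex|]; last first.
  by case; exists id; split=> // z; exact: cvg_id.
have [c e] := svalP (cid ex).
by apply: ads_dense => // z; exact: cvg_id.
Qed.

Variable G : subgroup R.

Lemma extension_comp g h : G g -> G h -> extension (g \o h) = extension g \o extension h.
Proof.
move=> Gg Gh; have [c1 e1 _] := extensionP (subgroup_sub Gg).
have [c2 e2 _] := extensionP (subgroup_sub Gh).
have [c3 e3 _] := extensionP (subgroup_sub (subgroup_comp Gg Gh)).
apply: ads_dense => // [z|z]; first exact: (cvg_comp _ _ (@c2 z) (@c1 _)).
by rewrite e3 /= e2 e1.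
Qed.

Lemma spatial_ext g z w : G g -> spatial z w -> spatial (extension g z) (extension g w).
Proof.
move=> /subgroup_sub hg; have [A [gA orthA _ _]] := SO22hat_linear hg.
have [c e a] := extensionP hg.
by apply: spatial_equivariant c (a A gA) orthA _ _.
Qed.

Variable L : set (cyl R).
Hypothesis Le : L `<=` @ein R.
Hypothesis Lclosed : closed L.
Hypothesis La : achronal L.
Hypothesis Lnon : nonelementary L.
Hypothesis Gpres : preserves G L.

Let Lk : compact L := achronal_compact Lclosed La.

Lemma ext_L g l : G g -> L l -> L (extension g l).
Proof. by move=> Gg Ll; rewrite -(Gpres Gg); exists l. Qed.

Lemma ext_between g z : G g -> between L z -> between L (extension g z).
Proof.
move=> Gg /(between_spatial _ Le Lk) h; apply/(between_spatial _ Le Lk) => l.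
by rewrite -(Gpres Gg) => -[l' Ll' <-]; apply: spatial_ext => //; exact: h.
Qed.

Lemma ext_ein g z : G g -> ein z -> ein (extension g z).
Proof.
move=> /subgroup_sub hg ez; have [A [gA orthA _ _]] := SO22hat_linear hg.
have [_ _ a] := extensionP hg; have [k k0 kE] := a A gA z.
apply: formQ_eq0_ein; rewrite kE formQZl formQZr formQ_adj -mulmxA orthA mulmx1.
by rewrite ein_top // !mulr0.
Qed.

Lemma ext_inv g : G g -> exists2 h, G h & cancel (extension h) (extension g).
Proof.
move=> Gg; have [h [Gh gK hK]] := subgroup_inv Gg; exists h => // z.
rewrite -[LHS]/((extension g \o extension h) z) -extension_comp //.
have -> : g \o h = id by apply/funext => x; exact: hK.
by rewrite extension_id.
Qed.

Lemma Omega_preserved : preserves_dom G (@extension R) (Omega L).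
Proof.
move=> g Gg; rewrite eqEsubset; split=> [_ [z [ez bz] <-]|z [ez bz]].
  by split; [exact: ext_ein|exact: ext_between].
have [h Gh hK] := ext_inv Gg; exists (extension h z); last exact: hK.
by split; [exact: ext_ein|exact: ext_between].
Qed.

Lemma Edom_stable g (z : ads R) : G g -> Edom L z -> Edom L (g z).
Proof.
move=> Gg; have [_ e _] := extensionP (subgroup_sub Gg).
by rewrite /Edom /= -e => h; exact: ext_between.
Qed.

Lemma Edom_preserved : preserves_dom G id (Edom L).
Proof.
move=> g Gg; rewrite eqEsubset; split=> [_ [z Ez <-]|z Ez]; first exact: Edom_stable.
have [h [Gh gK hK]] := subgroup_inv Gg; exists (h z); last exact: hK.
exact: Edom_stable.
Qed.

Definition Lcone : set 'rV[R]_4 := @rr R @` L.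

(** Orthogonality to the null ray equates the cosines of the time difference and of the angle on the
    circle, so [l] is on a lightlike geodesic through any lift of the ray. Lightcones contain
    geodesics of every length, so it suffices to move the lift below all of [L] by a multiple of
    [2 pi]. *)
Lemma future_lightcone_of_orthogonal (u : 'rV[R]_3) (l0 : cyl R) : L l0 ->
  u 0 0 ^+ 2 + u 0 1 ^+ 2 = 1 -> (forall l, L l -> formQ (ray u) (rr l) = 0) ->
  exists z, ein z /\ L `<=` future_lightcone z.
Proof.
move=> L0 u1 h.
have [N hN] : exists N : nat, u 0 ord_max - (pi *+ 2) * N%:R <= - (`|tm l0| + pi).
  exists (Num.Def.archi_bound (`|u 0 ord_max| + `|tm l0| + pi)).
  have b0 : 0 <= `|u 0 ord_max| + `|tm l0| + pi by exact: addr_ge0 (addr_ge0 (normr_ge0 _) (normr_ge0 _)) (pi_ge0 R).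
  have := archi_boundP b0.
  move: (_%:R) => a ha; have p2 : 2 <= pi := pi_ge2 R; have := ler_norm (u 0 ord_max).
  rewrite mulr2n; have : 0 <= (pi - 2) * a; last nra.
  by rewrite mulr_ge0 ?subr_ge0 //; have := normr_ge0 (u 0 ord_max); have := normr_ge0 (tm l0); lra.
pose t0 := u 0 ord_max - (pi *+ 2) * N%:R.
have [ct st] : cos t0 = cos (u 0 ord_max) /\ sin t0 = sin (u 0 ord_max).
  rewrite /t0; elim: N {hN t0} => [|n [IHc IHs]]; first by rewrite mulr0 subr0.
  have e : u 0 ord_max - pi *+ 2 * n%:R = (u 0 ord_max - pi *+ 2 * n.+1%:R) + pi *+ 2.
    by rewrite -[n.+1%:R]natr1; ring.
  by move: IHc IHs; rewrite e cosD2pi sinD2pi.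
pose x : 'rV[R]_3 := \row_(i < 3) [:: u 0 0; u 0 1; 0]`_i.
have [x0 x1 x2] := row3E (u 0 0) (u 0 1) 0.
have xz : cyl_set (x, t0).
  by split=> /=; [rewrite dotE x0 x1 x2 mulr0 addr0 -!expr2|rewrite x2].
pose z : cyl R := SigSub (mem_set xz).
exists z; split; first exact: x2.
move=> l Ll; pose s := tm l - t0.
have s0 : 0 <= s.
  have := achronal_bounded La L0 Ll => /ler_normlP[h1 _]; rewrite /s; have := hN; rewrite -/t0; lra.
have [l1 l2 l3] : [/\ pt l 0 ord_max = 0, cos s = u 0 0 * pt l 0 0 + u 0 1 * pt l 0 1
    & pt l 0 0 ^+ 2 + pt l 0 1 ^+ 2 = 1].
  have el := Le Ll; have := unit_pt l; rewrite /unit3 dotE el mulr0 addr0 -!expr2 => e1.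
  split=> //; have := h l Ll; have [r0 r1 r2 r3] := rayE u; have [q0 q1 q2 q3] := rayE (crd l).
  rewrite /formQ r0 r1 r2 r3 q0 q1 q2 q3 -tm_crd; have [-> -> _] := crdE l.
  by rewrite /s cosB ct st; lra.
pose b := u 0 0 * pt l 0 1 - u 0 1 * pt l 0 0.
have b2 : b ^+ 2 = sin s ^+ 2.
  rewrite sin2cos2 l2 /b; move: u1 l3; move: (u 0 0) (u 0 1) (pt l 0 0) (pt l 0 1) => p q a c u1 l3.
  have -> : 1 = (p ^+ 2 + q ^+ 2) * (a ^+ 2 + c ^+ 2) by rewrite u1 l3 mulr1.
  by ring.
(* [e] is the sense of rotation of the geodesic on the circle. *)
have [e [e2 be]] : exists e : R, e ^+ 2 = 1 /\ b = e * sin s.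
  move/eqP: b2; rewrite eqf_sqr => /orP[] /eqP ->.
    by exists 1; rewrite expr1n mul1r.
  by exists (-1); rewrite sqrrN expr1n mulN1r.
pose c (r : R) : 'rV[R]_3 := \row_(i < 3) [:: cos r * u 0 0 - e * sin r * u 0 1;
  cos r * u 0 1 + e * sin r * u 0 0; 0]`_i.
pose dc (r : R) : 'rV[R]_3 := \row_(i < 3) [:: - sin r * u 0 0 - e * cos r * u 0 1;
  - sin r * u 0 1 + e * cos r * u 0 0; 0]`_i.
have cE r := row3E (cos r * u 0 0 - e * sin r * u 0 1) (cos r * u 0 1 + e * sin r * u 0 0) 0.
have dcE r := row3E (- sin r * u 0 0 - e * cos r * u 0 1) (- sin r * u 0 1 + e * cos r * u 0 0) 0.
have isd r : is_derive r (1 : R) c (dc r).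
  apply: is_derive_matrix => i j; rewrite (ord1 i); move: j.
  have dcos := is_derive_cos r; have dsin := is_derive_sin r.
  apply: ord3P.
  - have E q : c q 0 0 = cos q * u 0 0 - e * sin q * u 0 1 by have [] := cE q.
    have [-> _ _] := dcE r; under eq_fun do rewrite E.
    by apply: is_derive_eq; rewrite /GRing.scale /=; ring.
  - have E q : c q 0 1 = cos q * u 0 1 + e * sin q * u 0 0 by have [] := cE q.
    have [_ -> _] := dcE r; under eq_fun do rewrite E.
    by apply: is_derive_eq; rewrite /GRing.scale /=; ring.
  - have E q : c q 0 ord_max = 0 by have [] := cE q.
    have [_ _ ->] := dcE r; under eq_fun do rewrite E.
    exact: is_derive_cst.
have d1 : derive1 c = dc.
  by apply/funext => r; rewrite derive1E; have [_ ->] := isd r.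
have cs r : cos r ^+ 2 + sin r ^+ 2 = 1 := cos2Dsin2 r.
have u2 : u 0 1 ^+ 2 = 1 - u 0 0 ^+ 2 by rewrite -u1; ring.
exists c, s; split=> //.
- split.
    move=> r; have [c0 c1 c2] := cE r; have [f0 f1 f2] := dcE r; rewrite d1.
    have key (p q : R) : (p * u 0 0 - e * q * u 0 1) ^+ 2 + (p * u 0 1 + e * q * u 0 0) ^+ 2 =
        (p ^+ 2 + q ^+ 2) * (u 0 0 ^+ 2 + u 0 1 ^+ 2).
      transitivity ((p ^+ 2 + e ^+ 2 * q ^+ 2) * (u 0 0 ^+ 2 + u 0 1 ^+ 2)); first by ring.
      by rewrite e2 mul1r.
    split; [|exact: c2|exact: derivable_of (isd r)|].
    + by rewrite dotE c0 c1 c2 mulr0 addr0 -!expr2 key cs u1 mulr1.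
    + by rewrite dotE f0 f1 f2 mulr0 addr0 -!expr2 key sqrrN addrC cs u1 mulr1.
  rewrite d1 => r; apply: (@cvg_row3 _ _ (nbhs r) _ dc (dc r)).
  + have E q : dc q 0 0 = - sin q * u 0 0 - e * cos q * u 0 1 by have [] := dcE q.
    rewrite E; under eq_fun do rewrite E.
    exact: (cvgB (cvgM (cvgN (@continuous_sin R r)) (cvg_cst _))
      (cvgM (cvgM (cvg_cst _) (@continuous_cos R r)) (cvg_cst _))).
  + have E q : dc q 0 1 = - sin q * u 0 1 + e * cos q * u 0 0 by have [] := dcE q.
    rewrite E; under eq_fun do rewrite E.
    exact: (cvgD (cvgM (cvgN (@continuous_sin R r)) (cvg_cst _))
      (cvgM (cvgM (cvg_cst _) (@continuous_cos R r)) (cvg_cst _))).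
  + have E q : dc q 0 ord_max = 0 by have [] := dcE q.
    by rewrite E; under eq_fun do rewrite E; exact: cvg_cst.
- have [c0 c1 c2] := cE 0; apply: row3P; rewrite ?c0 ?c1 ?c2 ?cos0 ?sin0 ?x0 ?x1 ?x2 //; ring.
- have [c0 c1 c2] := cE s; apply: row3P; rewrite ?c0 ?c1 ?c2 // -?be l2 ?/b.
    move: u2; move: (u 0 0) (u 0 1) (pt l 0 0) (pt l 0 1) => p q a d u2.
    transitivity (a * (p ^+ 2 + q ^+ 2)); last by ring.
    by rewrite u2; ring.
  move: u2; move: (u 0 0) (u 0 1) (pt l 0 0) (pt l 0 1) => p q a d u2.
  transitivity (d * (p ^+ 2 + q ^+ 2)); last by ring.
  by rewrite u2; ring.
- by rewrite /s addrC subrK.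
Qed.

End Ext.

(** * Timelike curves *)

Section Causal.
Variable R : realType.
Implicit Types (z w : cyl R).

Definition causal_le z w := sdist (pt z) (pt w) <= tm w - tm z.

Lemma causal_trans w z x : causal_le z w -> causal_le w x -> causal_le z x.
Proof.
rewrite /causal_le => h1 h2.
by have := sdist_triangle (unit_pt z) (unit_pt w) (unit_pt x); lra.
Qed.

(** Trading the distance for its cosine gives conditions that pass to limits. *)
Lemma causal_leP z w : causal_le z w <->
  0 <= tm w - tm z /\ (pi <= tm w - tm z \/ cos (tm w - tm z) <= dot (pt z) (pt w)).
Proof.
have d0 := sdist_ge0 (unit_pt z) (unit_pt w); have dp := sdist_lepi (unit_pt z) (unit_pt w).
rewrite /causal_le -(cos_sdist (unit_pt z) (unit_pt w)); split=> [h|[h0 [hp|hc]]].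
- split; first exact: le_trans h; have [hp|hp] := leP pi (tm w - tm z); [by left|right].
  by apply: cos_le => //; exact: ltW.
- exact: le_trans dp hp.
- have [hp|hp] := leP pi (tm w - tm z); first exact: le_trans dp hp.
  by apply: le_cos; [rewrite d0 dp|rewrite h0 (ltW hp)|exact: hc].
Qed.

Lemma causal_closed (T : Type) (F : set_system T) {FF : ProperFilter F} (f h : T -> cyl R) z w :
  f @ F --> z -> h @ F --> w -> (\forall t \near F, causal_le (f t) (h t)) -> causal_le z w.
Proof.
move=> fz hw hJ.
have cf := cvg_comp f (@tm R) fz (@tm_continuous R z).
have ch := cvg_comp h (@tm R) hw (@tm_continuous R w).
have cd : tm (h t) - tm (f t) @[t --> F] --> tm w - tm z by exact: (cvgB ch cf).
have pf := cvg_comp f (@pt R) fz (@pt_continuous R z).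
have ph := cvg_comp h (@pt R) hw (@pt_continuous R w).
have cdot : dot (pt (f t)) (pt (h t)) @[t --> F] --> dot (pt z) (pt w).
  rewrite /dot; apply: (@cvg_sumr _ _ F _ 3 (fun i t => pt (f t) 0 i * pt (h t) 0 i)) => i.
  exact: (cvgM (@cvg_coord _ _ F 1 3 (@pt R \o f) (pt z) 0 i pf) (@cvg_coord _ _ F 1 3 (@pt R \o h) (pt w) 0 i ph)).
have cc : cos (tm (h t) - tm (f t)) - dot (pt (f t)) (pt (h t)) @[t --> F] -->
    cos (tm w - tm z) - dot (pt z) (pt w).
  exact: (cvgB (cvg_comp _ (@cos R) cd (@continuous_cos R _)) cdot).
apply/causal_leP; split.
  apply: (@cvg_ge0 _ _ F _ _ _ cd); apply: (@filterS _ F) hJ => t.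
  by move=> /causal_leP[].
have [hp|hp] := leP pi (tm w - tm z); [by left|right].
rewrite -subr_le0; apply: (@cvg_le0 _ _ F _ _ _ cc).
have e1 : \forall t \near F, tm (h t) - tm (f t) < pi by exact: (cvgr_lt _ cd _ hp).
near=> t.
have h1 : tm (h t) - tm (f t) < pi by near: t; exact: e1.
have h2 : causal_le (f t) (h t) by near: t; exact: hJ.
by move: h2 => /causal_leP[_ [h'|h']]; [move: h1; rewrite ltNge h'|rewrite subr_le0].
Unshelve. all: by end_near. Qed.

(** With the conformal factor removed: the projection to the hemisphere moves more slowly than
    time. *)
Lemma future_timelike_speed (u v : 'rV[R]_3) : chart_dom u -> future_timelike u v ->
  0 < v 0 ord_max /\ v 0 0 ^+ 2 + v 0 1 ^+ 2 + sgm u ^+ 2 * (u 0 0 * v 0 0 + u 0 1 * v 0 1) ^+ 2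
    < v 0 ord_max ^+ 2.
Proof.
move=> hu [m v0]; split=> //; move: m; rewrite metricE // formQ_dX //.
have s2 := sgm2 hu; have s0 := sgm_gt0 hu; have : 0 < sgm u ^+ 2 by rewrite exprn_gt0.
have -> : sgm u ^+ 4 = sgm u ^+ 2 * sgm u ^+ 2 by rewrite -exprD.
move: (sgm u ^+ 2) (u 0 0 * _ + _) => S a S0 h.
by rewrite -subr_lt0 -(pmulr_rlt0 _ S0); move: h; rewrite !expr2; lra.
Qed.

(** The distance from the starting point grows at most as fast as time. Since [acos] is not
    differentiable at 1, where the curve starts, it is applied to [c * D] with [c = cos n < 1], and
    [n] tends to 0 at the end. *)
Lemma causal_curve (l : R -> cyl R) (a b : R) : a <= b ->
  (forall s : R, a <= s <= b -> [/\ chart_dom (crd (l s)), derivable (@crd R \o l) s 1 &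
     future_timelike (crd (l s)) (derive1 (@crd R \o l) s)]) ->
  causal_le (l a) (l b).
Proof.
rewrite le_eqVlt => /orP[/eqP <- _|ab h].
  by rewrite /causal_le sdistxx ?subrr //; exact: unit_pt.
pose k := @crd R \o l; pose dk := derive1 k.
pose x := pt (l a).
have ux : unit3 x := unit_pt (l a).
pose D s := x 0 0 * k s 0 0 + x 0 1 * k s 0 1 +
   x 0 ord_max * Num.sqrt (1 - k s 0 0 ^+ 2 - k s 0 1 ^+ 2).
have DE s : D s = dot x (pt (l s)).
  by rewrite dotE /D /k /= (pt3E (l s)); have [-> -> _] := crdE (l s).
pose y s := (sgm (k s))^-1.
pose dy s := - (k s 0 0 * dk s 0 0 + k s 0 1 * dk s 0 1) * sgm (k s).
pose dD s := x 0 0 * dk s 0 0 + x 0 1 * dk s 0 1 + x 0 ord_max * dy s.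
have dkE s i : a <= s <= b -> is_derive s (1 : R) (fun s => k s 0 i) (dk s 0 i).
  move=> hs; have [_ d _] := h s hs; rewrite /dk derive1E; exact: derive_entry.
have dDE s : a <= s <= b -> is_derive s (1 : R) D (dD s).
  move=> hs; have [hu _ _] := h s hs.
  have p0 : 0 < 1 - k s 0 0 ^+ 2 - k s 0 1 ^+ 2 := dom_gt0 hu.
  have d0 := dkE s 0 hs; have d1 := dkE s 1 hs.
  have e1 : is_derive s (1 : R) (fun s => 1 - k s 0 0 ^+ 2 - k s 0 1 ^+ 2)
     (- (2 * (k s 0 0 * dk s 0 0 + k s 0 1 * dk s 0 1))).
    apply: is_derive_eq; rewrite /GRing.scale /=; ring.
  have e2 := @is_derive1_comp R Num.sqrt (fun s => 1 - k s 0 0 ^+ 2 - k s 0 1 ^+ 2) s _ _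
    (is_derive1_sqrt p0) e1.
  have e3 := is_deriveD (is_deriveD (is_deriveZ (x 0 0) d0) (is_deriveZ (x 0 1) d1)) (is_deriveZ (x 0 ord_max) e2).
  apply: is_derive_eq e3 _; rewrite /GRing.scale /= /dD /dy /sgm.
  have sn : Num.sqrt (1 - k s 0 0 ^+ 2 - k s 0 1 ^+ 2) != 0 by rewrite gt_eqF // sqrtr_gt0.
  by move: (Num.sqrt _) sn => q qn; field.
(* [V] is the squared speed of the projection to the sphere; Cauchy-Schwarz with the part of [x]
   tangent at the current point bounds the derivative of [D]. *)
have key s : a <= s <= b -> D s ^+ 2 <= 1 /\ exists2 V : R, 0 <= V &
    [/\ 0 < dk s 0 ord_max, V < dk s 0 ord_max ^+ 2 & dD s ^+ 2 <= (1 - D s ^+ 2) * V].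
  move=> hs; have [hu _ ft] := h s hs; have [v0 sp] := future_timelike_speed hu ft.
  pose Y := pt (l s).
  have uY : unit3 Y := unit_pt (l s).
  have D1 : D s ^+ 2 <= 1.
    by have := dot_CS x Y; rewrite DE ux uY mulr1.
  pose dY : 'rV[R]_3 := \row_(i < 3) [:: dk s 0 0; dk s 0 1; dy s]`_i.
  have [e0 e1 e2] := row3E (dk s 0 0) (dk s 0 1) (dy s).
  have [k0 k1 _] := crdE (l s).
  have y3 : Y 0 ord_max = (sgm (k s))^-1 by rewrite /Y pt3E /sgm invrK k0 k1.
  have sn : sgm (k s) != 0 by rewrite gt_eqF // sgm_gt0.
  have YdY : dot Y dY = 0.
    rewrite dotE e0 e1 e2 y3 /dy /Y -k0 -k1 -/(k s) mulrCA mulVf // mulr1; ring.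
  have xdY : dot x dY = dD s by rewrite dotE e0 e1 e2.
  split=> //; exists (dot dY dY); first exact: dot_ge0.
  split=> //.
    apply: le_lt_trans sp; rewrite dotE e0 e1 e2 /dy le_eqVlt; apply/orP; left; apply/eqP.
    rewrite -/(k s) -/(dk s); ring.
  have := dot_CS (1 *: x + (- D s) *: Y) dY.
  rewrite dot_combo YdY mulr0 addr0 mul1r xdY.
  rewrite dot_combo dotC dot_combo [dot Y (_ + _)]dotC dot_combo ux uY (dotC Y x) -DE.
  by move=> hh; apply: le_trans hh _; rewrite le_eqVlt; apply/orP; left; apply/eqP; ring.
have tmE s : tm (l s) = k s 0 ord_max := tm_crd (l s).
have mono (c : R) : 0 < c -> c < 1 -> acos (c * D b) - tm (l b) <= acos (c * D a) - tm (l a).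
  move=> c0 c1; rewrite -subr_le0.
  pose f s := acos (c * D s) - k s 0 ord_max.
  pose df s := - (Num.sqrt (1 - (c * D s) ^+ 2))^-1 * (c * dD s) - dk s 0 ord_max.
  have cD s : a <= s <= b -> (c * D s) ^+ 2 < 1.
    move=> hs; have [D1 _] := key s hs; rewrite exprMn.
    by apply: (@le_lt_trans _ _ (c ^+ 2)); [rewrite ler_piMr ?sqr_ge0|rewrite expr_lt1 // ltW].
  have dfE s : a <= s <= b -> is_derive s (1 : R) f (df s).
    move=> hs; have hlt : -1 < c * D s < 1.
      by have := cD s hs => h2; apply/andP; split; nra.
    have e1 : is_derive s (1 : R) (fun s => c * D s) (c * dD s) := is_deriveZ c (dDE s hs).
    have e2 := @is_derive1_comp R (@acos R) (fun s => c * D s) s _ _ (is_derive1_acos hlt) e1.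
    exact: (is_deriveB e2 (dkE s ord_max hs)).
  have [] := @MVT R f df a b ab.
  - by move=> s; rewrite in_itv /= => /andP[s1 s2]; apply: dfE; rewrite !ltW.
  - apply: derivable_within_continuous => s; rewrite in_itv /= => hs.
    exact: derivable_of (dfE s hs).
  move=> s; rewrite in_itv /= => /andP[s1 s2]; rewrite /f -!tmE => ->.
  have hs : a <= s <= b by rewrite !ltW.
  apply: mulr_le0_ge0; last by rewrite subr_ge0 ltW.
  have [D1 [V V0 [v0 Vv dDV]]] := key s hs; have := cD s hs; rewrite /df.
  move: (D s) (dD s) (dk s 0 ord_max) D1 v0 Vv dDV => d e v d1 v0 Vv dDV cd.
  have q0 : 0 < 1 - (c * d) ^+ 2 by rewrite subr_gt0.
  have [q qE] : exists q : R, q = Num.sqrt (1 - (c * d) ^+ 2) by eexists.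
  have qp : 0 < q by rewrite qE sqrtr_gt0.
  have q2 : q ^+ 2 = 1 - (c * d) ^+ 2 by rewrite qE sqr_sqrtr // ltW.
  rewrite -qE.
  have ce : (c * e) ^+ 2 <= (q * v) ^+ 2.
    rewrite !exprMn q2; have c2 : c ^+ 2 <= 1 by rewrite expr_le1 // ltW.
    have c20 := sqr_ge0 c; have d20 := sqr_ge0 d.
    apply: (@le_trans _ _ ((1 - (c * d) ^+ 2) * V)); last by rewrite ler_pM2l // ltW.
    apply: (@le_trans _ _ (c ^+ 2 * ((1 - d ^+ 2) * V))); first by rewrite ler_wpM2l.
    rewrite mulrA ler_wpM2r // exprMn; lra.
  have qv0 : 0 <= q * v by rewrite mulr_ge0 // ltW.
  have ce2 : - (c * e) <= q * v.
    rewrite -subr_ge0 leNgt; apply/negP => lt0; move: ce; rewrite leNgt => /negP; apply.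
    by rewrite -[X in _ < X]sqrrN ltr_sqr ?nnegrE //; lra.
  rewrite subr_le0 mulNr -mulrN mulrC ler_pdivrMr // mulrC; lra.
have DaE : D a = 1 by rewrite DE -/x ux.
have mono2 (n : R) : 0 < n -> n < pi / 2 -> acos (cos n * D b) <= n + (tm (l b) - tm (l a)).
  move=> n0 np; have c0 : 0 < cos n by rewrite cos_gt0_pihalf // np andbT; have := pi_gt0 R; lra.
  have c1 : cos n < 1.
    by rewrite -cos0 ltr_cos // in_itv /= ?lexx ?pi_ge0 ?(ltW n0) //; have := pi_gt0 R; lra.
  have := mono _ c0 c1; rewrite DaE mulr1 cosK; first by lra.
  by rewrite in_itv /= (ltW n0) /=; have := pi_gt0 R; lra.
have t0 : 0 <= tm (l b) - tm (l a).
  have [] := @MVT R (fun s => k s 0 ord_max) (fun s => dk s 0 ord_max) a b ab.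
  - by move=> s; rewrite in_itv /= => /andP[s1 s2]; apply: dkE; rewrite !ltW.
  - apply: derivable_within_continuous => s; rewrite in_itv /= => hs.
    exact: derivable_of (dkE s ord_max hs).
  move=> s; rewrite in_itv /= -!tmE => /andP[s1 s2] ->.
  have hs : a <= s <= b by rewrite !ltW.
  by have [_ [V _ [v0 _ _]]] := key s hs; rewrite mulr_ge0 ?subr_ge0 // ltW.
apply/causal_leP; split => //; rewrite -DE.
have [hp|hp] := leP pi (tm (l b) - tm (l a)); [by left|right].
move: t0 hp mono2; move: (tm (l b) - tm (l a)) => T T0 Tp mono2.
rewrite leNgt; apply/negP => lt.
have cc : (cos n * D b - cos (n + T)) @[n --> (0 : R)] --> cos 0 * D b - cos (0 + T).
  apply: cvgB; first exact: (cvgM (@continuous_cos R 0) (cvg_cst _)).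
  exact: (cvg_comp _ (@cos R) (cvgD cvg_id (cvg_cst T)) (@continuous_cos R _)).
rewrite cos0 mul1r add0r in cc.
have /(cvgr_lt _ cc _)[e /= e0 he] : D b - cos T < 0 by rewrite subr_lt0.
pose n := Num.min (e / 2) (Num.min ((pi - T) / 2) (pi / 4)).
have n0 : 0 < n by have pg := pi_gt0 R; rewrite !lt_min; apply/and3P; split; lra.
have [n1 n2 n3] : [/\ n <= e / 2, n <= (pi - T) / 2 & n <= pi / 4].
  by split; rewrite /n !ge_min lexx ?orbT.
have := he n; rewrite /= sub0r normrN gtr0_norm // => /(_ ltac:(lra)).
apply/negP; rewrite -leNgt subr_ge0.
have Db : -1 <= cos n * D b <= 1.
  have := unit_dot_le1 ux (unit_pt (l b)); rewrite -DE; have := cos_le1 n; have := cos_geN1 n.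
  by move=> h1 h2 /andP[h3 h4]; apply/andP; split; nra.
rewrite -[X in _ <= X]acosK ?in_itv //.
apply: cos_le; [by apply: acos_ge0|by lra|apply: mono2 => //].
by have := pi_gt0 R; lra.
Qed.

(** Real induction on the supremum of the points reachable from [a]; it joins local lifts of a curve
    without choosing a subdivision. *)
Lemma interval_chain (P : R -> R -> Prop) (a b : R) : a <= b ->
  (forall s t r, P s t -> P t r -> P s r) ->
  (forall t : R, a <= t <= b -> exists2 e : R, 0 < e & forall s r : R,
     a <= s -> s <= r -> r <= b -> `|s - t| < e -> `|r - t| < e -> P s r) ->
  P a b.
Proof.
move=> ab tr loc.
have haa : P a a.
  have [|e e0 he] := loc a; first by rewrite lexx.
  by apply: he; rewrite ?lexx ?subrr ?normr0.
pose S := [set t : R | a <= t <= b /\ P a t].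
have Sa : S a by rewrite /S /= lexx ab.
have Sub : has_ubound S by exists b => t [/andP[]].
have supS : has_sup S by split; [exists a|].
have s1 : a <= sup S by apply: ub_le_sup.
have s2 : sup S <= b by apply: ge_sup; [exists a|move=> t [/andP[]]].
have [|e e0 he] := loc (sup S); first by rewrite s1.
have [t [/andP[ta tb] Pt] te] := sup_adherent e0 supS.
have tS : t <= sup S by apply: ub_le_sup => //; split; rewrite ?ta.
pose r := Num.min b (sup S + e / 2).
have rb : r <= b by rewrite /r ge_min lexx.
have re : r <= sup S + e / 2 by rewrite /r ge_min lexx orbT.
have Sr : sup S <= r by rewrite /r le_min s2 /=; lra.
have Pr : P a r.
  apply: (tr _ t) => //; apply: he => //; first exact: le_trans Sr.
    by rewrite ler0_norm; lra.
  by rewrite ger0_norm; lra.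
have rS : r <= sup S by apply: ub_le_sup => //; split=> //; rewrite rb (le_trans s1).
suff -> : b = r by [].
apply/eqP; rewrite eq_le rb andbT leNgt; apply/negP => rlt.
by move: rS; rewrite /r min_r; [lra|rewrite leNgt; apply/negP => h; move: rlt; rewrite /r min_l ?ltxx // ltW].
Qed.

End Causal.

(** * Discreteness and proper discontinuity *)

Section Seq.
Variable R : realType.
Implicit Types (z w l y : cyl R).

Lemma cvg_rr (T : Type) (F : set_system T) {FF : Filter F} (f : T -> cyl R) z :
  rr (f t) @[t --> F] --> rr z -> tm (f t) @[t --> F] --> tm z -> f @ F --> z.
Proof.
move=> h1 h2; apply: (@cvg_cyl _ _ F FF f z).
have [_ _ e2 e3] := rayE (crd z).
apply: (@cvg_row3 _ _ F FF (fun t => crd (f t)) (crd z)).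
- have E w : crd w 0 0 = rr w 0 (inord 2) by have [_ _ -> _] := rayE (crd w).
  by rewrite E; under eq_fun do rewrite E; exact: (@cvg_coord _ _ F 1 4 (fun t => rr (f t)) (rr z) 0 _ h1).
- have E w : crd w 0 1 = rr w 0 (inord 3) by have [_ _ _ ->] := rayE (crd w).
  by rewrite E; under eq_fun do rewrite E; exact: (@cvg_coord _ _ F 1 4 (fun t => rr (f t)) (rr z) 0 _ h1).
- by rewrite -tm_crd; under eq_fun do rewrite -tm_crd.
Qed.

Lemma rr_extension (g : ads R -> ads R) A z : SO22hat g -> linear_part g A ->
  rr (extension g z) = (topn (rr z *m A))^-1 *: (rr z *m A) /\ 0 < topn (rr z *m A).
Proof.
move=> hg gA; have [_ _ /(_ A gA z)[k k0 kE]] := extensionP hg.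
have : topn (rr (extension g z)) = 1 by rewrite /topn rr_top sqrtr1.
rewrite kE topnZ gtr0_norm // => h.
have t0 : 0 < topn (rr z *m A) by rewrite -(pmulr_rgt0 _ k0) h.
split=> //; congr (_ *: _).
by apply: (mulIf (lt0r_neq0 t0)); rewrite h mulVf // gt_eqF.
Qed.

Section IdLimit.
Variables (T : Type) (U : set_system T) (UU : UltraFilter U).
Variables (g : T -> ads R -> ads R) (A : T -> 'M[R]_4).
Hypothesis hg : forall t, SO22hat (g t).
Hypothesis hA : forall t, linear_part (g t) (A t).
Hypothesis A1 : A @ U --> (1%:M : 'M[R]_4).
Let e t := extension (g t).

Lemma rr_id_limit (z : T -> cyl R) z' : z @ U --> z' -> rr (e t (z t)) @[t --> U] --> rr z'.
Proof.
move=> zz; have h1 : rr (z t) *m A t @[t --> U] --> rr z' *m 1%:M.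
  apply: (@cvg_mulmx _ _ U _ _ _ _ (fun t => rr (z t)) A) => //.
  exact: (cvg_comp z (@rr R) zz (@rr_continuous R z')).
rewrite mulmx1 in h1.
have t1 : topn (rr z') = 1 by rewrite /topn rr_top sqrtr1.
have h2 : topn (rr (z t) *m A t) @[t --> U] --> (1 : R) by rewrite -t1; exact: cvg_topn.
have h3 : (topn (rr (z t) *m A t))^-1 @[t --> U] --> (1 : R)^-1 by apply: cvgV => //; exact: oner_neq0.
have h4 := @cvg_scalemx _ _ U _ _ _ _ _ _ _ h3 h1; rewrite invr1 scale1r in h4.
have E : (fun t => rr (e t (z t))) = (fun t => (topn (rr (z t) *m A t))^-1 *: (rr (z t) *m A t)).
  by apply/funext => t; have [] := rr_extension (z t) (hg t) (hA t).
by rewrite E; exact: h4.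
Qed.

(** The limit of the times agrees with [tm z'] modulo [2 pi] because the matrices tend to 1. The
    reference point [y], within [pi] of both, excludes the other sheets. *)
Lemma tm_id_limit (z : T -> cyl R) y z' (M : R) :
  tm (e t y) @[t --> U] --> tm y -> z @ U --> z' -> `|tm z' - tm y| < pi ->
  (\forall t \near U, `|tm (e t (z t)) - tm (e t y)| < pi) -> tm (e t (z t)) @[t --> U] --> tm z'.
Proof.
move=> hy zz d hs.
have hb : \forall t \near U, `|tm (e t y)| < `|tm y| + 1.
  by apply: (cvgr_lt _ (cvg_norm hy)); rewrite ltrDl.
have [S hS] : exists S : R, tm (e t (z t)) @[t --> U] --> S.
  apply: (@ultra_cvg_bounded _ _ U (fun t => tm (e t (z t))) (`|tm y| + 1 + pi) UU).
  near=> t.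
  have h1 : `|tm (e t (z t)) - tm (e t y)| < pi by near: t; exact: hs.
  have h2 : `|tm (e t y)| < `|tm y| + 1 by near: t; exact: hb.
  rewrite -(subrK (tm (e t y)) (tm _)) (le_trans (ler_normD _ _)) //; lra.
have hSy : `|S - tm y| <= pi.
  have c : `|tm (e t (z t)) - tm (e t y)| - pi @[t --> U] --> `|S - tm y| - pi.
    exact: (cvgB (cvg_norm (cvgB hS hy)) (cvg_cst pi)).
  rewrite -subr_le0; apply: (@cvg_le0 _ _ U _ _ _ c); near=> t.
  by rewrite subr_le0 ltW //; near: t; exact: hs.
have hr := rr_id_limit zz.
have cE : cos (S - tm z') = 1.
  have h0 := @cvg_coord _ _ U 1 4 _ _ 0 0 hr; have h1 := @cvg_coord _ _ U 1 4 _ _ 0 1 hr.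
  have E0 w : rr w 0 0 = cos (tm w) by rewrite tm_crd; have [-> _ _ _] := rayE (crd w).
  have E1 w : rr w 0 1 = sin (tm w) by rewrite tm_crd; have [_ -> _ _] := rayE (crd w).
  have c0 := cvg_comp _ (@cos R) hS (@continuous_cos R S).
  have c1 := cvg_comp _ (@sin R) hS (@continuous_sin R S).
  have F0 : cos S = rr z' 0 0.
    apply: (@cvg_uniq _ _ U _ _ _ _ _ c0).
    by move: h0; under eq_fun do rewrite E0.
  have F1 : sin S = rr z' 0 1.
    apply: (@cvg_uniq _ _ U _ _ _ _ _ c1).
    by move: h1; under eq_fun do rewrite E1.
  by rewrite cosB F0 F1 -E0 -E1 -!expr2 rr_top.
suff <- : S = tm z' by [].
apply/eqP; rewrite -subr_eq0; apply/eqP; apply: cos_eq1 => //.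
rewrite -(subrK (tm y) S) -addrA (le_lt_trans (ler_normD _ _)) // (distrC (tm y)); lra.
Unshelve. all: by end_near. Qed.

End IdLimit.
End Seq.

(** * Convergence to the identity, finiteness and properness *)

Section Dyn.
Variable R : realType.
Variables (G : subgroup R) (L : set (cyl R)).
Implicit Types (z w l y : cyl R).
Hypothesis Le : L `<=` @ein R.
Hypothesis Lclosed : closed L.
Hypothesis La : achronal L.
Hypothesis Lnon : nonelementary L.
Hypothesis Gpres : preserves G L.

Let Lk : compact L := achronal_compact Lclosed La.

(** The empty set would lie in the lightcone of any boundary point. *)
Lemma L_nonempty : exists l, L l.
Proof.
apply: contrapT => h; apply: Lnon.2; exists (mk (delta_mx 0 0)); split; last first.
  by move=> l Ll; case: h; exists l.
rewrite /ein /= pt3E pt_mk !mxE /= shrink1; last by rewrite !mxE /= expr1n expr0n addr0.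
by rewrite mul1r mulr0 expr1n expr0n subrr subr0 sqrtr0.
Qed.

Lemma null_ray (a : 'rV[R]_4) : formQ a a = 0 -> a != 0 ->
  exists2 k : R, 0 < k & exists2 u : 'rV[R]_3, u 0 0 ^+ 2 + u 0 1 ^+ 2 = 1 & a = k *: ray u.
Proof.
move=> aa a0; have t0 : 0 < topn a by apply: topn_gt0 => //; rewrite aa.
have t2 := topn_sqr a; move: (topn a) t0 t2 => k k0 k2.
have kn0 : k != 0 by rewrite gt_eqF.
have [t [ct st]] : exists t : R, cos t = a 0 0 / k /\ sin t = a 0 1 / k.
  by apply: polar; rewrite !expr_div_n -mulrDl -k2 divff // expf_neq0.
exists k => //; have [u0 u1 u2] := row3E (a 0 (inord 2) / k) (a 0 (inord 3) / k) t.
exists (\row_(i < 3) [:: a 0 (inord 2) / k; a 0 (inord 3) / k; t]`_i).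
  rewrite u0 u1 !expr_div_n -mulrDl; apply: (mulIf (expf_neq0 2 kn0)).
  rewrite divfK ?expf_neq0 // mul1r k2; move: aa; rewrite /formQ !expr2; lra.
set u := \row_(i < 3) _ in u0 u1 u2 *; have [r0 r1 r2 r3] := rayE u.
apply/rowP; apply: ord4P; rewrite [RHS]mxE ?r0 ?r1 ?r2 ?r3 ?u0 ?u1 ?u2 ?ct ?st mulrC divfK //.
Qed.

(** Nondegeneracy comes from nonelementarity: a null vector orthogonal to the cone is, up to scale,
    a boundary ray with a lift whose future lightcone contains [L]. *)
Lemma limit_cone_L : limit_cone (linear_group G) (Lcone L).
Proof.
split.
- apply: compact_closed; first exact: norm_hausdorff.
  apply: continuous_compact Lk; apply: continuous_subspaceT; exact: rr_continuous.
- by move=> _ [l _ <-]; exact: rr_top.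
- move=> _ A [l Ll <-] [g Gg gA].
  have [_ _ /(_ A gA l)[k k0 kE]] := extensionP (subgroup_sub Gg).
  exists k^-1, (rr (extension g l)); split; first by rewrite invr_gt0.
    by exists (extension g l) => //; exact: (ext_L Gpres).
  by rewrite kE scalerA mulVf ?scale1r // gt_eqF.
- by move=> _ [l Ll <-]; apply: ein_top; exact: Le.
- by move=> _ _ [l Ll <-] [l' Ll' <-]; exact: (achronal_le0 Le La).
move=> a a0 aa; apply: contrapT => h; apply: Lnon.2.
have [k k0 [u u1 aE]] := null_ray aa a0; have [l0 L0] := L_nonempty.
apply: (future_lightcone_of_orthogonal Le La L0 u1) => l Ll; apply: contrapT => hq.
apply: h; exists (rr l); first by exists l.
by rewrite aE formQZl mulf_eq0 gt_eqF //=; apply/eqP.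
Qed.

Lemma invisible_rr z : between L z -> invisible (Lcone L) (rr z).
Proof. by move=> /(between_spatial _ Le Lk) h _ [l Ll <-]; have [] := h l Ll. Qed.

(** The default 0 is never taken on [SO22hat], by [linP]. *)
Definition lin (g : ads R -> ads R) : 'M[R]_4 := xget 0 [set A | linear_part g A].

Lemma linP g : SO22hat g -> linear_part g (lin g).
Proof. by move=> /SO22hat_linear[A [hA _ _ _]]; rewrite /lin; case: xgetP => [B _ //|/(_ A)]. Qed.

Section Id.
Variables (T : Type) (U : set_system T) (UU : UltraFilter U).
Variable (g : T -> ads R -> ads R).
Hypothesis hg : forall t, G (g t).
Hypothesis A1 : lin (g t) @[t --> U] --> (1%:M : 'M[R]_4).
Let e t := extension (g t).
Let hg' t : SO22hat (g t) := subgroup_sub (hg t).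
Let hA t : linear_part (g t) (lin (g t)) := linP (hg' t).
Let P y := tm (e t y) @[t --> U] --> tm y.

Let step y z : P y -> spatial z y -> P z.
Proof.
move=> hy hs.
have h := @tm_id_limit R T U UU g (fun t => lin (g t)) hg' hA A1 (fun=> z) y z 0 hy (cvg_cst z) hs.1.
apply: h; near=> t; have [] := spatial_ext (hg t) hs; exact.
Unshelve. all: by end_near.
Qed.

(** Achronality bounds the times of the images of [l]. Their limit is a point of the closed set [L]
    over the same boundary point, so achronality again makes it [l]. *)
Let base l : L l -> P l.
Proof.
move=> Ll; have [S hS] : exists S : R, tm (e t l) @[t --> U] --> S.
  apply: (@ultra_cvg_bounded _ _ U _ (`|tm l| + pi) UU); near=> t.
  by apply: (achronal_bounded La Ll); exact: (ext_L Gpres).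
have hr : rr (e t l) @[t --> U] --> rr l by exact: (rr_id_limit UU hg' hA A1 (cvg_cst l)).
have rS : rr l = rr (vert l S).
  have cE w : rr w 0 0 = cos (tm w) by rewrite tm_crd; have [-> _ _ _] := rayE (crd w).
  have sE w : rr w 0 1 = sin (tm w) by rewrite tm_crd; have [_ -> _ _] := rayE (crd w).
  have bE w i : (i == inord 2) || (i == inord 3) -> rr (vert w S) 0 i = rr w 0 i.
    have [_ _ v2 v3] := rayE (crd (vert w S)); have [_ _ w2 w3] := rayE (crd w).
    by case/orP => /eqP ->; rewrite /rr ?v2 ?v3 ?w2 ?w3 !mxE.
  apply/rowP; apply: ord4P; last 2 first.
  - by rewrite bE ?eqxx.
  - by rewrite bE ?eqxx ?orbT.
  - rewrite (cE (vert l S)) tm_vert; have h0 := @cvg_coord _ _ U 1 4 _ _ 0 0 hr.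
    apply: (@cvg_uniq _ _ U _ _ _ _ _ h0); have cc := cvg_comp _ (@cos R) hS (@continuous_cos R S).
    have E : (fun t => rr (e t l) 0 0) = @cos R \o (fun t => tm (e t l)) by apply/funext => t /=; rewrite cE.
    by rewrite E; exact: cc.
  - rewrite (sE (vert l S)) tm_vert; have h0 := @cvg_coord _ _ U 1 4 _ _ 0 1 hr.
    apply: (@cvg_uniq _ _ U _ _ _ _ _ h0); have cc := cvg_comp _ (@sin R) hS (@continuous_sin R S).
    have E : (fun t => rr (e t l) 0 1) = @sin R \o (fun t => tm (e t l)) by apply/funext => t /=; rewrite sE.
    by rewrite E; exact: cc.
have cw : e t l @[t --> U] --> vert l S by apply: cvg_rr => //; rewrite -rS.
have Lw : L (vert l S).
  apply: Lclosed; apply: (@filter_closure _ _ U _ (fun t => e t l)) => //.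
  by near=> t; exact: (ext_L Gpres).
have := La Lw Ll; rewrite pt_vert sdistxx; last exact: unit_pt.
by rewrite normr_le0 subr_eq0 tm_vert => /eqP Sl; rewrite /P -Sl; exact: hS.
Unshelve. all: by end_near. Qed.

Let axis_spatial z : spatial (to_cyl (axis (tm z))) z.
Proof.
have [a0 a1 at_] := axisE (tm z); split; first by rewrite at_ subrr normr0 pi_gt0.
by rewrite formQ_rr_bot a0 a1 at_ subrr cos0; lra.
Qed.

Let axis_step (s t : R) : `|s - t| <= 1 -> spatial (to_cyl (axis s)) (to_cyl (axis t)).
Proof.
move=> h; have [a0 a1 at_] := axisE s; have [b0 b1 bt_] := axisE t.
have p2 : 2 <= pi := pi_ge2 R.
split; first by rewrite at_ bt_; lra.
rewrite formQ_rr_bot a0 a1 at_ bt_ !mul0r addr0 sub0r oppr_lt0.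
have -> : cos (s - t) = cos `|s - t| by case: ger0P => _; rewrite ?cosN.
apply: lt_le_trans (cos1_gt0 R) _; apply: cos_le => //; lra.
Qed.

(** Convergence of times spreads along spatially related points: from a limit point to the axis,
    along the axis in steps of length at most 1, and from the axis to [y]. *)
Let all_id y : P y.
Proof.
have [l0 L0] := L_nonempty.
suff h : P (to_cyl (axis (tm y))) by apply: step h (spatialC (axis_spatial y)).
have h0 : P (to_cyl (axis (tm l0))) by apply: step (base L0) (axis_spatial l0).
have walk (s : R) (n : nat) : forall t : R, `|s - t| <= n%:R -> P (to_cyl (axis t)) -> P (to_cyl (axis s)).
  elim: n => [|n IH] t ht Pt.
    by have -> // : s = t by apply/eqP; rewrite -subr_eq0 -normr_le0.
  have [h1|h1] := leP `|s - t| 1; first exact: step Pt (axis_step h1).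
  pose r := t + (s - t) / `|s - t|.
  have n0 : `|s - t| != 0 by rewrite gt_eqF //; lra.
  apply: (IH r); last first.
    apply: step Pt (axis_step _).
    by rewrite /r addrAC subrr add0r normrM normfV normr_id divff.
  have -> : s - r = (s - t) * (1 - `|s - t|^-1) by rewrite /r; field.
  rewrite normrM [X in _ * X]ger0_norm; last by rewrite subr_ge0 invf_le1 ?ltW //; lra.
  by rewrite mulrBr mulr1 divff //; move: ht; rewrite -natr1; lra.
apply: (walk _ (Num.Def.archi_bound `|tm y - tm l0|) (tm l0)) => //.
by apply: ltW; apply: archi_boundP.
Qed.

Lemma id_limit (z : T -> ads R) (z' : ads R) : z @ U --> z' -> g t (z t) @[t --> U] --> z'.
Proof.
move=> zz; have zc := cvg_comp z (@to_cyl R) zz (@to_cyl_continuous R z').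
have sz : spatial (to_cyl z') (to_cyl z').
  split; first by rewrite subrr normr0 pi_gt0.
  rewrite formQ_rr_self oppr_lt0 exprn_gt0 //.
  exact: (set_valP z').
have near_sp : \forall t \near U, spatial (to_cyl (z t)) (to_cyl z').
  have [[B C] /= [Bz Cz] BC] := spatial_near sz.
  apply: (@filterS _ U _ _ _ _ (zc B Bz)) => t Bt.
  by apply: (BC (to_cyl (z t), to_cyl z')); split=> //; exact: nbhs_singleton.
have ht : tm (e t (to_cyl (z t))) @[t --> U] --> tm (to_cyl z').
  have h := @tm_id_limit R T U UU g (fun t => lin (g t)) hg' hA A1 _ _ _ 0 (@all_id (to_cyl z')) zc sz.1.
  by apply: h; apply: filterS near_sp => t st; have [] := spatial_ext (hg t) st.
have hr : rr (e t (to_cyl (z t))) @[t --> U] --> rr (to_cyl z') by exact: (rr_id_limit UU hg' hA A1 zc).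
apply: (@cvg_ads _ _ U _ (fun t => g t (z t)) z').
have E : (fun t => to_cyl (g t (z t))) = (fun t => e t (to_cyl (z t))).
  by apply/funext => t; have [_ E _] := extensionP (hg' t); rewrite /e E.
by rewrite E; exact: (@cvg_rr R T U _ (fun t => e t (to_cyl (z t))) (to_cyl z') hr ht).
Qed.

End Id.

Hypothesis Gdisc : discrete G.

(** Transfers discreteness from the compact-open topology to matrices: by [id_limit], elements whose
    matrices tend to 1 tend to the identity in that topology. *)
Lemma near_id : exists2 d : R, 0 < d & forall g, G g ->
  (forall i j, `|lin g i j - (1%:M : 'M[R]_4) i j| < d) -> g = id.
Proof.
pose B (d : R) := [set g : {compact-open, ads R -> ads R} | G g /\
  forall i j, `|lin g i j - (1%:M : 'M[R]_4) i j| < d].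
pose F := filter_from [set d : R | 0 < d] B.
have FF : Filter F.
  apply: filter_from_filter; first by exists 1; exact: ltr01.
  move=> a b /= a0 b0; exists (Num.min a b); first by rewrite /= lt_min a0.
  by move=> g [Gg h]; split; split=> // i j; have := h i j; rewrite lt_min => /andP[].
have Fid : F --> (id : {compact-open, ads R -> ads R}).
  apply/compact_open_cvgP => K O cK oO KO; apply: contrapT => hF.
  (* A failure for some compact [K] and open [O] gives elements with matrices tending to 1 that send
     points of [K] outside [O]. *)
  have bad n : exists p : (ads R -> ads R) * ads R,
      [/\ G p.1, forall i j, `|lin p.1 i j - (1%:M : 'M[R]_4) i j| < n.+1%:R^-1, K p.2 & ~ O (p.1 p.2)].
    apply: contrapT => hn; apply: hF; exists n.+1%:R^-1; first by rewrite /= invr_gt0 ltr0n.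
    move=> g [Gg hgn] _ [z Kz <-]; apply: contrapT => nO; apply: hn; exists (g, z); split=> //.
  pose p n := sval (cid (bad n)); have hp n := svalP (cid (bad n)).
  have [U [UU sU]] := ultraFilterLemma (@eventually_filter).
  have A1 : lin (p n).1 @[n --> U] --> (1%:M : 'M[R]_4).
    apply: cvg_mxP => i j; apply: (@cvg_trans _ (lin (p n).1 i j @[n --> \oo])).
      by move=> W hW; exact: sU.
    apply/cvgrPdist_lt => ep ep0.
    have := @cvg_harmonic R => /cvgrPdist_lt/(_ ep ep0); apply: filterS => n.
    rewrite sub0r normrN => hn; rewrite distrC.
    have [_ h _ _] := hp n; apply: lt_trans (h i j) _; apply: le_lt_trans hn; exact: ler_norm.
  have [z [Kz Uz]] : exists z : ads R, K z /\ (fun n => (p n).2) @ U --> z.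
    have hK n : K (p n).2 by have [] := hp n.
    have UK : U (fun n => K (p n).2).
      by exact: (@filterS nat U _ _ _ (fun n _ => hK n) (@filterT nat U _)).
    move: cK; rewrite compact_ultra => cK.
    by have [z [Kz hz]] := cK _ (ultra_fmap (fun n => (p n).2) UU) UK; exists z.
  have hG n : G (p n).1 by have [] := hp n.
  have := @id_limit nat U UU (fun n => (p n).1) hG A1 (fun n => (p n).2) z Uz.
  have Oz : nbhs z O by apply: open_nbhs_nbhs; split=> //; apply: KO; exists z.
  move=> /(_ O Oz) hO; have hO' : U (fun n => O ((p n).1 (p n).2)) by exact: hO.
  have [n hn] := filter_ex hO'.
  by have [_ _ _] := hp n; apply.
have [_ [V Vid VG]] := Gdisc (subgroup_id G).
have [d d0 dV] := Fid V Vid; exists d => // g Gg hd.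
have : (V `&` [set g : {compact-open, ads R -> ads R} | G g]) g by split=> //; exact: dV.
by rewrite VG.
Qed.

Definition msize (A : 'M[R]_4) : R := \sum_i \sum_j `|A i j|.

Lemma le_msize (A : 'M[R]_4) i j : `|A i j| <= msize A.
Proof.
rewrite /msize (bigD1 i) //= (bigD1 j) //= -addrA lerDl addr_ge0 ?sumr_ge0 // => k _.
by rewrite sumr_ge0.
Qed.

Lemma msizeZ (c : R) (A : 'M[R]_4) : msize (c *: A) = `|c| * msize A.
Proof.
rewrite /msize mulr_sumr; apply: eq_bigr => i _; rewrite mulr_sumr; apply: eq_bigr => j _.
by rewrite mxE normrM.
Qed.

Lemma cvg_msize (T : Type) (F : set_system T) {FF : Filter F} (f : T -> 'M[R]_4) (A : 'M[R]_4) :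
  f @ F --> A -> msize (f t) @[t --> F] --> msize A.
Proof.
move=> h; apply: (@cvg_sumr _ _ F _ 4 (fun i t => \sum_j `|f t i j|)) => i.
apply: (@cvg_sumr _ _ F _ 4 (fun j t => `|f t i j|)) => j.
exact: cvg_norm (@cvg_coord _ _ F 4 4 f A i j h).
Qed.

Lemma cofinite_ultra (T : Type) (S : set T) : ~ finite_set S ->
  exists U : set_system T, [/\ UltraFilter U, U S & forall B, finite_set B -> U (~` B)].
Proof.
move=> infS; pose F := filter_from [set B : set T | finite_set B] (fun B => S `\` B).
have FF : Filter F.
  apply: filter_from_filter; first by exists set0; exact: finite_set0.
  move=> B C fB fC; exists (B `|` C); first by rewrite /= finite_setU.
  by move=> x [Sx nBC]; split; split=> // h; apply: nBC; [left|right].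
have PF : ProperFilter F.
  apply: filter_from_proper => B fB; apply/set0P/negP => /eqP h; apply: infS.
  apply: sub_finite_set fB => x Sx; apply: contrapT => nB.
  by have : (S `\` B) x by []; rewrite h.
have [U [UU sU]] := ultraFilterLemma PF; exists U; split=> //.
- by apply: sU; exists set0; [exact: finite_set0|move=> x []].
- by move=> B fB; apply: sU; exists B => // x [].
Qed.

(** Along a nonprincipal ultrafilter the matrices converge, so two distinct elements [g], [h] would
    have [lin g] times the inverse of [lin h] close to 1, against [near_id]. *)
Lemma bounded_finite (M : R) : finite_set [set g | G g /\ msize (lin g) <= M].
Proof.
apply: contrapT => /cofinite_ultra[U [UU US Uc]].
have [B hB] : exists B : 'M[R]_4, lin @ U --> B.
  apply: (@ultra_cvg_mx _ _ U 4 4 lin M UU); apply: filterS US => g [_ h] i j.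
  exact: le_trans (le_msize _ _ _) h.
have hO := SO22_like_group G.
have LG g : G g -> linear_group G (lin g) by move=> Gg; exists g => //; exact: linP (subgroup_sub Gg).
have BB : B *m adjQ B = 1%:M.
  have h : lin g *m adjQ (lin g) @[g --> U] --> B *m adjQ B by exact: (cvg_mulmx hB (cvg_adjQ hB)).
  have h2 : lin g *m adjQ (lin g) @[g --> U] --> (1%:M : 'M[R]_4).
    apply: (@cvg_trans _ (cst (1%:M : 'M[R]_4) @ U)); last exact: cvg_cst.
    apply: near_eq_cvg; apply: filterS US => g [Gg _] /=.
    by rewrite (AA_orth hO) //; exact: LG.
  exact: (@cvg_uniq _ _ U _ _ _ _ _ h h2).
have [d d0 hd] := near_id.
have near_d (f : (ads R -> ads R) -> 'M[R]_4) (C : 'M[R]_4) : f @ U --> C ->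
    (forall i j, `|C i j - (1%:M : 'M[R]_4) i j| < d) ->
    \forall g \near U, forall i j, `|f g i j - (1%:M : 'M[R]_4) i j| < d.
  move=> hf hC.
  have h ij : \forall g \near U, `|f g ij.1 ij.2 - (1%:M : 'M[R]_4) ij.1 ij.2| < d.
    have c : `|f g ij.1 ij.2 - (1%:M : 'M[R]_4) ij.1 ij.2| @[g --> U] -->
        `|C ij.1 ij.2 - (1%:M : 'M[R]_4) ij.1 ij.2|.
      exact: (cvg_norm (cvgB (@cvg_coord _ _ U 4 4 f C ij.1 ij.2 hf) (cvg_cst ((1%:M : 'M[R]_4) ij.1 ij.2)))).
    exact: (cvgr_lt _ c _ (hC ij.1 ij.2)).
  have h' : \forall g \near U, forall ij : 'I_4 * 'I_4, `|f g ij.1 ij.2 - (1%:M : 'M[R]_4) ij.1 ij.2| < d.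
    exact: filter_forall.
  by apply: filterS h' => g hh i j; exact: (hh (i, j)).
have c1 : lin g *m adjQ B @[g --> U] --> (1%:M : 'M[R]_4).
  by rewrite -BB; apply: cvg_mulmx hB (cvg_cst _).
have n1 := near_d _ _ c1 (_ : forall i j, `|(1%:M : 'M[R]_4) i j - (1%:M : 'M[R]_4) i j| < d).
have {}n1 := n1 (fun i j => ltac:(rewrite subrr normr0; exact: d0)).
have [g [hg1 [Gg _]]] := filter_ex (filterI n1 US).
have c2 : lin g *m adjQ (lin h) @[h --> U] --> lin g *m adjQ B.
  exact: cvg_mulmx (cvg_cst _) (cvg_adjQ hB).
have n2 := near_d _ _ c2 hg1.
have ng : U (~` [set g]) by apply: Uc; exact: finite_set1.
have [h [[hh [Gh _]] hne]] := filter_ex (filterI (filterI n2 US) ng).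
apply: hne; have [h' [Gh' hK h'K]] := subgroup_inv Gh.
have Gc : G (h' \o g) by exact: subgroup_comp.
have lE : lin (h' \o g) = lin g *m adjQ (lin h).
  apply: linear_part_uniq (linP (subgroup_sub Gc)) _; apply: linear_part_comp.
    exact: (linear_part_inv Gh Gh' hK h'K (linP (subgroup_sub Gh))).
  exact: linP (subgroup_sub Gg).
have E : h' \o g = id by apply: hd => // i j; rewrite lE; exact: hh.
apply/funext => z; have := congr1 (fun f => h (f z)) E; rewrite /= h'K.
by [].
Qed.

(** Normalizing by the sum of the absolute values of the entries keeps the limit nonzero. *)
Lemma escape (T : Type) (U : set_system T) (UU : UltraFilter U) (g : T -> ads R -> ads R) :
  (\forall t \near U, G (g t)) -> (forall M : R, \forall t \near U, M < msize (lin (g t))) ->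
  exists B, [/\ SS (linear_group G) B, B != 0 & exists c : T -> R,
    [/\ c @ U --> (0 : R), \forall t \near U, 0 < c t & c t *: lin (g t) @[t --> U] --> B]].
Proof.
move=> hG hM; pose c t := (msize (lin (g t)))^-1.
have c0 : \forall t \near U, 0 < c t by apply: filterS (hM 0) => t h; rewrite invr_gt0.
have s1 : \forall t \near U, msize (c t *: lin (g t)) = 1.
  apply: filterS c0 => t h; rewrite msizeZ gtr0_norm // /c mulVf //.
  by rewrite -invr_eq0 gt_eqF.
have [B hB] : exists B : 'M[R]_4, c t *: lin (g t) @[t --> U] --> B.
  apply: (@ultra_cvg_mx _ _ U 4 4 _ 1 UU); apply: filterS s1 => t <- i j; exact: le_msize.
have cc : c @ U --> (0 : R).
  apply/cvgrPdist_lt => e e0; apply: filterS (hM e^-1) => t h.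
  rewrite sub0r normrN gtr0_norm; last by rewrite invr_gt0 (lt_trans _ h) // invr_gt0.
  by rewrite /c invf_plt ?posrE // (lt_trans _ h) // invr_gt0.
exists B; split.
- apply: (@SS_intro _ _ _ U _ (fun t => lin (g t)) c B) => //.
  apply: filterS (filterI hG c0) => t [Gg ct]; split=> //.
  by exists (g t) => //; exact: linP (subgroup_sub Gg).
- apply/eqP => B0; have : msize (c t *: lin (g t)) @[t --> U] --> msize B by exact: cvg_msize.
  have -> : msize B = 0 by rewrite B0 /msize big1 // => i _; rewrite big1 // => j _; rewrite mxE normr0.
  move=> h; have h2 : msize (c t *: lin (g t)) @[t --> U] --> (1 : R).
    apply: (@cvg_trans _ (cst (1 : R) @ U)); last exact: cvg_cst.
    by apply: near_eq_cvg; apply: filterS s1 => t ->.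
  have E01 : (0 : R) = 1 by exact: (@cvg_uniq _ _ U _ _ _ _ _ h h2).
  by move/eqP: E01; rewrite eq_sym oner_eq0.
- by exists c.
Qed.

(** Treats both domains at once, in the closed cylinder. If infinitely many elements bring [K] back,
    points [x g] and their images converge to invisible [p] and [q], and the rescaled limit maps the
    ray of [p] to a nonnegative multiple of that of [q]. *)
Lemma proper_between (K : set (cyl R)) : compact K -> (forall z, K z -> between L z) ->
  finite_set [set g | G g /\ (extension g @` K) `&` K !=set0].
Proof.
move=> cK bK; apply: contrapT => /cofinite_ultra[U [UU US Uc]].
have hM (M : R) : \forall g \near U, M < msize (lin g).
  have h := Uc _ (bounded_finite M); apply: filterS (filterI US h) => g [[Gg _] /= nb].
  by rewrite ltNge; apply/negP => le; apply: nb.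
have [B [sB B0 [c [c0 cp cB]]]] := @escape _ U UU id (filterS (fun g (h : G g /\ _) => h.1) US) hM.
have [g0 [Gg0 [z0 [_ Kz0]]]] := filter_ex US.
(* [z0] is a default for the elements that do not bring [K] back. *)
have pick g : exists z, G g /\ (extension g @` K) `&` K !=set0 -> K z /\ K (extension g z).
  have [[Gg [_ [[z Kz <-] Kgz]]]|h] := pselect (G g /\ (extension g @` K) `&` K !=set0).
    by exists z.
  by exists z0 => /h.
pose x g := sval (cid (pick g)); have hx g := svalP (cid (pick g)).
have lim (f : (ads R -> ads R) -> cyl R) : (\forall g \near U, K (f g)) -> exists2 p, K p & f @ U --> p.
  move=> hf; move: cK; rewrite compact_ultra => /(_ _ (ultra_fmap f UU) hf)[p [Kp fp]].
  by exists p.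
have [p Kp xp] := lim x (filterS (fun g h => (hx g h).1) US).
have [q Kq xq] := lim (fun g => extension g (x g)) (filterS (fun g h => (hx g h).2) US).
have r1 := cvg_comp x (@rr R) xp (@rr_continuous R p).
have r2 := cvg_comp (fun g => extension g (x g)) (@rr R) xq (@rr_continuous R q).
have h1 : rr (x g) *m (c g *: lin g) @[g --> U] --> rr p *m B by exact: cvg_mulmx r1 cB.
have h0 : topn (rr (x g) *m (c g *: lin g)) @[g --> U] --> topn (rr p *m B) by exact: cvg_topn.
have h2 := @cvg_scalemx _ _ U _ _ _ _ _ _ _ h0 r2.
apply: (invisible_image_not_invisible (SO22_like_group G) limit_cone_L
  (invisible_rr (bK _ Kp)) (invisible_rr (bK _ Kq)) sB B0 (topn_ge0 (rr p *m B))).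
suff h3 : rr (x g) *m (c g *: lin g) @[g --> U] --> topn (rr p *m B) *: rr q.
  exact: (@cvg_uniq _ _ U _ _ _ _ _ h1 h3).
apply: (@cvg_trans _ ((fun g => topn (rr (x g) *m (c g *: lin g)) *: rr (extension g (x g))) @ U)); last exact: h2.
apply: near_eq_cvg; apply: filterS (filterI US cp) => g [[Gg _] cg] /=.
have [-> t0] := rr_extension (x g) (subgroup_sub Gg) (linP (subgroup_sub Gg)).
rewrite -scalemxAr topnZ gtr0_norm // scalerA -mulrA divff ?mulr1 //.
by rewrite gt_eqF.
Qed.

End Dyn.

(** * Freeness, and lifting causal relations from the quotient *)

Section Final.
Variable R : realType.
Variables (G : subgroup R) (L : set (cyl R)).
Hypothesis Le : L `<=` @ein R.
Hypothesis Lclosed : closed L.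
Hypothesis La : achronal L.
Hypothesis Lnon : nonelementary L.
Hypothesis Gpres : preserves G L.
Hypothesis Gdisc : discrete G.
Hypothesis Gtf : torsion_free G.

Let Lk : compact L := achronal_compact Lclosed La.
Let PD := proper_between Le Lclosed La Lnon Gpres Gdisc.

Lemma iter_mem g n : G g -> G (iter n g).
Proof.
move=> Gg; elim: n => [|n IH]; first exact: subgroup_id.
exact: (subgroup_comp Gg IH).
Qed.

Lemma iter_inj g : G g -> g <> id -> injective (fun n => iter n g : ads R -> ads R).
Proof.
move=> Gg gid; suff h n m : (n < m)%N -> iter n g = iter m g -> False.
  move=> n m E; have [lt|lt|//] := ltngtP n m; first by case: (h n m lt E).
  by case: (h m n lt (esym E)).
move=> lt E; apply: gid; apply: (Gtf (n := (m - n)%N) Gg); first by rewrite subn_gt0.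
have [h [Gh hK _]] := subgroup_inv (iter_mem n Gg).
apply/funext => z; apply: (can_inj hK); rewrite -iterD subnKC ?(ltnW lt) //.
by rewrite -E.
Qed.

(** All powers of [g] fix [x]; without torsion they are infinitely many, against properness for the
    one-point set. *)
Lemma free_between g x : G g -> between L x -> extension g x = x -> g = id.
Proof.
move=> Gg bx gx; apply: contrapT => gid.
have bK z : [set x] z -> between L z by move=> ->.
have fS := PD (@compact_set1 _ x) bK.
have sub : range (fun n => iter n g : ads R -> ads R) `<=`
    [set g | G g /\ (extension g @` [set x]) `&` [set x] !=set0].
  move=> _ [n _ <-]; split; first exact: iter_mem.
  exists x; split=> //; exists x => //; elim: n => [|n IH]; first by rewrite extension_id.
  have -> : iter n.+1 g = g \o iter n g by [].
  by rewrite (extension_comp Gg (iter_mem n Gg)) /= IH.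
have fr := sub_finite_set sub fS; apply: infinite_nat.
have e := @inj_card_eq _ _ [set: nat] _ (in2W (iter_inj Gg gid)).
by rewrite -(eq_finite_set e).
Qed.

Lemma free_Omega : free_action G (@extension R) (Omega L).
Proof. by move=> g x Gg [_ bx]; exact: free_between. Qed.

Lemma proper_Omega : properly_discontinuous G (@extension R) (Omega L).
Proof. by move=> K KO cK; apply: PD => // z /KO[]. Qed.

Lemma free_Edom : free_action G id (Edom L).
Proof.
move=> g x Gg bx gx; apply: (free_between Gg bx).
by have [_ -> _] := extensionP (subgroup_sub Gg); congr to_cyl.
Qed.

Lemma proper_Edom : properly_discontinuous G id (Edom L).
Proof.
move=> K KE cK.
have cK' : compact (@to_cyl R @` K).
  apply: continuous_compact cK; apply: continuous_subspaceT; exact: to_cyl_continuous.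
have bK z : (@to_cyl R @` K) z -> between L z by move=> [w Kw <-]; exact: KE.
apply: sub_finite_set (PD cK' bK) => g [Gg [_ [[z Kz <-] Kgz]]]; split=> //.
have [_ e _] := extensionP (subgroup_sub Gg).
exists (to_cyl (g z)); split; last by exists (g z).
by exists (to_cyl z); [exists z|exact: e].
Qed.

Lemma quot_projP (z w : Etype L) :
  quot_proj G z = quot_proj G w <-> exists2 g, G g & g (to_ads z) = to_ads w.
Proof.
split=> [h|h].
  by have /asboolP := introT (eqmodP (orbit_rel G L) z w) h.
by apply: (elimT (eqmodP (orbit_rel G L) z w)); apply/asboolP.
Qed.

Lemma quot_proj_surj (x : Mquot G L) : exists z : Etype L, quot_proj G z = x.
Proof. by exists (repr x); exact: reprK. Qed.

Lemma to_ads_continuous : continuous (@to_ads R L).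
Proof. exact: set_val_continuous. Qed.

Lemma to_ads_inj : injective (@to_ads R L).
Proof. exact: val_inj. Qed.

Lemma quot_proj_open (W : set (Etype L)) : open W -> open (@quot_proj R G L @` W).
Proof.
move=> oW; rewrite /open /= /quotient_open openE => z [w Ww E].
have /quot_projP[g Gg gz] : quot_proj G z = quot_proj G w by rewrite E.
pose gE (z : Etype L) : Etype L :=
  SigSub (mem_set (Edom_stable Le Lclosed La Gpres Gg (set_valP z))).
have gEc : continuous gE.
  move=> z'; apply: (@cvg_set_type _ (Edom L) _ (nbhs z') _ gE (gE z')).
  have c1 := @SO22hat_continuous R g (subgroup_sub Gg) (to_ads z').
  have c2 := cvg_comp (@to_ads R L) g (@to_ads_continuous z') c1.
  exact: c2.
have gEz : gE z = w by apply: to_ads_inj; exact: gz.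
have nW : nbhs (gE z) W by rewrite gEz; exact: open_nbhs_nbhs.
have nz : nbhs z (fun z' => W (gE z')) by exact: (gEc z W nW).
have FF : Filter (nbhs z) by exact: nbhs_filter.
apply: (@filterS _ _ FF _ _ _ nz) => z' Wz'; exists (gE z') => //.
by apply/esym/quot_projP; exists g.
Qed.

Lemma quot_proj_continuous : continuous (@quot_proj R G L).
Proof. exact: pi_continuous. Qed.

Lemma Edom_open (z : Etype L) : exists2 V : set 'rV[R]_3, nbhs (chart (to_ads z)) V &
  forall u, V u -> chart_dom u /\ Edom L (mka u).
Proof.
have hz : forall l, L l -> spatial (to_cyl (to_ads z)) l.
  by apply/(between_spatial _ Le Lk); exact: (set_valP z).
have hu := chart_domP (to_ads z).
have e : mk (chart (to_ads z)) = to_cyl (to_ads z) by exact: mk_crd.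
have c1 : mk u @[u --> chart (to_ads z)] --> to_cyl (to_ads z) by rewrite -e; exact: mk_continuous.
have n1 := c1 _ (spatial_all_open Lk hz); have n2 := near_dom hu.
exists ([set u | chart_dom u] `&` [set u | forall l, L l -> spatial (mk u) l]).
  by apply: filterI.
move=> u [du su]; split=> //; apply/(between_spatial _ Le Lk).
by rewrite -[to_cyl _]mk_crd -chartE chart_mka.
Qed.

(** Requiring causality of all images makes the relation stable under the group by definition, as
    needed when local lifts are matched by group elements. Timelike curves satisfy it because
    isometries preserve them. *)
Definition Jinf (z w : ads R) := forall g, G g -> causal_le (to_cyl (g z)) (to_cyl (g w)).

Lemma Jinf_trans w z x : Jinf z w -> Jinf w x -> Jinf z x.
Proof. by move=> h1 h2 g Gg; exact: causal_trans (h1 g Gg) (h2 g Gg). Qed.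

Lemma Jinf_stable g z w : G g -> Jinf z w -> Jinf (g z) (g w).
Proof. by move=> Gg h f Gf; exact: (h (f \o g) (subgroup_comp Gf Gg)). Qed.

Lemma Jinf_curve (l : R -> ads R) (s r : R) : s <= r ->
  (forall t : R, s <= t <= r -> derivable (@chart R \o l) t 1 /\
     future_timelike (chart (l t)) (derive1 (@chart R \o l) t)) -> Jinf (l s) (l r).
Proof.
move=> sr h g Gg; have [[[[F [gF sF]] _] _] _ time] := subgroup_sub Gg.
apply: (@causal_curve R (fun t => to_cyl (g (l t))) s r sr) => t ht.
have [d ft] := h t ht; have hu := chart_domP (l t).
have dk : differentiable (@chart R \o l) t by apply/derivable1_diffP.
have dF : differentiable F ((@chart R \o l) t) by have [/(_ _ hu)] := sF 1%N.
have E : @crd R \o (fun t => to_cyl (g (l t))) = F \o (@chart R \o l).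
  by apply/funext => x /=; rewrite gF.
have dFk := differentiable_comp dk dF.
split; first by rewrite -chartE; exact: chart_domP.
  by rewrite E; apply/derivable1_diffP.
have -> : derive1 (@crd R \o (fun t => to_cyl (g (l t)))) t = 'd F (chart (l t)) (derive1 (@chart R \o l) t).
  rewrite E derive1E (deriveE _ dFk) (diff_comp dk dF) /= derive1E (deriveE _ dk).
  by [].
by rewrite -chartE -gF; exact: time.
Qed.

(** A local lift can be moved by the group to start at any given point over its start, and the
    resulting relations compose along the interval. *)
Lemma future_lift (x y : Mquot G L) (z : Etype L) : quot_proj G z = x -> future x y ->
  exists2 w, quot_proj G w = y & Jinf (to_ads z) (to_ads w).
Proof.
move=> zx [c [a [b [ab hc ca cb]]]].
pose P (s r : R) := forall z : Etype L, quot_proj G z = c s ->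
  exists2 w : Etype L, quot_proj G w = c r & Jinf (to_ads z) (to_ads w).
suff h : P a b by rewrite -cb; apply: h; rewrite ca.
apply: (interval_chain (ltW ab)).
  move=> s t r h1 h2 z' hz; have [w hw J1] := h1 z' hz; have [w' hw' J2] := h2 w hw.
  by exists w' => //; exact: Jinf_trans J1 J2.
move=> t ht; have [e [l [e0 hl]]] := hc t ht; exists e => // s r as_ sr rb hs hr z' hz.
have [_ _ _ cs] := hl s hs; have [_ _ _ cr] := hl r hr.
rewrite cs in hz; last by rewrite as_ (le_trans sr).
have /quot_projP[g Gg gz] := esym hz.
have [h [Gh gK hK]] := subgroup_inv Gg.
pose w : Etype L := SigSub (mem_set (Edom_stable Le Lclosed La Gpres Gg (set_valP (l r)))).
exists w; first by rewrite cr ?(le_trans as_) //; apply/esym/quot_projP; exists g.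
suff J : Jinf (to_ads (l s)) (to_ads (l r)) by rewrite -gz; exact: (Jinf_stable Gg J).
apply: (@Jinf_curve (fun t => to_ads (l t)) s r sr) => q /andP[q1 q2].
have hq : `|q - t| < e.
  move: hs hr; rewrite !real_ltr_norml ?num_real // => /andP[h1 h2] /andP[h3 h4].
  by apply/andP; split; lra.
by have [h1 _ h3 _] := hl q hq.
Qed.

End Final.

(** * Perturbation of timelike curves *)

Section Bump.
Variable R : realType.

Lemma is_derive_sqr_sign (y : R) : is_derive y (1 : R) (fun y : R => y * `|y|) (2 * `|y|).
Proof.
have sq : is_derive y (1 : R) (fun x : R => x * x) (2 * y).
  by apply: is_derive_eq; rewrite /GRing.scale /=; ring.
have [y0|y0|->] := ltgtP y 0.
- have nsq : is_derive y (1 : R) (fun x : R => - (x * x)) (- (2 * y)) by exact: is_deriveN sq.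
  rewrite ltr0_norm // mulrN; apply: near_eq_is_derive nsq.
  have nn : nbhs y (fun x : R => x < 0) by exact: (@cvgr_lt _ _ (nbhs y) _ id y cvg_id 0 y0).
  have FF : Filter (nbhs y) by exact: nbhs_filter.
  apply: (@filterS _ _ FF _ _ _ nn) => x /= x0.
  by rewrite ltr0_norm // mulrN.
- rewrite gtr0_norm //; apply: near_eq_is_derive sq.
  have nn : nbhs y (fun x : R => 0 < x) by exact: (@cvgr_gt _ _ (nbhs y) _ id y cvg_id 0 y0).
  have FF : Filter (nbhs y) by exact: nbhs_filter.
  apply: (@filterS _ _ FF _ _ _ nn) => x /= x0.
  by rewrite gtr0_norm.
rewrite normr0 mulr0.
have c : (fun h : R => h^-1 *: ((h *: (1 : R) + 0) * `|h *: (1 : R) + 0| - 0 * `|0 : R|)) h @[h --> (0 : R)^'] --> (0 : R).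
  apply: (@cvg_trans _ ((fun h : R => `|h|) @ (0 : R)^')).
    apply: near_eq_cvg; near=> h.
    have h0 : h != 0 by near: h; exact: nbhs_dnbhs_neq.
    by rewrite /GRing.scale /= mulr1 addr0 mul0r subr0 mulrA mulVf // mul1r.
  have : (fun h : R => `|h|) h @[h --> (0 : R)] --> `|0 : R| by apply: cvg_norm; exact: cvg_id.
  by rewrite normr0; apply: cvg_trans; apply: cvg_app; exact: cvg_within.
by apply: DeriveDef; [exact: (cvgP _ c)|exact: (cvg_lim (@norm_hausdorff _ _) c)].
Unshelve. all: by end_near. Qed.

(** The square of the positive part of [1 + m * (s - a)]: a [C^1] function equal to 1 at [a] that
    vanishes, on one side, beyond distance the inverse of the modulus of [m]. *)
Definition bump (a m s : R) : R := (fun y => (y * `|y| + y * y) / 2) (1 + m * (s - a)).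
Definition dbump (a m s : R) : R := (`|1 + m * (s - a)| + (1 + m * (s - a))) * m.

Lemma is_derive_bump (a m s : R) : is_derive s (1 : R) (bump a m) (dbump a m s).
Proof.
pose y (s : R) := 1 + m * (s - a).
have dy : is_derive s (1 : R) y m.
  by apply: is_derive_eq; rewrite /GRing.scale /=; ring.
have d1 := @is_derive1_comp R (fun y : R => y * `|y|) y s _ _ (is_derive_sqr_sign (y s)) dy.
have sq : is_derive (y s) (1 : R) (fun x : R => x * x) (2 * y s).
  by apply: is_derive_eq; rewrite /GRing.scale /=; ring.
have d2 := @is_derive1_comp R (fun x : R => x * x) y s _ _ sq dy.
have -> : bump a m = (2^-1 : R) *: (((fun y : R => y * `|y|) \o y) + ((fun x : R => x * x) \o y)).
  by apply/funext => x; rewrite /bump !fctE /GRing.scale /= mulrC.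
apply: is_derive_eq (is_deriveZ _ (is_deriveD d1 d2)) _.
by rewrite /GRing.scale /= /dbump -/(y s); field.
Qed.

Lemma dbump_continuous (a m : R) : continuous (dbump a m).
Proof.
move=> s; have c : (fun s : R => 1 + m * (s - a)) x @[x --> s] --> 1 + m * (s - a).
  exact: (cvgD (cvg_cst (1 : R)) (cvgM (cvg_cst m) (cvgB cvg_id (cvg_cst a)))).
exact: (cvgM (cvgD (cvg_norm c) c) (cvg_cst m)).
Qed.

Lemma bump_continuous (a m : R) : continuous (bump a m).
Proof. by move=> s; apply: differentiable_continuous; apply/derivable1_diffP; exact: derivable_of (is_derive_bump a m s). Qed.

Lemma bump_eq0 (a m s : R) : 1 + m * (s - a) <= 0 -> bump a m s = 0.
Proof. by move=> h; rewrite /bump ler0_norm // mulrN addNr mul0r. Qed.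

Lemma bump_eq1 (a m : R) : bump a m a = 1.
Proof. by rewrite /bump subrr mulr0 addr0 normr1 mulr1; field. Qed.

Lemma interval_near (s t e : R) : `|s - t| < e -> \forall x \near s, `|x - t| < e.
Proof.
move=> h; have c : `|x - t| @[x --> s] --> `|s - t| by exact: (cvg_norm (cvgB cvg_id (cvg_cst t))).
exact: (cvgr_lt _ c _ h).
Qed.

(** A positive factor clears the denominators, so openness of the condition follows from continuity
    of polynomials. *)
Lemma future_timelikeE (u v : 'rV[R]_3) : chart_dom u ->
  (1 - u 0 0 ^+ 2 - u 0 1 ^+ 2) * (v 0 0 ^+ 2 + v 0 1 ^+ 2 - v 0 ord_max ^+ 2)
    + (u 0 0 * v 0 0 + u 0 1 * v 0 1) ^+ 2 < 0 /\ 0 < v 0 ord_max <-> future_timelike u v.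
Proof.
move=> hu; rewrite /future_timelike metricE // formQ_dX //.
have s2 := sgm2 hu; have s0 : 0 < sgm u ^+ 2 by rewrite exprn_gt0 // sgm_gt0.
have -> : sgm u ^+ 4 = sgm u ^+ 2 * sgm u ^+ 2 by rewrite -exprD.
move: (sgm u ^+ 2) (1 - _ - _) (u 0 0 * _ + _) s2 s0 => S D a s2 S0.
have -> : S * (v 0 0 * v 0 0 + v 0 1 * v 0 1 - v 0 ord_max * v 0 ord_max) + S * S * a * a =
  S ^+ 2 * (D * (v 0 0 ^+ 2 + v 0 1 ^+ 2 - v 0 ord_max ^+ 2) + a ^+ 2).
  transitivity (S * (S * D) * (v 0 0 ^+ 2 + v 0 1 ^+ 2 - v 0 ord_max ^+ 2) + S ^+ 2 * a ^+ 2); last by ring.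
  by rewrite s2; ring.
by rewrite pmulr_rlt0 // exprn_gt0.
Qed.

Lemma future_timelike_near (T : Type) (F : set_system T) {FF : Filter F} (f g : T -> 'rV[R]_3) (u v : 'rV[R]_3) :
  f @ F --> u -> g @ F --> v -> chart_dom u -> future_timelike u v ->
  \forall t \near F, future_timelike (f t) (g t).
Proof.
move=> fu gv hu /(future_timelikeE _ hu)[m v0].
have cf i := @cvg_coord _ _ F 1 3 f u 0 i fu; have cg i := @cvg_coord _ _ F 1 3 g v 0 i gv.
have nd : \forall t \near F, chart_dom (f t) := fu _ (near_dom hu).
have n0 : \forall t \near F, 0 < g t 0 ord_max by exact: (cvgr_gt _ (cg ord_max) _ v0).
have cm : (1 - f t 0 0 ^+ 2 - f t 0 1 ^+ 2) * (g t 0 0 ^+ 2 + g t 0 1 ^+ 2 - g t 0 ord_max ^+ 2)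
    + (f t 0 0 * g t 0 0 + f t 0 1 * g t 0 1) ^+ 2 @[t --> F] -->
    (1 - u 0 0 ^+ 2 - u 0 1 ^+ 2) * (v 0 0 ^+ 2 + v 0 1 ^+ 2 - v 0 ord_max ^+ 2)
    + (u 0 0 * v 0 0 + u 0 1 * v 0 1) ^+ 2.
  exact: (cvgD (cvgM (cvgB (cvgB (cvg_cst _) (cvg_sqr (cf 0))) (cvg_sqr (cf 1)))
    (cvgB (cvgD (cvg_sqr (cg 0)) (cvg_sqr (cg 1))) (cvg_sqr (cg ord_max))))
    (cvg_sqr (cvgD (cvgM (cf 0) (cg 0)) (cvgM (cf 1) (cg 1))))).
have nm := cvgr_lt _ cm _ m.
near=> t; apply/(future_timelikeE _ _); first by near: t.
by split; near: t; [exact: nm|exact: n0].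
Unshelve. all: by end_near. Qed.

End Bump.

(** * Moving an endpoint of a timelike curve *)

Section Curves.
Variable R : realType.
Variables (G : subgroup R) (L : set (cyl R)).
Hypothesis Le : L `<=` @ein R.
Hypothesis Lclosed : closed L.
Hypothesis La : achronal L.

Definition good (u : 'rV[R]_3) := chart_dom u /\ Edom L (mka u).

Definition toE (z0 : Etype L) (u : 'rV[R]_3) : Etype L :=
  if pselect (good u) is left h then SigSub (mem_set h.2) else z0.

Lemma chart_toE z0 u : good u -> chart (to_ads (toE z0 u)) = u.
Proof. by move=> h; rewrite /toE; case: pselect => // h'; exact: (chart_mka h.1). Qed.

Lemma good_chart (z : Etype L) : good (chart (to_ads z)).
Proof. by split; [exact: chart_domP|rewrite mka_chart; exact: (set_valP z)]. Qed.

Lemma toE_chart z0 (z : Etype L) : toE z0 (chart (to_ads z)) = z.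
Proof. by apply: to_ads_inj; apply: chart_inj; rewrite chart_toE //; exact: good_chart. Qed.

Lemma good_open u : good u -> \forall x \near u, good x.
Proof.
move=> hu; pose z : Etype L := SigSub (mem_set hu.2).
have [V + hV] := Edom_open Le Lclosed La z; have -> : chart (to_ads z) = u by exact: (chart_mka hu.1).
by apply: filterS.
Qed.

Definition nice (k : R -> 'rV[R]_3) (s : R) := [/\ derivable k s 1, {for s, continuous (derive1 k)},
  future_timelike (k s) (derive1 k s) & good (k s)].

Lemma model_curve (z0 : Etype L) (k : R -> 'rV[R]_3) (t e : R) :
  (forall s : R, `|s - t| < e -> nice k s) -> forall s : R, `|s - t| < e ->
  let k' := fun r => chart (to_ads (toE z0 (k r))) in
  [/\ derivable k' s 1, {for s, continuous (derive1 k')} & future_timelike (k' s) (derive1 k' s)].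
Proof.
move=> h s hs k'.
have E r : `|r - t| < e -> k' r = k r by move=> hr; apply: chart_toE; have [] := h r hr.
have nE r : `|r - t| < e -> \forall x \near r, k x = k' x.
  by move=> hr; apply: filterS (interval_near hr) => x hx; rewrite E.
have dE r : `|r - t| < e -> derive1 k' r = derive1 k r.
  by move=> hr; rewrite !derive1E; apply/esym/near_eq_derive; exact: nE.
have [d c f _] := h s hs; split.
- exact: near_eq_derivable (nE s hs) d.
- have c2 : derive1 k' @ s --> derive1 k s.
    apply: (@cvg_trans _ (derive1 k @ s)); last exact: c.
    by apply: near_eq_cvg; apply: filterS (interval_near hs) => x hx; rewrite dE.
  by rewrite -(dE s hs) in c2.
- by rewrite E // dE.
Qed.

(** The local lift near [t0] is translated in the chart by a small [h] times a bump. The hypothesis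
    on [m] makes [t0] an end of the interval and selects the side on which the bump decreases:
    [m = 1] at [b], [m = -1] at [a]. *)
Lemma perturb (c : R -> Mquot G L) (a b t0 m : R) : a < b -> timelike_curve c a b ->
  a <= t0 <= b -> (forall s : R, a <= s <= b -> m * (s - t0) = - `|s - t0|) ->
  exists2 z : Etype L, quot_proj G z = c t0 & \forall w \near z, exists c', [/\ timelike_curve c' a b,
    c' t0 = quot_proj G w & forall s, a <= s <= b -> (b - a) / 2 <= `|s - t0| -> c' s = c s].
Proof.
move=> ab hc ht0 hm; have [e [l [e0 hl]]] := hc t0 ht0.
pose k s := chart (to_ads (l s)).
have tt : `|t0 - t0| < e by rewrite subrr normr0.
exists (l t0); first by have [_ _ _ ->] := hl t0 tt.
(* The bound [e / 4] keeps the change well inside the domain of the local lift, and [(b - a) / 2]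
   leaves the other half of the curve unchanged. *)
pose d := Num.min (e / 4) ((b - a) / 2).
have d0 : 0 < d by rewrite lt_min; apply/andP; split; lra.
have d1 : d <= e / 4 by rewrite ge_min lexx.
have d2 : d <= (b - a) / 2 by rewrite ge_min lexx orbT.
have dn0 : d != 0 by rewrite gt_eqF.
pose x s := bump t0 (m / d) s; pose dx s := dbump t0 (m / d) s.
have x0 s : a <= s <= b -> d <= `|s - t0| -> x s = 0.
  move=> hs ds; apply: bump_eq0; have -> : m / d * (s - t0) = m * (s - t0) / d by rewrite mulrAC.
  by rewrite hm // mulNr subr_le0 ler_pdivlMr // mul1r.
pose kh (h : 'rV[R]_3) s := k s + x s *: h.
have ise h s : `|s - t0| < e -> is_derive s (1 : R) (kh h) (derive1 k s + dx s *: h).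
  move=> hs; have [dk _ _ _] := hl s hs.
  have i1 : is_derive s (1 : R) k (derive1 k s) by rewrite derive1E; exact: derivableP.
  have i2 : is_derive s (1 : R) (fun s => x s *: h) (dx s *: h).
    apply: is_derive_matrix => i j; under eq_fun do rewrite mxE; rewrite mxE.
    apply: is_derive_eq (is_deriveM (is_derive_bump t0 (m / d) s) (is_derive_cst (h i j) s 1)) _.
    by rewrite /GRing.scale /= mulr0 add0r mulrC.
  exact: is_deriveD i1 i2.
have ck s : `|s - t0| < e -> k @ s --> k s.
  by move=> hs; have [dk _ _ _] := hl s hs; apply: differentiable_continuous; apply/derivable1_diffP.
(* Local lifts live on open intervals, so the perturbed one must be timelike on both sides of [t0],
   also where the bump keeps growing; compactness makes the smallness of [h] uniform. *)
have tube : \forall h \near (0 : 'rV[R]_3), `[t0 - e / 2, t0 + e / 2]%classic `<=`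
    (fun s => good (kh h s) /\ future_timelike (kh h s) (derive1 k s + dx s *: h)).
  have /compact_near_coveringP cK := @segment_compact R (t0 - e / 2) (t0 + e / 2).
  have := cK _ (nbhs (0 : 'rV[R]_3)) (fun h s => good (kh h s) /\
    future_timelike (kh h s) (derive1 k s + dx s *: h)) _; apply.
  move=> s; rewrite /= in_itv /= => /andP[s1 s2].
  have hs : `|s - t0| < e by rewrite real_ltr_norml ?num_real //; apply/andP; split; lra.
  have [_ cdk ft _] := hl s hs.
  have FF : Filter (nbhs (s, (0 : 'rV[R]_3))) by exact: nbhs_filter.
  have cf : (fun p : R * 'rV[R]_3 => kh p.2 p.1) p @[p --> (s, (0 : 'rV[R]_3))] --> k s.
    have cx : (fun p : R * 'rV[R]_3 => x p.1) p @[p --> (s, (0 : 'rV[R]_3))] --> x s.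
      exact: (cvg_comp (fun p : R * 'rV[R]_3 => p.1) x cvg_fst (@bump_continuous R t0 (m / d) s)).
    have c2 : (fun p : R * 'rV[R]_3 => p.2) p @[p --> (s, (0 : 'rV[R]_3))] --> (0 : 'rV[R]_3) by exact: cvg_snd.
    have cz : (fun p : R * 'rV[R]_3 => x p.1 *: p.2) p @[p --> (s, (0 : 'rV[R]_3))] --> x s *: (0 : 'rV[R]_3).
      exact: (@cvg_scalemx R _ (nbhs (s, (0 : 'rV[R]_3))) FF 1 3 _ _ _ _ cx c2).
    have ck0 : (fun p : R * 'rV[R]_3 => k p.1) p @[p --> (s, (0 : 'rV[R]_3))] --> k s.
      exact: (cvg_comp (fun p : R * 'rV[R]_3 => p.1) k cvg_fst (ck s hs)).
    have := @cvg_addmx R _ (nbhs (s, (0 : 'rV[R]_3))) FF 1 3 _ _ _ _ ck0 cz.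
    by rewrite scaler0 addr0.
  have cg : (fun p : R * 'rV[R]_3 => derive1 k p.1 + dx p.1 *: p.2) p @[p --> (s, (0 : 'rV[R]_3))] --> derive1 k s.
    have cx : (fun p : R * 'rV[R]_3 => dx p.1) p @[p --> (s, (0 : 'rV[R]_3))] --> dx s.
      exact: (cvg_comp (fun p : R * 'rV[R]_3 => p.1) dx cvg_fst (@dbump_continuous R t0 (m / d) s)).
    have c2 : (fun p : R * 'rV[R]_3 => p.2) p @[p --> (s, (0 : 'rV[R]_3))] --> (0 : 'rV[R]_3) by exact: cvg_snd.
    have cz : (fun p : R * 'rV[R]_3 => dx p.1 *: p.2) p @[p --> (s, (0 : 'rV[R]_3))] --> dx s *: (0 : 'rV[R]_3).
      exact: (@cvg_scalemx R _ (nbhs (s, (0 : 'rV[R]_3))) FF 1 3 _ _ _ _ cx c2).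
    have ck0 : (fun p : R * 'rV[R]_3 => derive1 k p.1) p @[p --> (s, (0 : 'rV[R]_3))] --> derive1 k s.
      exact: (cvg_comp (fun p : R * 'rV[R]_3 => p.1) (derive1 k) cvg_fst cdk).
    have := @cvg_addmx R _ (nbhs (s, (0 : 'rV[R]_3))) FF 1 3 _ _ _ _ ck0 cz.
    by rewrite scaler0 addr0.
  have n1 := cf _ (good_open (good_chart (l s))).
  have n2 := @future_timelike_near R _ (nbhs (s, (0 : 'rV[R]_3))) FF _ _ _ _ cf cg (chart_domP _) ft.
  have n3 : nbhs (s, (0 : 'rV[R]_3)) (fun p : R * 'rV[R]_3 => good (kh p.2 p.1) /\
     future_timelike (kh p.2 p.1) (derive1 k p.1 + dx p.1 *: p.2)).
    by apply: filterI; [exact: n1|exact: n2].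
  by have [[A B] /= [sA B0] AB] := n3; exists (A, B) => // -[s' h'] [/= As Bh]; exact: (AB (s', h')).
have ch : (fun w : Etype L => chart (to_ads w) - k t0) w @[w --> l t0] --> (0 : 'rV[R]_3).
  have c1 : (fun w : Etype L => chart (to_ads w)) w @[w --> l t0] --> k t0.
    exact: (cvg_comp (@to_ads R L) (@chart R) (@to_ads_continuous R L (l t0)) (@chart_continuous R _)).
  have c2 : (fun w : Etype L => chart (to_ads w) - k t0) w @[w --> l t0] --> k t0 - k t0.
    exact: (cvgB c1 (cvg_cst (k t0))).
  by rewrite subrr in c2.
have nt : nbhs (l t0) (fun w : Etype L => `[t0 - e / 2, t0 + e / 2]%classic `<=`
    (fun s => good (kh (chart (to_ads w) - k t0) s) /\
      future_timelike (kh (chart (to_ads w) - k t0) s) (derive1 k s + dx s *: (chart (to_ads w) - k t0)))).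
  by exact: (ch _ tube).
have FF : Filter (nbhs (l t0)) by exact: nbhs_filter.
apply: (@filterS _ _ FF _ _ _ nt) => w; set h := chart (to_ads w) - k t0 => hw.
have hnice s : `|s - t0| < e / 2 -> nice (kh h) s.
  move=> hs; have hs' : `|s - t0| < e by lra.
  have [_ cdk _ _] := hl s hs'.
  have [|gs fs] := hw s.
    by move: hs; rewrite real_ltr_norml ?num_real // /= in_itv /= => /andP[h1 h2]; apply/andP; split; lra.
  have dE r : `|r - t0| < e -> derive1 (kh h) r = derive1 k r + dx r *: h.
    by move=> hr; rewrite derive1E; have [_ ->] := ise h r hr.
  split; [exact: (derivable_of (ise h s hs'))| |by rewrite (dE s hs')|exact: gs].
  suff c2 : derive1 (kh h) @ s --> derive1 k s + dx s *: h by rewrite -(dE s hs') in c2.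
  apply: (@cvg_trans _ ((fun r => derive1 k r + dx r *: h) @ s)).
    by apply: near_eq_cvg; apply: filterS (interval_near hs') => r hr; rewrite dE.
  exact: (@cvg_addmx R _ (nbhs s) _ 1 3 (derive1 k) _ _ _ cdk
    (@cvg_scalemx R _ (nbhs s) _ 1 3 dx (fun=> h) _ _ (@dbump_continuous R t0 (m / d) s) (cvg_cst h))).
pose c' s := if `|s - t0| <= d then quot_proj G (toE (l t0) (kh h s)) else c s.
exists c'; split; last first.
- move=> s hs ds; rewrite /c'; case: ifP => // sd.
  have sd2 : d <= `|s - t0| by lra.
  have dd : `|s - t0| = d by apply/eqP; rewrite eq_le sd.
  have hs' : `|s - t0| < e by rewrite dd; lra.
  have [_ _ _ ->//] := hl s hs'; rewrite /kh x0 // scale0r addr0; congr quot_proj; exact: toE_chart.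
- rewrite /c' subrr normr0 (ltW d0); congr quot_proj.
  by rewrite /kh /x bump_eq1 scale1r /h addrC subrK toE_chart.
move=> t ht; have [te|te] := ltP `|t - t0| (e / 2).
  exists (e / 2 - `|t - t0|), (fun s => toE (l t0) (kh h s)); split; first by rewrite subr_gt0.
  move=> k' s hs; have hs2 : `|s - t0| < e / 2.
    have := ler_distD t s t0; lra.
  have [k1 k2 k3] := model_curve (l t0) hnice hs2; split; [exact: k1|exact: k2|exact: k3|move=> hsab].
  rewrite /c'; case: ifP => // /negbT; rewrite -ltNge => sd.
  have hs' : `|s - t0| < e by lra.
  have [_ _ _ ->//] := hl s hs'; rewrite /kh x0 //; last exact: ltW.
  by rewrite scale0r addr0 toE_chart.
(* Farther than [d] from [t0] the curve is unchanged, so its old lift is kept on a shorter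
   interval. *)
have [et [lt [et0 hlt]]] := hc t ht.
exists (Num.min et (e / 2 - d)), lt; split; first by rewrite lt_min et0 /=; lra.
move=> k' s; rewrite lt_min => /andP[s1 s2]; have [k1 k2 k3 k4] := hlt s s1; split; [exact: k1|exact: k2|exact: k3|move=> hs].
rewrite /c' ifF ?k4 //; apply/negbTE; rewrite -ltNge.
have := ler_distD s t t0; rewrite (distrC t s); lra.
Qed.

End Curves.

(** * Strong causality *)

Section Causality.
Variable R : realType.
Variables (G : subgroup R) (L : set (cyl R)).
Hypothesis Le : L `<=` @ein R.
Hypothesis Lclosed : closed L.
Hypothesis La : achronal L.
Hypothesis Lnon : nonelementary L.
Hypothesis Gpres : preserves G L.
Hypothesis Gdisc : discrete G.
Hypothesis Gtf : torsion_free G.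

Let Lk : compact L := achronal_compact Lclosed La.

Lemma open_of_lifts (A : set (Mquot G L)) :
  (forall y, A y -> exists2 z : Etype L, quot_proj G z = y & \forall w \near z, A (quot_proj G w)) -> open A.
Proof.
move=> h; rewrite openE => y Ay; have [z zy hz] := h y Ay.
have [W [oW Wz] WA] : exists2 W : set (Etype L), open_nbhs z W & W `<=` (fun w => A (quot_proj G w)).
  have nz : nbhs z (fun w => A (quot_proj G w)) by exact: hz.
  by move: nz; rewrite nbhsE.
suff nA : nbhs y A by exact: nA.
have n1 : nbhs y (@quot_proj R G L @` W).
  by apply: open_nbhs_nbhs; split; [apply: quot_proj_open|exists z].
have FF : Filter (nbhs y) by exact: nbhs_filter.
by apply: (@filterS _ _ FF _ _ _ n1) => _ [w Ww <-]; exact: WA.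
Qed.

Lemma future_open (x : Mquot G L) : open (future x).
Proof.
apply: open_of_lifts => y [c [a [b [ab hc ca cb]]]].
have ht : a <= b <= b by rewrite (ltW ab) lexx.
have [|z zE hz] := perturb Le Lclosed La (m := 1) ab hc ht.
  by move=> s /andP[s1 s2]; rewrite mul1r ler0_norm ?opprK // subr_le0.
exists z; first by rewrite zE.
apply: filterS hz => w [c' [h1 h2 h3]]; exists c', a, b; split=> //.
by rewrite h3 ?ca ?lexx ?ltW // ltr0_norm; lra.
Qed.









Lemma past_open (y : Mquot G L) : open (past y).
Proof.
apply: open_of_lifts => x [c [a [b [ab hc ca cb]]]].
have ht : a <= a <= b by rewrite lexx ltW.
have [|z zE hz] := perturb Le Lclosed La (m := -1) ab hc ht.
  by move=> s /andP[s1 s2]; rewrite mulN1r ger0_norm // subr_ge0.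
exists z; first by rewrite zE.
apply: filterS hz => w [c' [h1 h2 h3]]; exists c', a, b; split=> //.
by rewrite h3 ?cb ?lexx ?ltW // gtr0_norm; lra.
Qed.

Section Vertical.
Variable z : Etype L.
Let p := chart (to_ads z).
Definition vline (r : R) : 'rV[R]_3 := \row_(i < 3) [:: p 0 0; p 0 1; r]`_i.
Let vE r := row3E (p 0 0) (p 0 1) r.
Let t0 := tm (to_cyl (to_ads z)).

Lemma vline_tm : vline t0 = p.
Proof.
have [v0 v1 v2] := vE t0; apply: row3P; rewrite ?v0 ?v1 ?v2 //.
by rewrite /t0 tm_crd.
Qed.

Lemma is_derive_vline (r : R) : is_derive r (1 : R) vline (delta_mx 0 ord_max).
Proof.
apply: is_derive_matrix => i j; rewrite (ord1 i); move: j; apply: ord3P; rewrite mxE /=.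
- have E q : vline q 0 0 = p 0 0 by have [] := vE q.
  by under eq_fun do rewrite E; exact: is_derive_cst.
- have E q : vline q 0 1 = p 0 1 by have [] := vE q.
  by under eq_fun do rewrite E; exact: is_derive_cst.
- have E q : vline q 0 ord_max = q by have [] := vE q.
  by under eq_fun do rewrite E; exact: is_derive_id.
Qed.

Lemma vline_continuous : continuous vline.
Proof.
by move=> r; apply: differentiable_continuous; apply/derivable1_diffP; exact: derivable_of (is_derive_vline r).
Qed.

Lemma vline_nice : exists2 n : R, 0 < n & forall r : R, `|r - t0| < n -> nice L vline r.
Proof.
have h : \forall x \near vline t0, good L x.
  by rewrite vline_tm; apply: good_open => //; exact: good_chart.
have h2 : \forall r \near t0, good L (vline r) by exact: (@vline_continuous t0 _ h).
have [n /= n0 hn] := h2; exists n => // r hr.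
have gr : good L (vline r) by apply: hn; rewrite /= distrC.
have dE : derive1 vline = fun=> delta_mx 0 ord_max.
  by apply/funext => q; rewrite derive1E; have [_ ->] := is_derive_vline q.
split; [exact: (derivable_of (is_derive_vline r))|rewrite dE; exact: cvg_cst| |exact: gr].
rewrite dE; have E0 : vline r 0 0 = p 0 0 by have [] := vE r.
have E1 : vline r 0 1 = p 0 1 by have [] := vE r.
have d0 : (delta_mx 0 ord_max : 'rV[R]_3) 0 0 = 0 by rewrite !mxE.
have d1 : (delta_mx 0 ord_max : 'rV[R]_3) 0 1 = 0 by rewrite !mxE.
have d2 : (delta_mx 0 ord_max : 'rV[R]_3) 0 ord_max = 1 by rewrite !mxE !eqxx.
have h0 := dom_gt0 gr.1; apply/(future_timelikeE _ gr.1); rewrite E0 E1 in h0 *.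
by rewrite d0 d1 d2; split; [move: h0; move: (p 0 0) (p 0 1) => a b h0; nra|exact: ltr01].
Qed.













Lemma vertical_timelike : exists2 n : R, 0 < n & forall s t : R, `|s - t0| < n -> `|t - t0| < n -> s < t ->
  [/\ chart (to_ads (toE z (vline s))) = vline s, future (quot_proj G (toE z (vline s))) (quot_proj G (toE z (vline t))) &
   Jinf G (to_ads (toE z (vline s))) (to_ads (toE z (vline t)))].
Proof.
have [n n0 hn] := vline_nice; exists n => // s t hs ht st.
have inn r : s <= r <= t -> `|r - t0| < n.
  move=> /andP[r1 r2]; move: hs ht; rewrite !real_ltr_norml ?num_real // => /andP[h1 h2] /andP[h3 h4].
  by apply/andP; split; lra.
split.
- by apply: chart_toE; have [] := hn s hs.
- exists (fun r => quot_proj G (toE z (vline r))), s, t; split=> // r hr.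
  have hr' := inn r hr; exists (n - `|r - t0|), (fun q => toE z (vline q)); split; first by rewrite subr_gt0.
  move=> k' q hq; have hq2 : `|q - t0| < n by have := ler_distD r q t0; lra.
  have [k1 k2 k3] := model_curve z hn hq2.
  by split; [exact: k1|exact: k2|exact: k3|move=> _].
- apply: (@Jinf_curve R G (fun q => to_ads (toE z (vline q))) s t (ltW st)) => q hq.
  have [k1 _ k3] := model_curve z hn (inn q hq).
  by split; [exact: k1|exact: k3].
Qed.

End Vertical.

(** The time difference lies between the distance [d] and [2 pi - d], by the perimeter inequality
    with a limit point, and on that interval the cosine is at most [cos d]. *)
Lemma causal_product (z w : cyl R) : between L z -> between L w -> causal_le z w ->
  - (height z * height w) <= formQ (rr z) (rr w).
Proof.
move=> bz bw J; rewrite formQ_rr.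
have [l Ll] := L_nonempty Lnon.
have sz := (spatial_ein z (Le Ll)).2 ((between_spatial z Le Lk).1 bz l Ll).
have sw := (spatial_ein w (Le Ll)).2 ((between_spatial w Le Lk).1 bw l Ll).
have per := sdist_perimeter (unit_pt z) (unit_pt w) (unit_pt l).
rewrite (sdistC (pt l)) in per.
have d0 := sdist_ge0 (unit_pt z) (unit_pt w); have dp := sdist_lepi (unit_pt z) (unit_pt w).
move: J; rewrite /causal_le => J.
suff h : cos (tm z - tm w) <= dot (pt z) (pt w) by lra.
rewrite -(cos_sdist (unit_pt z) (unit_pt w)) -cosN opprB.
have up : tm w - tm z <= 2 * pi - sdist (pt z) (pt w).
  have := sz; have := sw; rewrite !real_ltr_norml ?num_real // => /andP[w1 w2] /andP[z1 z2].
  by move: w1 w2 z1 z2 per; lra.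
have [hp|hp] := leP (tm w - tm z) pi; first exact: cos_le.
have -> : cos (tm w - tm z) = cos (2 * pi - (tm w - tm z)).
  by rewrite -(cosN (2 * pi - _)) opprB -[RHS]cosD2pi; congr cos; rewrite mulr2n; lra.
apply: cos_le => //; lra.
Qed.

(** After rescaling, the lower bound of [causal_product] carries the factor [c], which tends to 0;
    the limit is [0 <= q(z, z B)], against [limit_spacelike]. *)
Lemma escape_not_causal (T : Type) (U : set_system T) (UU : UltraFilter U) (g : T -> ads R -> ads R)
  (z : ads R) (x y : T -> ads R) : Edom L z -> (forall t, G (g t)) ->
  (forall M : R, \forall t \near U, M < msize (lin (g t))) ->
  to_cyl (x t) @[t --> U] --> to_cyl z -> to_cyl (y t) @[t --> U] --> to_cyl z ->
  (\forall t \near U, [/\ Edom L (x t), Edom L (y t) & causal_le (to_cyl (x t)) (to_cyl (g t (y t)))]) -> False.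
Proof.
move=> Ez Gg hM xz yz hJ.
have [B [sB B0 [c [c0 cp cB]]]] := escape UU (@filterS _ U _ _ _ (fun t _ => Gg t) (@filterT _ U _)) hM.
have lC := limit_cone_L Le Lclosed La Lnon Gpres.
pose Z := to_cyl z.
have iz : invisible (Lcone L) (rr Z) by apply: invisible_rr.
have zz : formQ (rr Z) (rr Z) < 0.
  by rewrite formQ_rr_self oppr_lt0 exprn_gt0 //; exact: (set_valP z).
have := limit_spacelike (SO22_like_group G) lC iz zz sB B0; apply/negP; rewrite -leNgt.
have r1 : rr (to_cyl (x t)) @[t --> U] --> rr Z by exact: (cvg_comp _ (@rr R) xz (@rr_continuous R _)).
have r2 : rr (to_cyl (y t)) @[t --> U] --> rr Z by exact: (cvg_comp _ (@rr R) yz (@rr_continuous R _)).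
have r3 : rr (to_cyl (y t)) *m (c t *: lin (g t)) @[t --> U] --> rr Z *m B by exact: cvg_mulmx.
have q1 : formQ (rr (to_cyl (x t))) (rr (to_cyl (y t)) *m (c t *: lin (g t))) @[t --> U] --> formQ (rr Z) (rr Z *m B).
  exact: cvg_formQ.
have hh (f : T -> cyl R) : f @ U --> Z -> height (f t) @[t --> U] --> height Z.
  move=> fz; have pf := cvg_comp f (@pt R) fz (@pt_continuous R Z).
  exact: (@cvg_coord _ _ U 1 3 _ _ 0 ord_max pf).
have q2 : height (to_cyl (x t)) * (c t * height (to_cyl (y t))) @[t --> U] --> height Z * (0 * height Z).
  exact: (cvgM (hh _ xz) (cvgM c0 (hh _ yz))).
rewrite mul0r mulr0 in q2.
have q3 : formQ (rr (to_cyl (x t))) (rr (to_cyl (y t)) *m (c t *: lin (g t))) +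
    height (to_cyl (x t)) * (c t * height (to_cyl (y t))) @[t --> U] --> formQ (rr Z) (rr Z *m B) + 0.
  exact: (cvgD q1 q2).
rewrite addr0 in q3; apply: (@cvg_ge0 _ _ U _ _ _ q3).
near=> t.
have [Ex Ey J] : [/\ Edom L (x t), Edom L (y t) & causal_le (to_cyl (x t)) (to_cyl (g t (y t)))] by near: t; exact: hJ.
have ct : 0 < c t by near: t; exact: cp.
have Egy : between L (to_cyl (g t (y t))) by exact: (Edom_stable Le Lclosed La Gpres (Gg t) Ey).
have := causal_product Ex Egy J.
have [k k0 kE] := rr_linear_part (linP (subgroup_sub (Gg t))) (y t).
(* Heights scale like rays, because the matrix preserves [q(rr z, rr z) = - height z ^ 2]. *)
have hk : height (to_cyl (g t (y t))) = k * height (to_cyl (y t)).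
  have [A [_ orthA _ _]] := SO22hat_linear (subgroup_sub (Gg t)).
  have orth : lin (g t) *m adjQ (lin (g t)) = 1%:M.
    by have [] := linear_groupP (Gg t) (linP (subgroup_sub (Gg t))).
  have := formQ_rr_self (to_cyl (g t (y t))); rewrite kE formQZl formQZr formQ_adj -mulmxA orth mulmx1.
  rewrite formQ_rr_self => e2.
  have p1 := pt_ge0 (to_cyl (g t (y t))); have p2 := pt_ge0 (to_cyl (y t)).
  have : (height (to_cyl (g t (y t)))) ^+ 2 = (k * height (to_cyl (y t))) ^+ 2 by rewrite exprMn; lra.
  by move/eqP; rewrite eqrXn2 // ?mulr_ge0 ?(ltW k0) // => /eqP.
rewrite hk kE formQZr -scalemxAr formQZr => h.
have : 0 <= c t * (formQ (rr (to_cyl (x t))) (rr (to_cyl (y t)) *m lin (g t)) + height (to_cyl (x t)) * height (to_cyl (y t))).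
  apply: mulr_ge0; first exact: ltW.
  by rewrite -(pmulr_rge0 _ k0); move: h; lra.
by move: (formQ _ _) (height _) (height _) => a b d; lra.
Unshelve. all: by end_near. Qed.

End Causality.

(** * Small diamonds of the quotient *)

Section Diamond.
Variable R : realType.
Variables (G : subgroup R) (L : set (cyl R)).
Hypothesis Le : L `<=` @ein R.
Hypothesis Lclosed : closed L.
Hypothesis La : achronal L.
Hypothesis Lnon : nonelementary L.
Hypothesis Gpres : preserves G L.
Hypothesis Gdisc : discrete G.
Hypothesis Gtf : torsion_free G.

Let Lk : compact L := achronal_compact Lclosed La.

Lemma causal_antisym (z w : cyl R) : causal_le z w -> causal_le w z -> z = w.
Proof.
rewrite /causal_le (sdistC (pt w)) => h1 h2.
have d0 := sdist_ge0 (unit_pt z) (unit_pt w).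
have d1 : sdist (pt z) (pt w) = 0 by lra.
have e1 := cos_sdist (unit_pt z) (unit_pt w); rewrite d1 cos0 in e1.
apply: cyl_ext; last by lra.
apply/eqP; rewrite -subr_eq0; apply/eqP/dot_eq0.
have uz : dot (pt z) (pt z) = 1 := unit_pt z; have uw : dot (pt w) (pt w) = 1 := unit_pt w.
have -> : dot (pt z - pt w) (pt z - pt w) = dot (pt z) (pt z) + dot (pt w) (pt w) - 2 * dot (pt z) (pt w).
  by rewrite !dotE !mxE; ring.
by rewrite uz uw -e1; ring.
Qed.

Section Point.
Variable z : Etype L.
Variable n : R.
Hypothesis n0 : 0 < n.
Let t0 := tm (to_cyl (to_ads z)).
Let zs (r : R) : Etype L := toE z (vline z r).
Hypothesis vert_n : forall s t : R, `|s - t0| < n -> `|t - t0| < n -> s < t ->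
  [/\ chart (to_ads (zs s)) = vline z s, future (quot_proj G (zs s)) (quot_proj G (zs t)) &
   Jinf G (to_ads (zs s)) (to_ads (zs t))].
(** The points [zm k] and [zp k] bracket [z] on its vertical line and converge to it; the factor
    [n / 2] keeps them in the range of [vert_n]. *)
Let eps (k : nat) : R := n / 2 * k.+1%:R^-1.
Let zm k := zs (t0 - eps k).
Let zp k := zs (t0 + eps k).

Let eps_gt0 k : 0 < eps k.
Proof. by rewrite /eps mulr_gt0 ?invr_gt0 ?ltr0n // divr_gt0. Qed.

Let eps_lt k : eps k < n.
Proof.
have : eps k <= n / 2 by rewrite /eps ler_piMr ?invf_le1 ?ltr0n ?ler1n // ltW // divr_gt0.
by have := n0; lra.
Qed.

Let eps_le j k : (j <= k)%N -> eps k <= eps j.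
Proof.
move=> jk; rewrite /eps ler_wpM2l ?divr_ge0 ?(ltW n0) //.
by rewrite lef_pV2 ?posrE ?ltr0n // ler_nat.
Qed.

Let eps_cvg : eps k @[k --> \oo] --> (0 : R).
Proof. by have := cvgM (cvg_cst (n / 2)) (@cvg_harmonic R); rewrite mulr0; apply. Qed.

Let inm k : `|t0 - eps k - t0| < n.
Proof. by rewrite addrAC subrr add0r normrN gtr0_norm ?eps_gt0 ?eps_lt. Qed.

Let inp k : `|t0 + eps k - t0| < n.
Proof. by rewrite addrAC subrr add0r gtr0_norm ?eps_gt0 ?eps_lt. Qed.

Let inz : `|t0 - t0| < n. Proof. by rewrite subrr normr0. Qed.

Let zs0 : zs t0 = z.
Proof. by rewrite /zs /t0 vline_tm toE_chart. Qed.

Let chart_zs s : `|s - t0| < n -> chart (to_ads (zs s)) = vline z s.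
Proof.
move=> hs; have [st|ts] := ltP s (t0 + n / 2 + `|s - t0| / 2).
  have [] // := @vert_n s (t0 + n / 2 + `|s - t0| / 2) hs _ st.
  have := n0; have := normr_ge0 (s - t0) => p1 p2.
  have -> : t0 + n / 2 + `|s - t0| / 2 - t0 = n / 2 + `|s - t0| / 2 by ring.
  by rewrite ger0_norm; lra.
exfalso; move: hs ts n0 (ler_norm (s - t0)) => h1 h2 h3 h4; lra.
Qed.

Let cvg_zs (T : Type) (F : set_system T) (FF : Filter F) (f : T -> R) : f @ F --> t0 ->
  (forall t, `|f t - t0| < n) -> to_cyl (to_ads (zs (f t))) @[t --> F] --> to_cyl (to_ads z).
Proof.
move=> ft hf; apply: (@cvg_cyl _ _ F FF (fun t => to_cyl (to_ads (zs (f t)))) (to_cyl (to_ads z))).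
have E : (fun t => crd (to_cyl (to_ads (zs (f t))))) = vline z \o f.
  by apply/funext => t /=; rewrite -chartE chart_zs.
rewrite E -chartE -vline_tm; exact: (cvg_comp f (vline z) ft (@vline_continuous R L z t0)).
Qed.

Let cvg_m (F : set_system nat) (FF : Filter F) : \oo `<=` F ->
  to_cyl (to_ads (zm k)) @[k --> F] --> to_cyl (to_ads z).
Proof.
move=> hF; apply: cvg_zs; last exact: inm.
have c : eps k @[k --> F] --> (0 : R) by move=> W /eps_cvg hW; exact: hF.
have : (fun k => t0 - eps k) k @[k --> F] --> t0 - 0 by exact: (cvgB (cvg_cst t0) c).
by rewrite subr0.
Qed.

Let cvg_p (F : set_system nat) (FF : Filter F) : \oo `<=` F ->
  to_cyl (to_ads (zp k)) @[k --> F] --> to_cyl (to_ads z).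
Proof.
move=> hF; apply: cvg_zs; last exact: inp.
have c : eps k @[k --> F] --> (0 : R) by move=> W /eps_cvg hW; exact: hF.
have : (fun k => t0 + eps k) k @[k --> F] --> t0 + 0 by exact: (cvgD (cvg_cst t0) c).
by rewrite addr0.
Qed.

(** Contains every group element by which a lift of a timelike path of the quotient from [zm k] to
    [zp k] may miss its end. *)
Let S k := [set g | G g /\ Jinf G (to_ads (zm k)) (g (to_ads (zp k)))].

Let Jm k : Jinf G (to_ads (zm k)) (to_ads z).
Proof.
have [|_ _] := @vert_n (t0 - eps k) t0 (inm k) inz; first by rewrite ltrBlDr ltrDl eps_gt0.
by rewrite zs0.
Qed.

Let Jp k : Jinf G (to_ads z) (to_ads (zp k)).
Proof.
have [|_ _] := @vert_n t0 (t0 + eps k) inz (inp k); first by rewrite ltrDl eps_gt0.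
by rewrite zs0.
Qed.

Let Jle s t : `|s - t0| < n -> `|t - t0| < n -> s <= t -> Jinf G (to_ads (zs s)) (to_ads (zs t)).
Proof.
move=> hs ht; rewrite le_eqVlt => /orP[/eqP ->|st]; last by have [] := vert_n hs ht st.
by move=> g Gg; rewrite /causal_le sdistxx ?subrr //; exact: unit_pt.
Qed.

Let S_mono j k : (j <= k)%N -> S k `<=` S j.
Proof.
move=> jk g [Gg J]; split=> //; have le := eps_le jk.
have J1 : Jinf G (to_ads (zm j)) (to_ads (zm k)) by apply: Jle; rewrite ?inm // lerD2l lerN2.
have J2 : Jinf G (to_ads (zp k)) (to_ads (zp j)) by apply: Jle; rewrite ?inp // lerD2l.
exact: Jinf_trans (Jinf_trans J1 J) (Jinf_stable Gg J2).
Qed.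

(** Otherwise each [S k] contains an element whose matrix has size greater than [k], by
    [bounded_finite], and [escape_not_causal] applies to this sequence. *)
Let S_finite : exists k, finite_set (S k).
Proof.
apply: contrapT => h.
have pick k : exists g, S k g /\ k%:R < msize (lin g).
  apply: contrapT => hk; apply: h; exists k.
  suff sub : S k `<=` [set g | G g /\ msize (lin g) <= k%:R].
    have fb := bounded_finite Lclosed La Lnon Gpres Gdisc k%:R.
    by apply: sub_finite_set fb => g Sg; exact: sub.
  move=> g [Gg J]; split=> //.
  by rewrite leNgt; apply/negP => lt; apply: hk; exists g.
pose g k := sval (cid (pick k)); have hg k := svalP (cid (pick k)).
have [U [UU sU]] := ultraFilterLemma (@eventually_filter).
have UF : Filter U by exact: filter_filter.
have hM (M : R) : \forall k \near U, M < msize (lin (g k)).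
  apply: sU; have [N _ hN] : \forall k \near \oo, M < k%:R.
    exists (Num.Def.archi_bound `|M|) => // k /= hk.
    have h1 := archi_boundP (normr_ge0 M).
    apply: le_lt_trans (ler_norm M) (lt_le_trans h1 _); by rewrite ler_nat.
  by exists N => // k hk; apply: lt_trans (hN k hk) _; have [] := hg k.
apply: (@escape_not_causal R G L Le Lclosed La Lnon Gpres nat U UU g (to_ads z)
  (fun k => to_ads (zm k)) (fun k => to_ads (zp k))) => //.
- exact: (set_valP z).
- by move=> k; have [[]] := hg k.
- exact: cvg_m.
- exact: cvg_p.
apply: (@filterS nat U UF setT) => [k _|]; last exact: filterT.
split; [exact: (set_valP (zm k))|exact: (set_valP (zp k))|].
by have [[_ J] _] := hg k; exact: (J id (subgroup_id G)).
Qed.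

(** In the limit [z] precedes [g z], hence every iterate of it, so all powers of [g] lie in every
    [S k], one of which is finite. *)
Let S_all g : (forall k, S k g) -> g = id.
Proof.
move=> hg; have Gg : G g by have [] := hg 0%N.
apply: contrapT => gid.
have Jz : Jinf G (to_ads z) (g (to_ads z)).
  move=> f Gf; have [c e _] := extensionP (subgroup_sub Gf).
  have [c' e' _] := extensionP (subgroup_sub (subgroup_comp Gf Gg)).
  rewrite -e -[f (g _)]/((f \o g) (to_ads z)) -e'.
  apply: (@causal_closed R nat \oo _ (fun k => extension f (to_cyl (to_ads (zm k))))
     (fun k => extension (f \o g) (to_cyl (to_ads (zp k))))).
  - by apply: (cvg_comp _ (extension f) (cvg_m _ _) (@c _)).
  - by apply: (cvg_comp _ (extension (f \o g)) (cvg_p _ _) (@c' _)).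
  - by exists 0%N => // k _ /=; rewrite e e'; have [_ J] := hg k; exact: (J f Gf).
have Jit m : Jinf G (to_ads z) (iter m g (to_ads z)).
  elim: m => [|m IH]; first by have := Jle inz inz (lexx t0); rewrite zs0.
  exact: Jinf_trans Jz (Jinf_stable Gg IH).
have [k fk] := S_finite.
have sub : range (fun m => iter m g : ads R -> ads R) `<=` S k.
  move=> _ [m _ <-]; have Gm := iter_mem m Gg; split=> //.
  exact: Jinf_trans (Jinf_trans (Jm k) (Jit m)) (Jinf_stable Gm (Jp k)).
have e := @inj_card_eq _ _ [set: nat] _ (in2W (iter_inj Gtf Gg gid)).
by apply: infinite_nat; rewrite -(eq_finite_set e); exact: sub_finite_set sub fk.
Qed.

(** The sets decrease and one is finite, so nontrivial elements at every level would, by the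
    pigeonhole principle, include one common to all levels. *)
Let S_id : exists k0, forall k, (k0 <= k)%N -> forall g, S k g -> g = id.
Proof.
suff [k0 h0] : exists k0, forall g, S k0 g -> g = id.
  by exists k0 => k hk g /(S_mono hk); exact: h0.
apply: contrapT => h.
have pick k : exists g, S k g /\ g <> id.
  apply: contrapT => hk; apply: h; exists k => g Sg; apply: contrapT => gid.
  by apply: hk; exists g.
pose g k := sval (cid (pick k)); have hg k := svalP (cid (pick k)).
have [k0 fk] := S_finite.
have cover : [set k | (k0 <= k)%N] `<=` \bigcup_(f in S k0) [set k | (k0 <= k)%N /\ g k = f].
  by move=> k /= hk; exists (g k) => //; apply: (S_mono hk); have [] := hg k.
have [fib|nfib] := pselect (forall f, S k0 f -> finite_set [set k | (k0 <= k)%N /\ g k = f]).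
  have f1 := sub_finite_set cover (bigcup_finite fk fib).
  apply: infinite_nat; have := finite_setU `I_k0 [set k | (k0 <= k)%N].
  have -> : `I_k0 `|` [set k | (k0 <= k)%N] = setT.
    by apply/seteqP; split=> // k _; case: (ltnP k k0) => hk; [left|right].
  by move=> ->; split=> //; exact: finite_II.
apply: nfib => f Sf; apply: contrapT => inf.
have unb j : exists2 k, (j <= k)%N & g k = f.
  apply: contrapT => hj; apply: inf; apply: (@sub_finite_set _ _ `I_j) (finite_II j) => k [_ kf].
  by rewrite /= ltnNge; apply/negP => jk; apply: hj; exists k.
have fid : f = id.
  apply: S_all => j; have [k jk kf] := unb j; apply: (S_mono jk); rewrite -kf.
  by have [] := hg k.
by have [k _ kf] := unb 0%N; have [_] := hg k; apply; rewrite -[LHS]/(g k) kf.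
Qed.

(** Once [S k] is trivial, the diamond of the quotient lies in the projection of the causal diamond
    between [zm k] and [zp k]. These shrink to [z]: a limit of their points is both after and before
    [z], and the causal relation of the cylinder is antisymmetric. *)
Lemma small_diamond (W : set (Mquot G L)) : nbhs (quot_proj G z) W ->
  exists U : set (Mquot G L), [/\ exists x y, U = future x `&` past y, U (quot_proj G z) & U `<=` W].
Proof.
move=> nW; have nV : nbhs z (fun w => W (quot_proj G w)) by exact: (@quot_proj_continuous R G L z W nW).
have [k0 hk0] := S_id.
suff [k hk sub] : exists2 k, (k0 <= k)%N & forall w : Etype L,
    causal_le (to_cyl (to_ads (zm k))) (to_cyl (to_ads w)) ->
    causal_le (to_cyl (to_ads w)) (to_cyl (to_ads (zp k))) -> W (quot_proj G w).
  exists (future (quot_proj G (zm k)) `&` past (quot_proj G (zp k))); split.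
  - by exists (quot_proj G (zm k)), (quot_proj G (zp k)).
  - split.
      have [|_ f _] := @vert_n (t0 - eps k) t0 (inm k) inz; first by rewrite ltrBlDr ltrDl eps_gt0.
      by rewrite zs0 in f.
    have [|_ f _] := @vert_n t0 (t0 + eps k) inz (inp k); first by rewrite ltrDl eps_gt0.
    by rewrite zs0 in f.
  move=> u [fu pu].
  have [w wu J1] := future_lift Le Lclosed La Gpres (erefl (quot_proj G (zm k))) fu.
  have [w' w'p J2] := future_lift Le Lclosed La Gpres wu pu.
  have /quot_projP[g Gg gw] := esym w'p.
  have Sg : S k g by split=> //; rewrite gw; exact: Jinf_trans J1 J2.
  have gid := hk0 k hk g Sg; rewrite -wu; apply: sub; first exact: (J1 id (subgroup_id G)).
  by move: gw; rewrite gid => ->; exact: (J2 id (subgroup_id G)).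
apply: contrapT => h.
have pick k : exists w : Etype L, [/\ causal_le (to_cyl (to_ads (zm (k0 + k)%N))) (to_cyl (to_ads w)),
    causal_le (to_cyl (to_ads w)) (to_cyl (to_ads (zp (k0 + k)%N))) & ~ W (quot_proj G w)].
  apply: contrapT => hk; apply: h; exists (k0 + k)%N; first exact: leq_addr.
  by move=> w h1 h2; apply: contrapT => nw; apply: hk; exists w.
pose w k := sval (cid (pick k)); have hw k := svalP (cid (pick k)).
have [U [UU sU]] := ultraFilterLemma (@eventually_filter).
have UF : Filter U by exact: filter_filter.
have PU : ProperFilter U by exact: ultra_proper.
have shift (f : nat -> cyl R) (q : cyl R) : f @ \oo --> q -> (fun k => f (k0 + k)%N) @ U --> q.
  move=> fq; apply: (@cvg_trans _ ((fun k => f (k0 + k)%N) @ \oo)).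
    by move=> V hV; exact: sU.
  move=> V /fq[N _ hN]; exists N => // m hm; apply: hN => /=.
  exact: leq_trans hm (leq_addl _ _).
have cm : to_cyl (to_ads (zm (k0 + k)%N)) @[k --> U] --> to_cyl (to_ads z).
  by apply: (shift (fun k => to_cyl (to_ads (zm k)))); exact: cvg_m.
have cp : to_cyl (to_ads (zp (k0 + k)%N)) @[k --> U] --> to_cyl (to_ads z).
  by apply: (shift (fun k => to_cyl (to_ads (zp k)))); exact: cvg_p.
pose f k := to_cyl (to_ads (w k)).
have tmv k : tm (to_cyl (to_ads (zm k))) = t0 - eps k /\ tm (to_cyl (to_ads (zp k))) = t0 + eps k.
  rewrite !tm_crd -!chartE !chart_zs ?inm ?inp //.
  by have [_ _ e1] := row3E (chart (to_ads z) 0 0) (chart (to_ads z) 0 1) (t0 - eps k);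
     have [_ _ e2] := row3E (chart (to_ads z) 0 0) (chart (to_ads z) 0 1) (t0 + eps k).
pose K := [set q : cyl R | `|tm q| <= `|t0| + n].
have cK : compact K.
  apply: (@cyl_compact R K (`|t0| + n)) => //.
  apply: (@closed_comp _ _ (fun q : cyl R => `|tm q|) [set x | x <= `|t0| + n]); last exact: closed_le.
  by move=> q _; exact: (cvg_norm (@tm_continuous R q)).
have fK' k (r : cyl R) : causal_le (to_cyl (to_ads (zm k))) r -> causal_le r (to_cyl (to_ads (zp k))) -> K r.
  have [m1 p1] := tmv k; rewrite /causal_le m1 p1 => h1 h2.
  have d1 := sdist_ge0 (unit_pt (to_cyl (to_ads (zm k)))) (unit_pt r).
  have d2 := sdist_ge0 (unit_pt r) (unit_pt (to_cyl (to_ads (zp k)))).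
  have el := eps_lt k; have a1 := ler_norm t0; have a2 := ler_norm (- t0); rewrite normrN in a2.
  rewrite /K /= real_ler_norml ?num_real //; apply/andP.
  by move: (tm r) h1 h2 => x h1 h2; split; lra.
have fK k : K (f k) by have [h1 h2 _] := hw k; exact: (fK' _ _ h1 h2).
have [q [Kq fq]] : exists q, K q /\ f @ U --> q.
  have UK : U (fun k => K (f k)) by exact: (@filterS nat U UF _ _ (fun k _ => fK k) (@filterT nat U UF)).
  move: cK; rewrite compact_ultra => cK.
  by have [q [Kq hq]] := cK _ (ultra_fmap f UU) UK; exists q.
have Ball (P : nat -> Prop) : (forall k, P k) -> \forall k \near U, P k.
  by move=> hP; exact: (@filterS nat U UF _ _ (fun k _ => hP k) (@filterT nat U UF)).
have J1 : causal_le (to_cyl (to_ads z)) q.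
  have b k : causal_le (to_cyl (to_ads (zm (k0 + k)%N))) (f k) by have [] := hw k.
  have b' : \forall k \near U, causal_le (to_cyl (to_ads (zm (k0 + k)%N))) (f k) by exact: (Ball _ b).
  by have := @causal_closed R nat U PU (fun k => to_cyl (to_ads (zm (k0 + k)%N))) f _ _ cm fq b'.
have J2 : causal_le q (to_cyl (to_ads z)).
  have b k : causal_le (f k) (to_cyl (to_ads (zp (k0 + k)%N))) by have [] := hw k.
  have b' : \forall k \near U, causal_le (f k) (to_cyl (to_ads (zp (k0 + k)%N))) by exact: (Ball _ b).
  by have := @causal_closed R nat U PU f (fun k => to_cyl (to_ads (zp (k0 + k)%N))) _ _ fq cp b'.
have qz : q = to_cyl (to_ads z) := esym (causal_antisym J1 J2).
have wz : w @ U --> z.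
  apply: (@cvg_set_type _ (Edom L) _ U UF w z); apply: (@cvg_ads _ _ U UF (fun k => to_ads (w k)) (to_ads z)).
  by rewrite -qz.
have Wn : U (fun k => W (quot_proj G (w k))) by exact: (wz _ nV).
by have [k Wk] := filter_ex Wn; have [_ _] := hw k; apply.
Qed.

End Point.

Lemma strongly_causal_quotient : strongly_causal G L.
Proof.
split=> [_ [[x y] _ <-]|x W nW].
  by apply: openI; [apply: future_open|apply: past_open].
have [z zx] := quot_proj_surj x; have [n n0 hn] : exists2 n : R, 0 < n & forall s t : R, `|s - tm (to_cyl (to_ads z))| < n ->
    `|t - tm (to_cyl (to_ads z))| < n -> s < t ->
    [/\ chart (to_ads (toE z (vline z s))) = vline z s,
      future (quot_proj G (toE z (vline z s))) (quot_proj G (toE z (vline z t))) &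
      Jinf G (to_ads (toE z (vline z s))) (to_ads (toE z (vline z t)))].
  by apply: vertical_timelike.
rewrite -zx in nW *; have [U [[p [q Upq]] Uz UW]] := small_diamond n0 hn nW.
by exists U => //; split=> //; exists (p, q).
Qed.

End Diamond.

Theorem theorem10p1 (R : realType) (L : set (cyl R)) (G : subgroup R)
    (L_ein : L `<=` @ein R) (L_closed : closed L) (L_achronal : achronal L)
    (L_generic : generic L) (L_nonelementary : nonelementary L)
    (G_torsion_free : torsion_free G) (G_discrete : discrete G)
    (G_preserves : preserves G L) :
  [/\ preserves_dom G (@extension R) (Omega L),
      free_action G (@extension R) (Omega L) &
      properly_discontinuous G (@extension R) (Omega L)] /\
  [/\ preserves_dom G id (Edom L),
      free_action G id (Edom L) &
      properly_discontinuous G id (Edom L)] /\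
  strongly_causal G L.
Proof.
split; [split|split; [split|]].
- exact: Omega_preserved.
- exact: free_Omega.
- exact: proper_Omega.
- exact: Edom_preserved.
- exact: free_Edom.
- exact: proper_Edom.
- exact: strongly_causal_quotient.
Qed.
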